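(* Let $\alpha>0$ and for a holomorphic $g(z)=\sum_{k\ge0}\hat g(k)z^k$ on the unit disk let $\sigma_n^\alpha(g):=\sum_{k=0}^n\binom{n}{k}\big/\binom{n+\alpha}{k}\,\hat g(k)z^k$. Then: (1) $\|\sigma_n^\alpha(g)-g\|_{H^1}\to0$ for all $g\in H^1$; (2) $\sigma_n^\alpha(h)\to h$ weak* in $\mathrm{BMOA}$ for all $h\in\mathrm{BMOA}$; (3) $\|\sigma_n^\alpha(f)-f\|_{\mathrm{BMOA}}\to0$ for all $f\in\mathrm{VMOA}$.
   Context: Binomial coefficients with non-integer arguments are defined via the Gamma function. $H^1$ is the Hardy space on the unit disk $\mathbb D$. $\mathrm{BMOA}$ is the space of $f\in H^2$ with $\|f\|_{\mathrm{BMOA}}:=|f(0)|+\sup_{\mathbb D}(P|f|^2-|f|^2)^{1/2}<\infty$ ($P$ the Poisson integral), and $\mathrm{VMOA}$ the closed subspace where $(P|f|^2-|f|^2)(z)\to0$ as $|z|\to1$. $\mathrm{BMOA}$ is identified (up to isomorphism) with $(H^1)^*$ via $\langle g,h\rangle=\lim_{r\to1^-}\frac1{2\pi}\int_0^{2\pi}g(re^{i\theta})h(re^{-i\theta})d\theta$; weak* refers to this duality. *)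

(* Defs.v *)
From Stdlib Require Import Reals ClassicalEpsilon Arith.
From Coquelicot Require Import Coquelicot.
Open Scope R_scope.

(* A holomorphic function on the unit disk is given by its Taylor coefficients
   ghat : nat -> C, with the power series converging on the open disk. *)
Definition holo_disk (a : nat -> C) : Prop :=
  forall z : C, Cmod z < 1 -> ex_series (fun k => Cmod (a k * z ^ k)%C).

Definition peval (a : nat -> C) (z : C) : C :=
  (Series (fun k => fst (a k * z ^ k)%C), Series (fun k => snd (a k * z ^ k)%C)).

Definition cis (t : R) : C := (cos t, sin t).

Definition M1 (a : nat -> C) (r : R) : R :=
  / (2 * PI) * RInt (fun t => Cmod (peval a (RtoC r * cis t)%C)) 0 (2 * PI).
Definition M2sq (a : nat -> C) (r : R) : R :=
  / (2 * PI) * RInt (fun t => Cmod (peval a (RtoC r * cis t)%C) ^ 2) 0 (2 * PI).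

Definition H1_norm (a : nat -> C) : Rbar :=
  Lub_Rbar (fun m => exists r, 0 <= r < 1 /\ m = M1 a r).
Definition in_H1 (a : nat -> C) : Prop := holo_disk a /\ Rbar_lt (H1_norm a) p_infty.
Definition in_H2 (a : nat -> C) : Prop :=
  holo_disk a /\ Rbar_lt (Lub_Rbar (fun m => exists r, 0 <= r < 1 /\ m = M2sq a r)) p_infty.

(* the limit as r -> 1^- (chosen by Hilbert's epsilon; meaningful when it exists) *)
Definition lim_left1 (h : R -> R) : R :=
  epsilon (inhabits 0) (fun L => filterlim h (at_left 1) (locally L)).

Definition poisson (z : C) (t : R) : R := (1 - Cmod z ^ 2) / (Cmod (cis t - z)%C) ^ 2.

(* (P|f|^2)(z): Poisson integral of |f|^2 (boundary values), realised as the limit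
   r -> 1^- of the Poisson integrals of |f(r e^{it})|^2 *)
Definition P_abs2 (a : nat -> C) (z : C) : R :=
  lim_left1 (fun r => / (2 * PI) *
     RInt (fun t => Cmod (peval a (RtoC r * cis t)%C) ^ 2 * poisson z t) 0 (2 * PI)).

Definition bmo_gap (a : nat -> C) (z : C) : R := P_abs2 a z - Cmod (peval a z) ^ 2.

Definition BMOA_norm (a : nat -> C) : Rbar :=
  Rbar_plus (Cmod (peval a (RtoC 0)))
    (Lub_Rbar (fun s => exists z : C, Cmod z < 1 /\ s = sqrt (bmo_gap a z))).

Definition in_BMOA (a : nat -> C) : Prop := in_H2 a /\ Rbar_lt (BMOA_norm a) p_infty.

Definition in_VMOA (a : nat -> C) : Prop :=
  in_BMOA a /\
  forall eps, 0 < eps -> exists d, 0 < d /\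
    forall z : C, 1 - d < Cmod z < 1 -> Rabs (bmo_gap a z) <= eps.

Definition pairing (g h : nat -> C) : C :=
  (lim_left1 (fun r => / (2 * PI) *
      RInt (fun t => fst (peval g (RtoC r * cis t) * peval h (RtoC r * cis (- t)))%C) 0 (2 * PI)),
   lim_left1 (fun r => / (2 * PI) *
      RInt (fun t => snd (peval g (RtoC r * cis t) * peval h (RtoC r * cis (- t)))%C) 0 (2 * PI))).

(* generalized binomial coefficient binom(x, k) = x(x-1)...(x-k+1)/k!
   (= Gamma(x+1)/(Gamma(k+1) Gamma(x-k+1)) whenever the Gammas are defined) *)
Fixpoint falling (x : R) (k : nat) : R :=
  match k with O => 1 | S k' => falling x k' * (x - INR k') end.
Definition gbinom (x : R) (k : nat) : R := falling x k / INR (Factorial.fact k).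

Definition sigma_na (alpha : R) (n : nat) (a : nat -> C) (k : nat) : C :=
  if (k <=? n)%nat then (RtoC (gbinom (INR n) k / gbinom (INR n + alpha) k) * a k)%C
  else RtoC 0.

Definition csub (a b : nat -> C) (k : nat) : C := (a k - b k)%C.

(* Main.v *)
(* The means sigma_n^alpha are convolutions with kernels that are bounded in L^1 of the circle
   (Abel summation).  The gap P|h|^2 - |h|^2 at z equals (1 - |z|^2) sum_(m >= 1) |h_m(z)|^2, with
   h_m the m-th backward shift of h, so its square root is a Hilbert seminorm and Minkowski's
   inequality bounds sigma_n^alpha on BMOA; with l^2 convergence on compact subsets of the disk this
   gives (3).

   For (1) and (2), let p and h be polynomials, h with gap G <= M^2.  In the variable log z the
   function lam |p| + (e M^2 / lam) |p| exp (- G / M^2) - Re (p conj h) is subharmonic, because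
   - Laplacian G = 4 |h'|^2 and |p| is logarithmically subharmonic.  Hence its circle means are
   convex in x = log |z|; comparing the value at x = 0 with the tangent at x = log r gives
     |sum_k (1 - m_k) p_k h_k| <= lam (|p|_1 - |p_r|_1) + (C M^2 / lam) |p|_1,
   where p_r(z) = p(r z) and m_k = r^(2k) (1 - 2 k log r).  As r -> 0 this is Fefferman's
   inequality, hence the boundedness of the pairing.  Conversely the L^1 norm of p is recovered from
   Riesz projections h of unimodular functions, whose gap is at most 1 by Bessel's inequality.  So
   sigma_n^alpha is bounded on H^1, and, choosing lam large and then r with |g|_1 - |g_r|_1 small,
   g - g * m is small in H^1 while g * m has absolutely summable coefficients: no boundary values
   are needed. *)
Require Import Defs.
From Stdlib Require Import Reals Arith Lra Lia ClassicalEpsilon.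
From Coquelicot Require Import Coquelicot.
Open Scope R_scope.

(** The obstacle is that the pairing is a limit whose existence is not known beforehand, and that
    $H^1$ is given only by means over circles inside the disk. Inequalities are therefore proved for
    polynomials on the unit circle, with constants independent of the degree, and reach $g$ through
    its dilations. The exponential makes the gap usable as a weight: $-G/M^2$ lies between $-1$ and
    $0$, so $|p|e^{-G/M^2}$ stays comparable to $|p|$ while its Laplacian gains $|p|\,|h'|^2$. The
    factor $e$ in the weight repays the loss $e^{-1}$. Against the term $|p'|^2/|p|$ coming from
    $|p|$, the arithmetic-geometric inequality then absorbs $4|p'|\,|h'|$, the size of the Laplacian
    of $\mathrm{Re}(p\bar h)$. In the tangent inequality the slopes of the first two means have a
    favourable sign, being slopes of convex functions that stay bounded as $x\to-\infty$; only the
    slope of the mean of $\mathrm{Re}(p\bar h)$ survives, and it produces the factor $1-2k\log r$ of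
    $m_k$. *)

(** * Moduli of complex numbers *)

Lemma C_ext (z w : C) : Re z = Re w -> Im z = Im w -> z = w.
Proof. destruct z, w; simpl; intros; subst; reflexivity. Qed.

Lemma Re_plus (z w : C) : Re (z + w)%C = Re z + Re w.
Proof. reflexivity. Qed.
Lemma Im_plus (z w : C) : Im (z + w)%C = Im z + Im w.
Proof. reflexivity. Qed.
Lemma Re_mult (z w : C) : Re (z * w)%C = Re z * Re w - Im z * Im w.
Proof. reflexivity. Qed.
Lemma Im_mult (z w : C) : Im (z * w)%C = Re z * Im w + Im z * Re w.
Proof. reflexivity. Qed.

Lemma Re_le_Cmod (z : C) : Re z <= Cmod z.
Proof. eapply Rle_trans; [apply Rle_abs | apply re_le_Cmod]. Qed.

Lemma Im_le_Cmod (z : C) : Rabs (Im z) <= Cmod z.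
Proof. eapply Rle_trans; [|apply Rmax_Cmod]; apply Rmax_r. Qed.

Lemma Cmod_le_abs (z : C) : Cmod z <= Rabs (Re z) + Rabs (Im z).
Proof.
  replace z with (RtoC (Re z) + Ci * RtoC (Im z))%C at 1.
  2:{ destruct z; apply C_ext; simpl; ring. }
  eapply Rle_trans; [apply Cmod_triangle|].
  rewrite Cmod_mult, Cmod_Ci, !Cmod_R; lra.
Qed.

Lemma Cmod_minus_sym (z w : C) : Cmod (z - w)%C = Cmod (w - z)%C.
Proof. rewrite <- Cmod_opp; f_equal; ring. Qed.

Lemma Cmod_triangle_inv (z w : C) : Rabs (Cmod z - Cmod w) <= Cmod (z - w)%C.
Proof.
  apply Rabs_le; split.
  - assert (H := Cmod_triangle (w - z) z). rewrite (Cmod_minus_sym z w).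
    replace (w - z + z)%C with w in H by ring. lra.
  - assert (H := Cmod_triangle (z - w) w).
    replace (z - w + w)%C with z in H by ring. lra.
Qed.

Lemma Cmod_sub_trans (a b c : C) : Cmod (a - c)%C <= Cmod (a - b)%C + Cmod (b - c)%C.
Proof.
  replace (a - c)%C with ((a - b) + (b - c))%C by ring. apply Cmod_triangle.
Qed.

Lemma Cmod_zero_small (z : C) : (forall eps, 0 < eps -> Cmod z <= eps) -> z = RtoC 0.
Proof.
  intros H. apply Cmod_eq_0. apply Rle_antisym; [|apply Cmod_ge_0].
  apply le_epsilon; intros e He; rewrite Rplus_0_l; auto.
Qed.

Lemma Cmod2_real (z : C) : (z * Cconj z)%C = RtoC (Cmod z ^ 2).
Proof. symmetry; rewrite <- Cmod2_conj. reflexivity. Qed.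

(** * Finite sums *)

Fixpoint rsum (f : nat -> R) (n : nat) : R :=
  match n with O => 0 | S m => rsum f m + f m end.

Fixpoint csum (f : nat -> C) (n : nat) : C :=
  match n with O => RtoC 0 | S m => (csum f m + f m)%C end.

Lemma rsum_ext f g n : (forall k, (k < n)%nat -> f k = g k) -> rsum f n = rsum g n.
Proof.
  induction n as [|n IH]; intros H; simpl; auto.
  rewrite IH, H; auto.
Qed.

Lemma csum_ext f g n : (forall k, (k < n)%nat -> f k = g k) -> csum f n = csum g n.
Proof.
  induction n as [|n IH]; intros H; simpl; auto.
  rewrite IH, H; auto.
Qed.

Lemma rsum_plus f g n : rsum (fun k => f k + g k) n = rsum f n + rsum g n.
Proof. induction n as [|n IH]; simpl; [|rewrite IH]; lra. Qed.

Lemma rsum_scal c f n : rsum (fun k => c * f k) n = c * rsum f n.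
Proof. induction n as [|n IH]; simpl; [|rewrite IH]; lra. Qed.

Lemma rsum_le f g n : (forall k, (k < n)%nat -> f k <= g k) -> rsum f n <= rsum g n.
Proof.
  induction n as [|n IH]; intros H; simpl; [lra|].
  apply Rplus_le_compat; auto.
Qed.

Lemma rsum_0 n : rsum (fun _ => 0) n = 0.
Proof. induction n as [|n IH]; simpl; lra. Qed.

Lemma rsum_nonneg f n : (forall k, (k < n)%nat -> 0 <= f k) -> 0 <= rsum f n.
Proof. intros H; rewrite <- (rsum_0 n); apply rsum_le; auto. Qed.

Lemma rsum_mono f n m : (forall k, 0 <= f k) -> (n <= m)%nat -> rsum f n <= rsum f m.
Proof. intros H; induction 1; simpl; [lra|]; specialize (H m); lra. Qed.

Lemma rsum_app f n m : rsum f (n + m) = rsum f n + rsum (fun k => f (n + k)%nat) m.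
Proof.
  induction m as [|m IH]; [rewrite Nat.add_0_r; simpl; lra|].
  rewrite Nat.add_succ_r; simpl; rewrite IH; lra.
Qed.

Lemma csum_app f n m : csum f (n + m) = (csum f n + csum (fun k => f (n + k)%nat) m)%C.
Proof.
  induction m as [|m IH]; [rewrite Nat.add_0_r; simpl; ring|].
  rewrite Nat.add_succ_r; simpl; rewrite IH; ring.
Qed.

Lemma rsum_swap (f : nat -> nat -> R) n m :
  rsum (fun i => rsum (f i) m) n = rsum (fun j => rsum (fun i => f i j) n) m.
Proof.
  induction n as [|n IH]; simpl; [symmetry; apply rsum_0|].
  rewrite IH, <- rsum_plus; reflexivity.
Qed.

Lemma csum_0 n : csum (fun _ => RtoC 0) n = RtoC 0.
Proof. induction n as [|n IH]; simpl; [|rewrite IH]; ring. Qed.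

Lemma csum_plus f g n : csum (fun k => f k + g k)%C n = (csum f n + csum g n)%C.
Proof. induction n as [|n IH]; simpl; [|rewrite IH]; ring. Qed.

Lemma csum_minus f g n : csum (fun k => f k - g k)%C n = (csum f n - csum g n)%C.
Proof. induction n as [|n IH]; simpl; [|rewrite IH]; ring. Qed.

Lemma csum_scal c f n : csum (fun k => c * f k)%C n = (c * csum f n)%C.
Proof. induction n as [|n IH]; simpl; [|rewrite IH]; ring. Qed.

Lemma csum_scal_r c f n : csum (fun k => f k * c)%C n = (csum f n * c)%C.
Proof. induction n as [|n IH]; simpl; [|rewrite IH]; ring. Qed.

Lemma csum_swap (f : nat -> nat -> C) n m :
  csum (fun i => csum (f i) m) n = csum (fun j => csum (fun i => f i j) n) m.
Proof.
  induction n as [|n IH]; simpl; [symmetry; apply csum_0|].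
  rewrite IH, <- csum_plus; reflexivity.
Qed.

Lemma csum_conj f n : Cconj (csum f n) = csum (fun k => Cconj (f k)) n.
Proof.
  induction n as [|n IH]; simpl; [apply C_ext; simpl; ring|].
  rewrite Cplus_conj, IH; reflexivity.
Qed.

Lemma csum_Re f n : Re (csum f n) = rsum (fun k => Re (f k)) n.
Proof. induction n as [|n IH]; simpl; [reflexivity|]; rewrite <- IH; reflexivity. Qed.

Lemma csum_Im f n : Im (csum f n) = rsum (fun k => Im (f k)) n.
Proof. induction n as [|n IH]; simpl; [reflexivity|]; rewrite <- IH; reflexivity. Qed.

Lemma csum_RtoC f n : csum (fun k => RtoC (f k)) n = RtoC (rsum f n).
Proof.
  induction n as [|n IH]; simpl; [reflexivity|]. rewrite IH, RtoC_plus; reflexivity.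
Qed.

Lemma csum_Cmod_le f n : Cmod (csum f n) <= rsum (fun k => Cmod (f k)) n.
Proof.
  induction n as [|n IH]; simpl; [rewrite Cmod_0; lra|].
  eapply Rle_trans; [apply Cmod_triangle|]; lra.
Qed.

Lemma csum_single f n j : (j < n)%nat -> (forall k, (k < n)%nat -> k <> j -> f k = RtoC 0) ->
  csum f n = f j.
Proof.
  intros Hj H. induction n as [|n IH]; [lia|]. simpl.
  destruct (Nat.eq_dec j n) as [->|Hn].
  - rewrite (csum_ext f (fun _ => RtoC 0)), csum_0 by (intros; apply H; lia). ring.
  - rewrite IH, (H n) by (try (intros; apply H); lia). ring.
Qed.

Lemma csum_trunc f n m : (n <= m)%nat -> (forall k, (n <= k < m)%nat -> f k = RtoC 0) ->
  csum f m = csum f n.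
Proof.
  intros Hnm; induction Hnm as [|m Hnm IH]; intros H; simpl; [reflexivity|].
  rewrite IH, (H m) by (try (intros; apply H); lia). ring.
Qed.

Lemma rsum_trunc f n m : (n <= m)%nat -> (forall k, (n <= k < m)%nat -> f k = 0) ->
  rsum f m = rsum f n.
Proof.
  intros Hnm; induction Hnm as [|m Hnm IH]; intros H; simpl; [reflexivity|].
  rewrite IH, (H m) by (try (intros; apply H); lia). ring.
Qed.

Lemma rsum_shift f n : rsum f (S n) = f O + rsum (fun k => f (S k)) n.
Proof. induction n as [|n IH]; simpl in *; [|rewrite IH]; lra. Qed.

Lemma csum_shift f n : csum f (S n) = (f O + csum (fun k => f (S k)) n)%C.
Proof. induction n as [|n IH]; simpl in *; [ring|rewrite IH; ring]. Qed.

(** By induction: the new cross term [2 * s * (a n * b n)] is at most [A * b n ^ 2 + B * a n ^ 2],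
    which follows, after squaring, from [s ^ 2 <= A * B] and the square of a difference. *)
Lemma rsum_CS_sq (a b : nat -> R) n :
  rsum (fun k => a k * b k) n ^ 2 <= rsum (fun k => a k ^ 2) n * rsum (fun k => b k ^ 2) n.
Proof.
  induction n as [|n IH]; cbn [rsum]; [lra|].
  set (s := rsum (fun k => a k * b k) n) in *.
  set (A := rsum (fun k => a k ^ 2) n) in *. set (B := rsum (fun k => b k ^ 2) n) in *.
  assert (HA : 0 <= A) by (apply rsum_nonneg; intros; apply pow2_ge_0).
  assert (HB : 0 <= B) by (apply rsum_nonneg; intros; apply pow2_ge_0).
  assert (H : 2 * s * (a n * b n) <= A * b n ^ 2 + B * a n ^ 2).
  { assert (H0 : (2 * s * (a n * b n)) ^ 2 <= (A * b n ^ 2 + B * a n ^ 2) ^ 2).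
    { assert (H1 := pow2_ge_0 (A * b n ^ 2 - B * a n ^ 2)).
      assert (H2 : 0 <= (A * B - s ^ 2) * (a n * b n) ^ 2)
        by (apply Rmult_le_pos; [lra|apply pow2_ge_0]).
      replace ((A * b n ^ 2 + B * a n ^ 2) ^ 2)
        with ((2 * s * (a n * b n)) ^ 2 + (A * b n ^ 2 - B * a n ^ 2) ^ 2
              + 4 * ((A * B - s ^ 2) * (a n * b n) ^ 2)) by ring.
      lra. }
    apply Rsqr_incr_0_var; [rewrite !Rsqr_pow2; exact H0|].
    assert (0 <= A * b n ^ 2) by (apply Rmult_le_pos; auto; apply pow2_ge_0).
    assert (0 <= B * a n ^ 2) by (apply Rmult_le_pos; auto; apply pow2_ge_0). lra. }
  replace ((s + a n * b n) ^ 2) with (s ^ 2 + 2 * s * (a n * b n) + a n ^ 2 * b n ^ 2) by ring.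
  replace ((A + a n ^ 2) * (B + b n ^ 2))
    with (A * B + (A * b n ^ 2 + B * a n ^ 2) + a n ^ 2 * b n ^ 2) by ring.
  lra.
Qed.

Lemma csum_CS (u v : nat -> C) n :
  Cmod (csum (fun k => u k * v k)%C n)
  <= sqrt (rsum (fun k => Cmod (u k) ^ 2) n) * sqrt (rsum (fun k => Cmod (v k) ^ 2) n).
Proof.
  assert (HA : 0 <= rsum (fun k => Cmod (u k) ^ 2) n)
    by (apply rsum_nonneg; intros; apply pow2_ge_0).
  assert (HB : 0 <= rsum (fun k => Cmod (v k) ^ 2) n)
    by (apply rsum_nonneg; intros; apply pow2_ge_0).
  rewrite <- sqrt_mult by assumption.
  eapply Rle_trans; [apply csum_Cmod_le|].
  apply Rsqr_incr_0_var; [|apply sqrt_pos].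
  rewrite Rsqr_sqrt by (apply Rmult_le_pos; assumption).
  rewrite (rsum_ext _ (fun k => Cmod (u k) * Cmod (v k))) by (intros; apply Cmod_mult).
  assert (H := rsum_CS_sq (fun k => Cmod (u k)) (fun k => Cmod (v k)) n).
  unfold Rsqr; simpl in *; lra.
Qed.

Lemma geom_sum (z : C) n : ((1 - z) * csum (fun k => z ^ k) n = 1 - z ^ n)%C.
Proof.
  induction n as [|n IH]; cbn [csum]; [simpl; ring|].
  rewrite Cmult_plus_distr_l, IH, Cpow_S. ring.
Qed.

Lemma rgeom_le (r : R) n : 0 <= r < 1 -> rsum (fun k => r ^ k) n <= / (1 - r).
Proof.
  intros Hr.
  assert (H : (1 - r) * rsum (fun k => r ^ k) n = 1 - r ^ n).
  { induction n as [|n IH]; simpl; [ring|]. rewrite Rmult_plus_distr_l, IH. ring. }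
  apply Rmult_le_reg_l with (1 - r); [lra|].
  rewrite H, Rinv_r by lra. assert (0 <= r ^ n) by (apply pow_le; lra). lra.
Qed.

(** * Continuity and circle means *)

Definition rcont (f : R -> R) : Prop := forall t, continuous f t.
Definition ccont (f : R -> C) : Prop := rcont (fun t => Re (f t)) /\ rcont (fun t => Im (f t)).

Lemma rcont_ext f g : (forall t, f t = g t) -> rcont f -> rcont g.
Proof. intros H Hf t. apply (continuous_ext f); auto. Qed.

Lemma rcont_const c : rcont (fun _ => c).
Proof. intros t; apply continuous_const. Qed.

Lemma rcont_plus f g : rcont f -> rcont g -> rcont (fun t => f t + g t).
Proof. intros Hf Hg t; apply (continuous_plus (V := R_NormedModule) f g); auto. Qed.

Lemma rcont_opp f : rcont f -> rcont (fun t => - f t).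
Proof. intros Hf t; apply (continuous_opp (V := R_NormedModule) f); auto. Qed.

Lemma rcont_minus f g : rcont f -> rcont g -> rcont (fun t => f t - g t).
Proof. intros Hf Hg; apply rcont_plus; auto using rcont_opp. Qed.

Lemma rcont_mult f g : rcont f -> rcont g -> rcont (fun t => f t * g t).
Proof. intros Hf Hg t; apply (continuous_mult (K := R_AbsRing) f g); auto. Qed.

Lemma rcont_comp f g : rcont f -> rcont g -> rcont (fun t => f (g t)).
Proof. intros Hf Hg t; apply (continuous_comp g f); auto. Qed.

Lemma rcont_pow f n : rcont f -> rcont (fun t => f t ^ n).
Proof.
  intros Hf; induction n as [|n IH]; simpl; auto using rcont_const, rcont_mult.
Qed.

Lemma rcont_sqrt f : rcont f -> rcont (fun t => sqrt (f t)).
Proof. intros Hf t; apply (continuous_comp f sqrt); auto; apply continuous_sqrt. Qed.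

Lemma rcont_inv f : rcont f -> (forall t, f t <> 0) -> rcont (fun t => / f t).
Proof. intros Hf H t. apply (continuous_comp f Rinv); auto. apply continuous_Rinv; auto. Qed.

Lemma rcont_abs f : rcont f -> rcont (fun t => Rabs (f t)).
Proof. intros Hf t; apply (continuous_comp f Rabs); auto; apply continuous_Rabs. Qed.

Lemma rcont_derivable (f : R -> R) : (forall t, ex_derive f t) -> rcont f.
Proof. intros H t; apply (ex_derive_continuous f t (H t)). Qed.

Lemma rcont_id : rcont (fun t => t).
Proof. intros t; apply continuous_id. Qed.

Lemma rcont_cos f : rcont f -> rcont (fun t => cos (f t)).
Proof. intros Hf t; apply (continuous_comp f cos); auto; apply continuous_cos. Qed.
Lemma rcont_sin f : rcont f -> rcont (fun t => sin (f t)).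
Proof. intros Hf t; apply (continuous_comp f sin); auto; apply continuous_sin. Qed.

Lemma ccont_ext f g : (forall t, f t = g t) -> ccont f -> ccont g.
Proof.
  intros H [H1 H2]; split; [apply (rcont_ext _ _ (fun t => f_equal Re (H t)) H1)
    |apply (rcont_ext _ _ (fun t => f_equal Im (H t)) H2)].
Qed.

Lemma ccont_const c : ccont (fun _ => c).
Proof. split; apply rcont_const. Qed.

Lemma ccont_RtoC f : rcont f -> ccont (fun t => RtoC (f t)).
Proof. split; simpl; auto using rcont_const. Qed.

Lemma ccont_plus f g : ccont f -> ccont g -> ccont (fun t => f t + g t)%C.
Proof. intros [? ?] [? ?]; split; simpl; apply rcont_plus; auto. Qed.

Lemma ccont_opp f : ccont f -> ccont (fun t => - f t)%C.
Proof. intros [? ?]; split; simpl; apply rcont_opp; auto. Qed.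

Lemma ccont_minus f g : ccont f -> ccont g -> ccont (fun t => f t - g t)%C.
Proof. intros; apply ccont_plus; auto using ccont_opp. Qed.

Lemma ccont_mult f g : ccont f -> ccont g -> ccont (fun t => f t * g t)%C.
Proof.
  intros [? ?] [? ?]; split; simpl; [apply rcont_minus|apply rcont_plus];
    apply rcont_mult; auto.
Qed.

Lemma ccont_conj f : ccont f -> ccont (fun t => Cconj (f t)).
Proof. intros [? ?]; split; simpl; auto using rcont_opp. Qed.

Lemma ccont_pow f n : ccont f -> ccont (fun t => f t ^ n)%C.
Proof. intros Hf; induction n as [|n IH]; simpl; auto using ccont_const, ccont_mult. Qed.

Lemma ccont_csum f n : (forall k, (k < n)%nat -> ccont (f k)) -> ccont (fun t => csum (fun k => f k t) n).
Proof.
  induction n as [|n IH]; intros H; simpl; [apply ccont_const|].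
  apply ccont_plus; auto.
Qed.

Lemma rcont_rsum f n : (forall k, (k < n)%nat -> rcont (f k)) -> rcont (fun t => rsum (fun k => f k t) n).
Proof.
  induction n as [|n IH]; intros H; simpl; [apply rcont_const|].
  apply rcont_plus; auto.
Qed.

Lemma rcont_Re f : ccont f -> rcont (fun t => Re (f t)).
Proof. intros [? ?]; auto. Qed.
Lemma rcont_Im f : ccont f -> rcont (fun t => Im (f t)).
Proof. intros [? ?]; auto. Qed.

Lemma rcont_Cmod f : ccont f -> rcont (fun t => Cmod (f t)).
Proof.
  intros [? ?]. unfold Cmod. apply rcont_sqrt. apply rcont_plus; apply rcont_pow; auto.
Qed.

Lemma ccont_inv f : ccont f -> (forall t, f t <> RtoC 0) -> ccont (fun t => / f t)%C.
Proof.
  intros Hf H.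
  assert (Hn : forall t, Cmod (f t) ^ 2 <> 0).
  { intros t E. apply (H t), Cmod_eq_0. simpl in E; rewrite Rmult_1_r in E.
    apply Rmult_integral in E; tauto. }
  apply ccont_ext with (fun t => RtoC (/ (Cmod (f t) ^ 2)) * Cconj (f t))%C.
  - intros t.
    assert (Hc : Cconj (f t) <> RtoC 0).
    { intros E; apply (H t). rewrite <- (Cconj_conj (f t)), E. apply C_ext; simpl; ring. }
    rewrite RtoC_inv by auto. rewrite <- Cmod2_real. field; auto.
  - apply ccont_mult; [|apply ccont_conj; auto].
    apply ccont_RtoC, rcont_inv; auto. apply rcont_pow, rcont_Cmod; auto.
Qed.

Lemma ccont_cis : ccont cis.
Proof. split; simpl; [apply rcont_cos|apply rcont_sin]; apply rcont_id. Qed.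

Lemma ccont_comp (f : R -> C) g : ccont f -> rcont g -> ccont (fun t => f (g t)).
Proof. intros [H1 H2] Hg; split; [apply (rcont_comp _ g H1 Hg)|apply (rcont_comp _ g H2 Hg)]. Qed.

Create HintDb cont.
#[local] Hint Resolve rcont_const rcont_plus rcont_opp rcont_minus rcont_mult rcont_pow rcont_id
  rcont_abs rcont_cos rcont_sin rcont_sqrt rcont_Cmod rcont_Re rcont_Im
  ccont_const ccont_RtoC ccont_plus ccont_opp ccont_minus ccont_mult ccont_conj ccont_pow
  ccont_cis : cont.

Definition mean (f : R -> R) : R := / (2 * PI) * RInt f 0 (2 * PI).
Definition Cmean (f : R -> C) : C := (mean (fun t => Re (f t)), mean (fun t => Im (f t))).

Lemma two_PI_pos : 0 < 2 * PI.
Proof. assert (H := PI_RGT_0); lra. Qed.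

Lemma rcont_ex_RInt f a b : rcont f -> ex_RInt f a b.
Proof. intros H; apply (ex_RInt_continuous (V := R_CompleteNormedModule)); auto. Qed.

Lemma mean_ext f g : (forall t, f t = g t) -> mean f = mean g.
Proof. intros H; unfold mean; f_equal; apply RInt_ext; auto. Qed.

Lemma mean_const c : mean (fun _ => c) = c.
Proof.
  unfold mean. rewrite RInt_const. unfold scal; simpl; unfold mult; simpl.
  assert (H := two_PI_pos). field. lra.
Qed.

Lemma mean_plus f g : rcont f -> rcont g -> mean (fun t => f t + g t) = mean f + mean g.
Proof.
  intros Hf Hg; unfold mean.
  assert (E : RInt (fun t => f t + g t) 0 (2 * PI) = RInt f 0 (2 * PI) + RInt g 0 (2 * PI))
    by (apply (RInt_plus f g); apply rcont_ex_RInt; auto).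
  rewrite E; ring.
Qed.

Lemma mean_scal c f : rcont f -> mean (fun t => c * f t) = c * mean f.
Proof.
  intros Hf; unfold mean.
  assert (E : RInt (fun t => c * f t) 0 (2 * PI) = c * RInt f 0 (2 * PI))
    by (apply (RInt_scal f 0 (2 * PI) c), rcont_ex_RInt; auto).
  rewrite E; ring.
Qed.

Lemma mean_opp f : rcont f -> mean (fun t => - f t) = - mean f.
Proof.
  intros Hf. rewrite (mean_ext _ (fun t => -1 * f t)) by (intros; ring).
  rewrite mean_scal; auto; ring.
Qed.

Lemma mean_minus f g : rcont f -> rcont g -> mean (fun t => f t - g t) = mean f - mean g.
Proof.
  intros Hf Hg. unfold Rminus. rewrite mean_plus, mean_opp; auto using rcont_opp.
Qed.

Lemma mean_le f g : rcont f -> rcont g -> (forall t, f t <= g t) -> mean f <= mean g.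
Proof.
  intros Hf Hg H; unfold mean.
  apply Rmult_le_compat_l; [left; apply Rinv_0_lt_compat, two_PI_pos|].
  apply RInt_le; auto using rcont_ex_RInt. left; apply two_PI_pos.
Qed.

Lemma mean_ge0 f : rcont f -> (forall t, 0 <= f t) -> 0 <= mean f.
Proof. intros Hf H; rewrite <- (mean_const 0); apply mean_le; auto using rcont_const. Qed.

Lemma Cmean_ext f g : (forall t, f t = g t) -> Cmean f = Cmean g.
Proof. intros H; unfold Cmean; f_equal; apply mean_ext; intros; rewrite H; auto. Qed.

Lemma Cmean_const c : Cmean (fun _ => c) = c.
Proof. unfold Cmean; rewrite !mean_const; destruct c; reflexivity. Qed.

Lemma Cmean_plus f g : ccont f -> ccont g -> Cmean (fun t => f t + g t)%C = (Cmean f + Cmean g)%C.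
Proof.
  intros [? ?] [? ?]; apply C_ext.
  - apply (mean_plus (fun t => Re (f t)) (fun t => Re (g t))); auto.
  - apply (mean_plus (fun t => Im (f t)) (fun t => Im (g t))); auto.
Qed.

Lemma Cmean_scal c f : ccont f -> Cmean (fun t => c * f t)%C = (c * Cmean f)%C.
Proof.
  intros [H1 H2]; apply C_ext.
  - change (mean (fun t => Re c * Re (f t) - Im c * Im (f t))
      = Re c * mean (fun t => Re (f t)) - Im c * mean (fun t => Im (f t))).
    rewrite mean_minus, !mean_scal; auto using rcont_mult, rcont_const.
  - change (mean (fun t => Re c * Im (f t) + Im c * Re (f t))
      = Re c * mean (fun t => Im (f t)) + Im c * mean (fun t => Re (f t))).
    rewrite mean_plus, !mean_scal; auto using rcont_mult, rcont_const.
Qed.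

Lemma Cmean_minus f g : ccont f -> ccont g -> Cmean (fun t => f t - g t)%C = (Cmean f - Cmean g)%C.
Proof.
  intros Hf Hg.
  rewrite (Cmean_ext _ (fun t => f t + (-1) * g t)%C).
  2: intros; apply C_ext; simpl; ring.
  rewrite Cmean_plus, Cmean_scal; auto with cont. apply C_ext; simpl; ring.
Qed.

Lemma Cmean_conj f : ccont f -> Cmean (fun t => Cconj (f t)) = Cconj (Cmean f).
Proof. intros [H1 H2]. apply C_ext; simpl; auto. apply mean_opp; auto. Qed.

Lemma Cmean_RtoC f : Cmean (fun t => RtoC (f t)) = RtoC (mean f).
Proof. apply C_ext; simpl; auto. apply mean_const. Qed.

Lemma Cmean_csum f n : (forall k, (k < n)%nat -> ccont (f k)) ->
  Cmean (fun t => csum (fun k => f k t) n) = csum (fun k => Cmean (f k)) n.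
Proof.
  induction n as [|n IH]; intros H; simpl; [apply Cmean_const|].
  rewrite Cmean_plus, IH; auto. apply ccont_csum; auto.
Qed.

(* Multiplying by the conjugate of the mean reduces to the real case. *)
Lemma Cmod_Cmean f : ccont f -> Cmod (Cmean f) <= mean (fun t => Cmod (f t)).
Proof.
  intros Hf. set (c := Cmean f).
  destruct (Req_dec (Cmod c) 0) as [E|E].
  { rewrite E; apply mean_ge0; auto with cont. intros; apply Cmod_ge_0. }
  assert (Hc : 0 < Cmod c) by (assert (H := Cmod_ge_0 c); lra).
  apply Rmult_le_reg_l with (Cmod c); auto.
  rewrite <- mean_scal by auto with cont.
  replace (Cmod c * Cmod c) with (Re (Cmean (fun t => Cconj c * f t)%C)).
  - change (mean (fun t => Re (Cconj c * f t)%C) <= mean (fun t => Cmod c * Cmod (f t))).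
    apply mean_le; auto with cont.
    intros t. eapply Rle_trans; [apply (Re_le_Cmod (Cconj c * f t)%C)|].
      rewrite Cmod_mult, Cmod_conj; lra.
  - rewrite Cmean_scal by auto. fold c. rewrite Cmult_comm, Cmod2_real; simpl; ring.
Qed.

Lemma cis_add s t : cis (s + t) = (cis s * cis t)%C.
Proof. unfold cis; apply C_ext; simpl; [rewrite cos_plus|rewrite sin_plus]; ring. Qed.

Lemma cis_neg t : cis (- t) = Cconj (cis t).
Proof. unfold cis; apply C_ext; simpl; [rewrite cos_neg|rewrite sin_neg]; ring. Qed.

Lemma cis_0 : cis 0 = RtoC 1.
Proof. unfold cis; rewrite cos_0, sin_0; reflexivity. Qed.

Lemma Cmod_cis t : Cmod (cis t) = 1.
Proof.
  unfold Cmod, cis; simpl. replace (_ + _) with 1; [apply sqrt_1|].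
  assert (H := sin2_cos2 t); unfold Rsqr in H; lra.
Qed.

Lemma cis_conj_r t : (cis t * Cconj (cis t) = 1)%C.
Proof. rewrite Cmod2_real, Cmod_cis. f_equal; ring. Qed.

Lemma cis_pow t k : (cis t ^ k)%C = cis (INR k * t).
Proof.
  induction k as [|k IH]; [simpl; rewrite Rmult_0_l, cis_0; auto|].
  rewrite Cpow_S, IH, S_INR, <- cis_add. f_equal; ring.
Qed.

Lemma Cmean_cis_pow k : (0 < k)%nat -> Cmean (fun t => cis t ^ k)%C = RtoC 0.
Proof.
  intros Hk. assert (Hk' : 0 < INR k) by (apply lt_0_INR; auto).
  rewrite (Cmean_ext _ (fun t => cis (INR k * t))) by (intros; apply cis_pow).
  assert (P : forall n, cos (INR n * (2 * PI)) = 1 /\ sin (INR n * (2 * PI)) = 0).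
  { intros n. replace (INR n * (2 * PI)) with (0 + 2 * INR n * PI) by ring.
    rewrite cos_period, sin_period, cos_0, sin_0; auto. }
  destruct (P k) as [P1 P2].
  apply C_ext; simpl; unfold mean.
  - rewrite (is_RInt_unique _ 0 (2 * PI) (sin (INR k * (2 * PI)) / INR k - sin (INR k * 0) / INR k)).
    + rewrite P2, Rmult_0_r, sin_0. field. split; [lra|apply PI_neq0].
    + apply (is_RInt_derive (fun t => sin (INR k * t) / INR k)).
      * intros t _. auto_derive; auto. field; lra.
      * intros t _. apply rcont_cos; auto with cont.
  - rewrite (is_RInt_unique _ 0 (2 * PI) (- cos (INR k * (2 * PI)) / INR k - - cos (INR k * 0) / INR k)).
    + rewrite P1, Rmult_0_r, cos_0. field. split; [lra|apply PI_neq0].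
    + apply (is_RInt_derive (fun t => - cos (INR k * t) / INR k)).
      * intros t _. auto_derive; auto. field; lra.
      * intros t _. apply rcont_sin; auto with cont.
Qed.

Lemma Cmean_cis_orth j k :
  Cmean (fun t => cis t ^ j * Cconj (cis t ^ k))%C = RtoC (if Nat.eq_dec j k then 1 else 0).
Proof.
  assert (A : forall i d, Cmean (fun t => cis t ^ (i + d) * Cconj (cis t ^ i))%C = Cmean (fun t => cis t ^ d)%C).
  { intros i d. apply Cmean_ext; intros t.
    rewrite Cpow_add_r, Cpow_conj.
    replace (cis t ^ i * cis t ^ d * Cconj (cis t) ^ i)%C with ((cis t * Cconj (cis t)) ^ i * cis t ^ d)%C
      by (rewrite Cpow_mult_l; ring).
    rewrite cis_conj_r, Cpow_1_l; ring. }
  destruct (Nat.eq_dec j k) as [->|Hjk].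
  - assert (B := A k O). rewrite Nat.add_0_r in B. rewrite B.
    rewrite (Cmean_ext _ (fun _ => RtoC 1)); [apply Cmean_const|intros; reflexivity].
  - destruct (Nat.lt_ge_cases k j) as [H|H].
    + replace j with (k + (j - k))%nat by lia. rewrite (A k). apply Cmean_cis_pow; lia.
    + rewrite (Cmean_ext _ (fun t => Cconj (cis t ^ k * Cconj (cis t ^ j)))%C).
      * rewrite Cmean_conj by auto with cont. replace k with (j + (k - j))%nat by lia.
        rewrite (A j), Cmean_cis_pow by lia. apply C_ext; simpl; ring.
      * intros t. rewrite Cmult_conj, Cconj_conj. ring.
Qed.

(** * Power series on the disk *)

Definition pev (p : nat -> C) (n : nat) (z : C) : C := csum (fun k => p k * z ^ k)%C n.
Definition shift (a : nat -> C) (m k : nat) : C := a (m + k)%nat.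

(** The non-strict inequality lets uniform bounds be used as they stand. *)
Definition clim (u : nat -> C) (l : C) : Prop :=
  forall eps, 0 < eps -> exists N, forall n, (N <= n)%nat -> Cmod (u n - l)%C <= eps.

Lemma clim_unique u l l' : clim u l -> clim u l' -> l = l'.
Proof.
  intros H H'. assert (E : (l - l')%C = RtoC 0).
  { apply Cmod_zero_small; intros e He.
    destruct (H (e / 2)) as [N HN]; [lra|]. destruct (H' (e / 2)) as [N' HN']; [lra|].
    specialize (HN (N + N')%nat ltac:(lia)). specialize (HN' (N + N')%nat ltac:(lia)).
    eapply Rle_trans; [apply (Cmod_sub_trans _ (u (N + N')%nat))|].
    rewrite Cmod_minus_sym. lra. }
  replace l with ((l - l') + l')%C by ring. rewrite E; ring.
Qed.

Lemma clim_ext u v l : (forall n, u n = v n) -> clim u l -> clim v l.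
Proof. intros H Hu e He; destruct (Hu e He) as [N HN]; exists N; intros; rewrite <- H; auto. Qed.

Lemma clim_eventually_const u l n0 : (forall n, (n0 <= n)%nat -> u n = l) -> clim u l.
Proof.
  intros H e He; exists n0; intros n Hn; rewrite H by auto.
  replace (l - l)%C with (RtoC 0) by ring. rewrite Cmod_0; lra.
Qed.

Lemma clim_plus u v l l' : clim u l -> clim v l' -> clim (fun n => u n + v n)%C (l + l')%C.
Proof.
  intros H H' e He.
  destruct (H (e / 2)) as [N HN]; [lra|]. destruct (H' (e / 2)) as [N' HN']; [lra|].
  exists (N + N')%nat; intros n Hn.
  specialize (HN n ltac:(lia)). specialize (HN' n ltac:(lia)).
  replace (u n + v n - (l + l'))%C with ((u n - l) + (v n - l'))%C by ring.
  eapply Rle_trans; [apply Cmod_triangle|]; lra.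
Qed.

Lemma clim_scal c u l : clim u l -> clim (fun n => c * u n)%C (c * l)%C.
Proof.
  intros H e He. assert (Hc := Cmod_ge_0 c).
  destruct (H (e / (Cmod c + 1))) as [N HN]; [apply Rdiv_lt_0_compat; lra|].
  exists N; intros n Hn. specialize (HN n Hn).
  replace (c * u n - c * l)%C with (c * (u n - l))%C by ring. rewrite Cmod_mult.
  apply Rle_trans with (Cmod c * (e / (Cmod c + 1))); [apply Rmult_le_compat_l; lra|].
  apply Rmult_le_reg_r with (Cmod c + 1); [lra|].
  replace (Cmod c * (e / (Cmod c + 1)) * (Cmod c + 1)) with (Cmod c * e) by (field; lra). nra.
Qed.

Lemma clim_minus u v l l' : clim u l -> clim v l' -> clim (fun n => u n - v n)%C (l - l')%C.
Proof.
  intros H H'. apply clim_ext with (fun n => u n + (-1) * v n)%C.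
  - intros n; apply C_ext; simpl; ring.
  - replace (l - l')%C with (l + (-1) * l')%C by (apply C_ext; simpl; ring).
    apply clim_plus, clim_scal; auto.
Qed.

Lemma clim_incr u l : clim u l -> clim (fun n => u (S n)) l.
Proof. intros H e He; destruct (H e He) as [N HN]; exists N; intros n Hn; apply HN; lia. Qed.

Lemma clim_Cmod_le u l B : clim u l -> (exists N, forall n, (N <= n)%nat -> Cmod (u n) <= B) -> Cmod l <= B.
Proof.
  intros H [N0 HB]. apply le_epsilon; intros e He. destruct (H e He) as [N HN].
  specialize (HN (N + N0)%nat ltac:(lia)). specialize (HB (N + N0)%nat ltac:(lia)).
  replace l with (u (N + N0)%nat - (u (N + N0)%nat - l))%C by ring.
  unfold Cminus at 1. eapply Rle_trans; [apply Cmod_triangle|]. rewrite Cmod_opp. lra.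
Qed.

Lemma rsum_sum_n f n : sum_n f n = rsum f (S n).
Proof.
  induction n as [|n IH]; [rewrite sum_O; symmetry; apply Rplus_0_l|].
  rewrite sum_Sn, IH; reflexivity.
Qed.

Lemma rsum_Series_lim f : ex_series f ->
  forall eps, 0 < eps -> exists N, forall n, (N <= n)%nat -> Rabs (rsum f n - Series f) <= eps.
Proof.
  intros Hf e He. assert (H := Series_correct f Hf).
  assert (H' : is_lim_seq (fun n => sum_n f n) (Series f)) by exact H.
  apply is_lim_seq_spec in H'. destruct (H' (mkposreal e He)) as [N HN].
  exists (S N); intros [|n] Hn; [lia|].
  left. rewrite <- rsum_sum_n. apply HN; lia.
Qed.

Lemma rsum_le_Series f n : (forall k, 0 <= f k) -> ex_series f -> rsum f n <= Series f.
Proof.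
  intros Hp Hf. apply le_epsilon; intros e He.
  destruct (rsum_Series_lim f Hf e He) as [N HN].
  specialize (HN (N + n)%nat ltac:(lia)).
  assert (H := rsum_mono f n (N + n) Hp ltac:(lia)).
  apply Rabs_le_between in HN. lra.
Qed.

Lemma ex_series_bounded f B : (forall k, 0 <= f k) -> (forall n, rsum f n <= B) -> ex_series f.
Proof.
  intros Hp HB.
  destruct (ex_finite_lim_seq_incr (fun n => sum_n f n) B) as [l Hl].
  - intros n. rewrite !rsum_sum_n. apply rsum_mono; auto.
  - intros n; rewrite rsum_sum_n; auto.
  - exists l; exact Hl.
Qed.

Lemma Series_le_bound f B : ex_series f -> (forall n, rsum f n <= B) -> Series f <= B.
Proof.
  intros Hf HB. apply le_epsilon; intros e He.
  destruct (rsum_Series_lim f Hf e He) as [N HN].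
  specialize (HN N ltac:(lia)). specialize (HB N). apply Rabs_le_between in HN. lra.
Qed.

Lemma Series_split f n : ex_series f -> Series f = rsum f n + Series (fun k => f (n + k)%nat).
Proof.
  intros Hf. induction n as [|n IH]; [symmetry; apply Rplus_0_l|].
  rewrite IH. rewrite (Series_incr_1 (fun k => f (n + k)%nat)).
  - rewrite Nat.add_0_r. cbn [rsum]. rewrite Rplus_assoc. do 2 f_equal.
    apply Series_ext; intros; f_equal; lia.
  - apply ex_series_incr_n; auto.
Qed.

Lemma holo_disk_R (a : nat -> C) r : holo_disk a -> 0 <= r < 1 -> ex_series (fun k => Cmod (a k) * r ^ k).
Proof.
  intros H Hr. apply ex_series_ext with (fun k => Cmod (a k * RtoC r ^ k)%C).
  - intros k. rewrite Cmod_mult, Cmod_pow, Cmod_R, Rabs_pos_eq; auto; lra.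
  - apply H. rewrite Cmod_R, Rabs_pos_eq; lra.
Qed.

Lemma holo_disk_intro (a : nat -> C) : (forall r, 0 <= r < 1 -> ex_series (fun k => Cmod (a k) * r ^ k)) -> holo_disk a.
Proof.
  intros H z Hz. apply ex_series_ext with (fun k => Cmod (a k) * Cmod z ^ k).
  - intros k; rewrite Cmod_mult, Cmod_pow; auto.
  - apply H; split; auto. apply Cmod_ge_0.
Qed.

Lemma ex_series_dom (f g : nat -> R) : (forall k, 0 <= f k <= g k) -> ex_series g -> ex_series f.
Proof.
  intros H Hg. apply (ex_series_le (K := R_AbsRing) (V := R_CompleteNormedModule) f g); auto.
  intros n. unfold norm; simpl; unfold abs; simpl. rewrite Rabs_pos_eq; apply H.
Qed.

Lemma holo_disk_dom (a b : nat -> C) C0 : (forall k, Cmod (b k) <= C0 * Cmod (a k)) -> holo_disk a -> holo_disk b.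
Proof.
  intros H Ha. apply holo_disk_intro; intros r Hr.
  apply ex_series_dom with (fun k => C0 * (Cmod (a k) * r ^ k)).
  - intros k. assert (0 <= r ^ k) by (apply pow_le; lra). split.
    + apply Rmult_le_pos; auto; apply Cmod_ge_0.
    + rewrite <- Rmult_assoc. apply Rmult_le_compat_r; auto.
  - apply (ex_series_scal (K := R_AbsRing) (V := R_NormedModule) C0 (fun k => Cmod (a k) * r ^ k)), holo_disk_R; auto.
Qed.

Lemma holo_disk_csub (a b : nat -> C) : holo_disk a -> holo_disk b -> holo_disk (csub a b).
Proof.
  intros Ha Hb. apply holo_disk_intro; intros r Hr.
  apply ex_series_dom with (fun k => Cmod (a k) * r ^ k + Cmod (b k) * r ^ k).
  - intros k. assert (0 <= r ^ k) by (apply pow_le; lra). split.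
    + apply Rmult_le_pos; auto; apply Cmod_ge_0.
    + rewrite <- Rmult_plus_distr_r. apply Rmult_le_compat_r; auto.
      unfold csub, Cminus. eapply Rle_trans; [apply Cmod_triangle|]. rewrite Cmod_opp; lra.
  - apply (ex_series_plus (K := R_AbsRing) (V := R_NormedModule)
      (fun k => Cmod (a k) * r ^ k) (fun k => Cmod (b k) * r ^ k)); apply holo_disk_R; auto.
Qed.

Lemma holo_disk_bounded (a : nat -> C) B : (forall k, Cmod (a k) <= B) -> holo_disk a.
Proof.
  intros H. apply holo_disk_intro; intros r Hr.
  apply ex_series_bounded with (B * / (1 - r)).
  - intros k; apply Rmult_le_pos; [apply Cmod_ge_0|apply pow_le; lra].
  - intros n. assert (HB : 0 <= B) by (eapply Rle_trans; [apply Cmod_ge_0|apply (H O)]).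
    apply Rle_trans with (B * rsum (fun k => r ^ k) n).
    + rewrite <- rsum_scal. apply rsum_le; intros; apply Rmult_le_compat_r; auto. apply pow_le; lra.
    + apply Rmult_le_compat_l; auto. apply rgeom_le; lra.
Qed.

Lemma holo_disk_shift (a : nat -> C) m : holo_disk a -> holo_disk (shift a m).
Proof.
  (* The series of the shift is [/ r ^ m] times a tail of the original one, so the radius 0 is
     separate. *)
  intros Ha. apply holo_disk_intro; intros r Hr. destruct (Req_dec r 0) as [->|Hr0].
  - apply ex_series_bounded with (Cmod (shift a m O)).
    + intros k. apply Rmult_le_pos; [apply Cmod_ge_0|apply pow_le; lra].
    + intros n. assert (H0 := Cmod_ge_0 (shift a m O)). destruct n as [|n]; [simpl; lra|].
      rewrite rsum_shift. cbv beta.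
      rewrite (rsum_ext (fun k => Cmod (shift a m (S k)) * 0 ^ S k) (fun _ => 0)), rsum_0;
        [simpl; lra|intros; simpl; ring].
  - apply ex_series_ext with (fun k => / r ^ m * (Cmod (a (m + k)%nat) * r ^ (m + k))).
    + intros k. unfold shift. rewrite pow_add.
      change (/ r ^ m * (Cmod (a (m + k)%nat) * (r ^ m * r ^ k)) = Cmod (a (m + k)%nat) * r ^ k).
      field. apply pow_nonzero; auto.
    + apply (ex_series_scal (K := R_AbsRing) (V := R_NormedModule) (/ r ^ m)
        (fun k => Cmod (a (m + k)%nat) * r ^ (m + k))).
      apply (ex_series_incr_n (fun k => Cmod (a k) * r ^ k)). apply holo_disk_R; auto.
Qed.

Lemma pev_dom (p : nat -> C) n z r : Cmod z <= r -> Cmod (pev p n z) <= rsum (fun k => Cmod (p k) * r ^ k) n.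
Proof.
  intros Hz. unfold pev. eapply Rle_trans; [apply csum_Cmod_le|].
  apply rsum_le; intros k _. rewrite Cmod_mult, Cmod_pow.
  apply Rmult_le_compat_l; [apply Cmod_ge_0|]. apply pow_incr. split; auto; apply Cmod_ge_0.
Qed.

(** The tail of the majorant [Cmod (a k) * r ^ k] bounds real and imaginary tails at once and
    independently of [z]; each receives half of [eps]. *)
Lemma peval_unif (a : nat -> C) r : holo_disk a -> 0 <= r < 1 ->
  forall eps, 0 < eps -> exists N, forall n z, (N <= n)%nat -> Cmod z <= r ->
  Cmod (pev a n z - peval a z)%C <= eps.
Proof.
  intros Ha Hr e He. assert (Hb := holo_disk_R a r Ha Hr).
  set (b := fun k => Cmod (a k) * r ^ k) in *.
  destruct (rsum_Series_lim b Hb (e / 2)) as [N HN]; [lra|].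
  exists N; intros n z Hn Hz.
  assert (Hz0 := Cmod_ge_0 z).
  assert (D : forall k, Cmod (a k * z ^ k)%C <= b k).
  { intros k. rewrite Cmod_mult, Cmod_pow. apply Rmult_le_compat_l; [apply Cmod_ge_0|].
    apply pow_incr; lra. }
  assert (Key : forall f, (forall k, Rabs (f k) <= b k) -> Rabs (rsum f n - Series f) <= e / 2).
  { intros f Hf.
    assert (Ef : ex_series (fun k => Rabs (f k))).
    { apply ex_series_dom with b; auto. intros; split; auto; apply Rabs_pos. }
    rewrite (Series_split f n) by (apply ex_series_Rabs; auto).
    replace (_ - _) with (- Series (fun k => f (n + k)%nat)) by ring. rewrite Rabs_Ropp.
    assert (Eb : ex_series (fun k => b (n + k)%nat)) by (apply (ex_series_incr_n b); auto).
    eapply Rle_trans; [apply Series_Rabs; apply (ex_series_incr_n (fun k => Rabs (f k))); auto|].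
    eapply Rle_trans; [apply Series_le; [|exact Eb]|].
    - intros k; split; [apply Rabs_pos|apply Hf].
    - specialize (HN n Hn). rewrite (Series_split b n) in HN by auto.
      apply Rabs_le_between in HN. lra. }
  eapply Rle_trans; [apply Cmod_le_abs|].
  replace e with (e / 2 + e / 2) by field. apply Rplus_le_compat.
  - unfold pev, Cminus. rewrite Re_plus, csum_Re. apply Key.
    intros k. eapply Rle_trans; [apply re_le_Cmod|apply D].
  - unfold pev, Cminus. rewrite Im_plus, csum_Im. apply Key.
    intros k. eapply Rle_trans; [apply Im_le_Cmod|apply D].
Qed.

Lemma peval_clim (a : nat -> C) z : holo_disk a -> Cmod z < 1 -> clim (fun n => pev a n z) (peval a z).
Proof.
  intros Ha Hz e He.
  destruct (peval_unif a (Cmod z) Ha (conj (Cmod_ge_0 z) Hz) e He) as [N HN].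
  exists N; intros; apply HN; auto; lra.
Qed.

Lemma peval_finite (a : nat -> C) n z : (forall k, (n <= k)%nat -> a k = RtoC 0) -> Cmod z < 1 ->
  peval a z = pev a n z.
Proof.
  intros H Hz. apply clim_unique with (fun m => pev a m z).
  - apply peval_clim; auto. apply holo_disk_intro; intros r Hr.
    apply ex_series_bounded with (rsum (fun k => Cmod (a k) * r ^ k) n).
    + intros k; apply Rmult_le_pos; [apply Cmod_ge_0|apply pow_le; lra].
    + intros m. destruct (Nat.le_ge_cases m n) as [Hm|Hm].
      * apply rsum_mono; auto. intros k; apply Rmult_le_pos; [apply Cmod_ge_0|apply pow_le; lra].
      * rewrite (rsum_trunc _ n m); [lra|auto|]. intros k Hk; rewrite H, Cmod_0 by lia; ring.
  - apply clim_eventually_const with n. intros m Hm. apply csum_trunc; auto.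
    intros k Hk; rewrite H by lia; ring.
Qed.

Lemma peval_csub (a b : nat -> C) z : holo_disk a -> holo_disk b -> Cmod z < 1 ->
  peval (csub a b) z = (peval a z - peval b z)%C.
Proof.
  intros Ha Hb Hz. apply clim_unique with (fun n => pev (csub a b) n z).
  - apply peval_clim; auto using holo_disk_csub.
  - apply clim_ext with (fun n => pev a n z - pev b n z)%C.
    + intros n; unfold pev, csub. rewrite <- csum_minus. apply csum_ext; intros; ring.
    + apply clim_minus; apply peval_clim; auto.
Qed.

Lemma pev_scal_arg (p : nat -> C) n w z : pev p n (w * z)%C = pev (fun k => p k * w ^ k)%C n z.
Proof. unfold pev; apply csum_ext; intros; rewrite Cpow_mult_l; ring. Qed.

Lemma peval_shift (a : nat -> C) m z : holo_disk a -> Cmod z < 1 ->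
  peval (shift a m) z = (a m + z * peval (shift a (S m)) z)%C.
Proof.
  intros Ha Hz. apply clim_unique with (fun n => pev (shift a m) (S n) z).
  - apply (clim_incr (fun n => pev (shift a m) n z)). apply peval_clim; auto using holo_disk_shift.
  - apply clim_ext with (fun n => a m + z * pev (shift a (S m)) n z)%C.
    + intros n. unfold pev. rewrite csum_shift. unfold shift at 2. rewrite Nat.add_0_r.
      rewrite <- csum_scal. simpl Cpow. rewrite Cmult_1_r. f_equal. apply csum_ext; intros.
      unfold shift. rewrite Nat.add_succ_comm. ring.
    + apply clim_plus; [apply (clim_eventually_const _ _ O); auto|].
      apply clim_scal, peval_clim; auto using holo_disk_shift.
Qed.

Lemma peval_0 (a : nat -> C) : holo_disk a -> peval a (RtoC 0) = a O.
Proof.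
  intros Ha. assert (Hz : Cmod (RtoC 0) < 1) by (rewrite Cmod_0; lra).
  assert (H := peval_shift a O (RtoC 0) Ha Hz).
  transitivity (peval (shift a 0) (RtoC 0)); [reflexivity|]. rewrite H. ring.
Qed.

Lemma peval_dom (a : nat -> C) z B : holo_disk a -> Cmod z < 1 ->
  (forall n, rsum (fun k => Cmod (a k) * Cmod z ^ k) n <= B) -> Cmod (peval a z) <= B.
Proof.
  intros Ha Hz HB. apply clim_Cmod_le with (fun n => pev a n z); [apply peval_clim; auto|].
  exists O; intros n _. eapply Rle_trans; [apply pev_dom; apply Rle_refl|apply HB].
Qed.

Lemma rcont_unif (f : R -> R) :
  (forall eps, 0 < eps -> exists g, rcont g /\ forall t, Rabs (f t - g t) <= eps) -> rcont f.
Proof.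
  intros H t. apply filterlim_locally. intros [e He]; simpl.
  destruct (H (e / 4)) as [g [Hg Hfg]]; [lra|].
  assert (Hgt := Hg t). apply filterlim_locally with (eps := mkposreal (e / 4) ltac:(lra)) in Hgt.
  revert Hgt. apply filter_imp; intros y Hy.
  unfold ball in *; simpl in *; unfold AbsRing_ball, abs, minus, plus, opp in *; simpl in *.
  assert (H1 := Hfg t). assert (H2 := Hfg y).
  apply Rabs_def2 in Hy. apply Rabs_le_between in H1. apply Rabs_le_between in H2.
  apply Rabs_def1; lra.
Qed.

Lemma ccont_unif (f : R -> C) :
  (forall eps, 0 < eps -> exists g, ccont g /\ forall t, Cmod (f t - g t)%C <= eps) -> ccont f.
Proof.
  intros H; split; apply rcont_unif; intros e He; destruct (H e He) as [g [Hg Hfg]].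
  - exists (fun t => Re (g t)); split; [apply Hg|]. intros t.
    eapply Rle_trans; [apply (re_le_Cmod (f t - g t)%C)|auto].
  - exists (fun t => Im (g t)); split; [apply Hg|]. intros t.
    eapply Rle_trans; [apply (Im_le_Cmod (f t - g t)%C)|auto].
Qed.

Lemma ccont_pev (p : nat -> C) n (g : R -> C) : ccont g -> ccont (fun t => pev p n (g t)).
Proof. intros Hg. unfold pev. apply (ccont_csum (fun k t => p k * g t ^ k)%C). auto with cont. Qed.

Lemma ccont_peval (a : nat -> C) r (g : R -> C) : holo_disk a -> 0 <= r < 1 ->
  (forall t, Cmod (g t) <= r) -> ccont g -> ccont (fun t => peval a (g t)).
Proof.
  intros Ha Hr Hg Hc. apply ccont_unif; intros e He.
  destruct (peval_unif a r Ha Hr e He) as [N HN].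
  exists (fun t => pev a N (g t)); split; [apply ccont_pev; auto|].
  intros t. rewrite Cmod_minus_sym. apply HN; auto.
Qed.

Lemma mean_Rabs_sub_le (f g : R -> R) e : rcont f -> rcont g ->
  (forall t, Rabs (f t - g t) <= e) -> Rabs (mean f - mean g) <= e.
Proof.
  intros Hf Hg H. rewrite <- mean_minus by auto. apply Rabs_le; split.
  - rewrite <- (mean_const (- e)). apply mean_le; auto with cont.
    intros t; specialize (H t); apply Rabs_le_between in H; lra.
  - rewrite <- (mean_const e). apply mean_le; auto with cont.
    intros t; specialize (H t); apply Rabs_le_between in H; lra.
Qed.

Lemma Cmean_sub_le (f g : R -> C) e : ccont f -> ccont g ->
  (forall t, Cmod (f t - g t)%C <= e) -> Cmod (Cmean f - Cmean g)%C <= e.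
Proof.
  intros Hf Hg H. rewrite <- Cmean_minus by auto.
  eapply Rle_trans; [apply Cmod_Cmean; auto with cont|].
  rewrite <- (mean_const e). apply mean_le; auto with cont.
Qed.

Lemma Cmod_r_cis r t : 0 <= r -> Cmod (RtoC r * cis t)%C = r.
Proof. intros Hr; rewrite Cmod_mult, Cmod_cis, Cmod_R, Rabs_pos_eq; lra. Qed.

Lemma ccont_peval_cis (a : nat -> C) r : holo_disk a -> 0 <= r < 1 -> ccont (fun t => peval a (RtoC r * cis t)%C).
Proof.
  intros Ha Hr. apply ccont_peval with r; auto with cont. intros t; rewrite Cmod_r_cis; lra.
Qed.

Lemma Cmean_pev_cis (p : nat -> C) n k :
  Cmean (fun t => pev p n (cis t) * Cconj (cis t ^ k))%C = if lt_dec k n then p k else RtoC 0.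
Proof.
  rewrite (Cmean_ext _ (fun t => csum (fun j => p j * (cis t ^ j * Cconj (cis t ^ k)))%C n)).
  2:{ intros t; unfold pev. rewrite <- csum_scal_r. apply csum_ext; intros; ring. }
  rewrite (Cmean_csum (fun j t => p j * (cis t ^ j * Cconj (cis t ^ k)))%C) by auto 8 with cont.
  rewrite (csum_ext _ (fun j => p j * RtoC (if Nat.eq_dec j k then 1 else 0))%C).
  2:{ intros j _. rewrite Cmean_scal, Cmean_cis_orth; auto with cont. }
  destruct (lt_dec k n) as [Hk|Hk].
  - rewrite (csum_single _ n k); auto.
    + destruct (Nat.eq_dec k k); [ring|congruence].
    + intros j _ Hj. destruct (Nat.eq_dec j k); [congruence|ring].
  - rewrite (csum_ext _ (fun _ => RtoC 0)); [apply csum_0|].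
    intros j Hj. destruct (Nat.eq_dec j k); [lia|ring].
Qed.

(** Cauchy's coefficient formula: it is orthogonality for partial sums, which converge uniformly on
    the circle of radius [r]. *)
Lemma Cmean_peval_cis (a : nat -> C) r k : holo_disk a -> 0 <= r < 1 ->
  Cmean (fun t => peval a (RtoC r * cis t) * Cconj (cis t ^ k))%C = (a k * RtoC r ^ k)%C.
Proof.
  intros Ha Hr. assert (Hc := ccont_peval_cis a r Ha Hr).
  assert (E : (Cmean (fun t => peval a (RtoC r * cis t) * Cconj (cis t ^ k)) - a k * RtoC r ^ k)%C = RtoC 0).
  { apply Cmod_zero_small; intros e He.
    destruct (peval_unif a r Ha Hr e He) as [N HN].
    (* The partial sum must reach beyond [k] to contain the coefficient in question. *)
    set (n := (N + S k)%nat).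
    assert (Hp : Cmean (fun t => pev a n (RtoC r * cis t) * Cconj (cis t ^ k))%C = (a k * RtoC r ^ k)%C).
    { rewrite (Cmean_ext _ (fun t => pev (fun k => a k * RtoC r ^ k)%C n (cis t) * Cconj (cis t ^ k))%C)
        by (intros t; rewrite pev_scal_arg; auto).
      rewrite Cmean_pev_cis. destruct (lt_dec k n); auto. unfold n in *; lia. }
    rewrite <- Hp. apply Cmean_sub_le; auto with cont.
    - apply ccont_mult; auto with cont. apply ccont_pev; auto with cont.
    - intros t. replace (_ - _)%C with ((peval a (RtoC r * cis t) - pev a n (RtoC r * cis t)) * Cconj (cis t ^ k))%C by ring.
      rewrite Cmod_mult, Cmod_conj, Cmod_pow, Cmod_cis, pow1, Rmult_1_r, Cmod_minus_sym.
      apply HN; [unfold n; lia|]. rewrite Cmod_r_cis; lra. }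
  replace (a k * RtoC r ^ k)%C with (a k * RtoC r ^ k + RtoC 0)%C by ring. rewrite <- E. ring.
Qed.

(* Expand [0 <= mean |F - sum <F, e_k> e_k|^2]. *)
Lemma Bessel (F : R -> C) (e : nat -> R -> C) n : ccont F -> (forall k, ccont (e k)) ->
  (forall j k, Cmean (fun t => e j t * Cconj (e k t))%C = RtoC (if Nat.eq_dec j k then 1 else 0)) ->
  rsum (fun k => Cmod (Cmean (fun t => F t * Cconj (e k t))%C) ^ 2) n <= mean (fun t => Cmod (F t) ^ 2).
Proof.
  intros HF He Ho. set (c := fun k => Cmean (fun t => F t * Cconj (e k t))%C).
  induction n as [|n IH].
  { simpl. apply mean_ge0; [apply (rcont_pow _ 2); auto with cont|]. intros; apply pow2_ge_0. }
  clear IH. set (m := S n).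
  set (S0 := fun t => csum (fun k => c k * e k t)%C m).
  assert (HS : ccont S0) by (apply (ccont_csum (fun k t => c k * e k t)%C); auto with cont).
  assert (E1 : Cmean (fun t => F t * Cconj (S0 t))%C = RtoC (rsum (fun k => Cmod (c k) ^ 2) m)).
  { rewrite (Cmean_ext _ (fun t => csum (fun k => Cconj (c k) * (F t * Cconj (e k t)))%C m)).
    2:{ intros t; unfold S0. rewrite csum_conj, <- csum_scal. apply csum_ext; intros.
        rewrite Cmult_conj; ring. }
    rewrite (Cmean_csum (fun k t => Cconj (c k) * (F t * Cconj (e k t)))%C) by auto 8 with cont.
    rewrite <- csum_RtoC. apply csum_ext; intros k _.
    rewrite Cmean_scal by auto with cont. fold (c k). rewrite <- Cmod2_real. ring. }
  assert (E2 : Cmean (fun t => S0 t * Cconj (S0 t))%C = RtoC (rsum (fun k => Cmod (c k) ^ 2) m)).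
  { rewrite (Cmean_ext _ (fun t => csum (fun k => csum (fun j => c j * Cconj (c k) * (e j t * Cconj (e k t)))%C m) m)).
    2:{ intros t; unfold S0. rewrite csum_conj, <- csum_scal. apply csum_ext; intros k _.
        rewrite <- csum_scal_r. apply csum_ext; intros j _. rewrite Cmult_conj; ring. }
    rewrite (Cmean_csum (fun k t => csum (fun j => c j * Cconj (c k) * (e j t * Cconj (e k t)))%C m)).
    2:{ intros k _. apply (ccont_csum (fun j t => c j * Cconj (c k) * (e j t * Cconj (e k t)))%C).
        auto 8 with cont. }
    rewrite <- csum_RtoC. apply csum_ext; intros k Hk.
    rewrite (Cmean_csum (fun j t => c j * Cconj (c k) * (e j t * Cconj (e k t)))%C) by auto 8 with cont.
    rewrite (csum_single _ m k); auto.
    - rewrite Cmean_scal, Ho by auto with cont. destruct (Nat.eq_dec k k) as [_|?]; [|congruence].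
      rewrite <- Cmod2_real. ring.
    - intros j _ Hj. rewrite Cmean_scal, Ho by auto with cont. destruct (Nat.eq_dec j k); [congruence|ring]. }
  assert (P : 0 <= mean (fun t => Cmod (F t - S0 t)%C ^ 2)).
  { apply mean_ge0; [apply (rcont_pow _ 2); auto with cont|]. intros; apply pow2_ge_0. }
  assert (E3 : mean (fun t => Cmod (F t - S0 t)%C ^ 2)
     = mean (fun t => Cmod (F t) ^ 2 + Cmod (S0 t) ^ 2 - 2 * Re (F t * Cconj (S0 t))%C)).
  { apply mean_ext; intros t. rewrite !Cmod2_alt.
    generalize (F t), (S0 t); intros [x y] [u v]; simpl; ring. }
  assert (K1 : rcont (fun t => Cmod (F t) ^ 2)) by (apply (rcont_pow _ 2); auto with cont).
  assert (K2 : rcont (fun t => Cmod (S0 t) ^ 2)) by (apply (rcont_pow _ 2); auto with cont).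
  assert (K3 : rcont (fun t => Re (F t * Cconj (S0 t))%C)) by (apply (rcont_Re (fun t => F t * Cconj (S0 t))%C); auto with cont).
  rewrite E3, mean_minus, mean_plus, mean_scal in P; auto with cont.
  apply (f_equal Re) in E1. apply (f_equal Re) in E2. cbn [Re fst RtoC] in E1, E2.
  assert (E4 : mean (fun t => Cmod (S0 t) ^ 2) = rsum (fun k => Cmod (c k) ^ 2) m).
  { rewrite <- E2. unfold Cmean; simpl Re. apply mean_ext; intros t.
    assert (H := f_equal Re (Cmod2_real (S0 t))). simpl Re in *. symmetry; exact H. }
  assert (E5 : mean (fun t => Re (F t * Cconj (S0 t))%C) = rsum (fun k => Cmod (c k) ^ 2) m) by exact E1.
  fold c. rewrite E4, E5 in P. change (rsum (fun k => Cmod (c k) ^ 2) m <= mean (fun t => Cmod (F t) ^ 2)). lra.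
Qed.

(** * The Poisson kernel *)

Definition cauchy_ker (zeta : C) (t : R) : C := (/ (1 - zeta * cis t))%C.

Lemma cauchy_den (zeta : C) t : Cmod zeta < 1 -> 1 - Cmod zeta <= Cmod (1 - zeta * cis t)%C.
Proof.
  intros H. assert (K := Cmod_triangle_inv (RtoC 1) (zeta * cis t)%C).
  rewrite Cmod_1, Cmod_mult, Cmod_cis, Rmult_1_r in K. apply Rabs_le_between in K. lra.
Qed.

Lemma cauchy_den_neq (zeta : C) t : Cmod zeta < 1 -> (1 - zeta * cis t)%C <> RtoC 0.
Proof. intros H. apply Cmod_gt_0. assert (K := cauchy_den zeta t H). lra. Qed.

Lemma ccont_cauchy (zeta : C) : Cmod zeta < 1 -> ccont (cauchy_ker zeta).
Proof.
  intros H. apply (ccont_inv (fun t => 1 - zeta * cis t)%C); auto with cont.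
  intros; apply cauchy_den_neq; auto.
Qed.

(** The remainder of the geometric series is [(zeta * cis t) ^ n] times the kernel itself. *)
Lemma cauchy_approx (zeta : C) t n : Cmod zeta < 1 ->
  Cmod (cauchy_ker zeta t - csum (fun j => zeta ^ j * cis t ^ j)%C n)%C <= Cmod zeta ^ n / (1 - Cmod zeta).
Proof.
  intros H. assert (K := cauchy_den zeta t H). assert (Hn := cauchy_den_neq zeta t H).
  assert (G := geom_sum (zeta * cis t) n).
  assert (E : (cauchy_ker zeta t - csum (fun j => zeta ^ j * cis t ^ j) n)%C = ((zeta * cis t) ^ n * cauchy_ker zeta t)%C).
  { unfold cauchy_ker.
    rewrite (csum_ext _ (fun j => (zeta * cis t) ^ j)%C) by (intros; rewrite Cpow_mult_l; auto).
    set (s := csum _ n) in *.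
    replace s with ((1 - zeta * cis t) * s * / (1 - zeta * cis t))%C by (field; auto).
    rewrite G. field; auto. }
  rewrite E, Cmod_mult, Cmod_pow, Cmod_mult, Cmod_cis, Rmult_1_r.
  unfold cauchy_ker. rewrite Cmod_inv by auto.
  apply Rmult_le_compat_l; [apply pow_le, Cmod_ge_0|].
  apply Rinv_le_contravar; lra.
Qed.

Lemma geom_small x eps : 0 <= x < 1 -> 0 < eps -> exists N, forall n, (N <= n)%nat -> x ^ n / (1 - x) <= eps.
Proof.
  intros Hx He.
  destruct (pow_lt_1_zero x ltac:(rewrite Rabs_pos_eq; lra) (eps * (1 - x)) ltac:(nra)) as [N HN].
  exists N; intros n Hn. specialize (HN n Hn).
  rewrite Rabs_pos_eq in HN by (apply pow_le; lra).
  apply Rmult_le_reg_r with (1 - x); [lra|]. unfold Rdiv. rewrite Rmult_assoc, Rinv_l by lra. lra.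
Qed.

(** Termwise integration under uniform convergence, stated once for all uses of the expansion of the
    Cauchy kernel; [dl n] is the uniform error. *)
Lemma Cmean_mult_approx (G g : R -> C) (l : C) (s : nat -> R -> C) (dl : nat -> R) :
  ccont G -> ccont g -> (forall n, ccont (s n)) -> (forall t, Cmod (g t) <= 1) ->
  (forall n t, Cmod (G t - s n t)%C <= dl n) ->
  (forall eps, 0 < eps -> exists N, forall n, (N <= n)%nat -> dl n <= eps) ->
  clim (fun n => Cmean (fun t => s n t * g t)%C) l -> Cmean (fun t => G t * g t)%C = l.
Proof.
  intros HG Hg Hs Hg1 Hd Hdl Hl.
  apply clim_unique with (fun n => Cmean (fun t => s n t * g t)%C); auto.
  intros e He. destruct (Hdl e He) as [N HN]. exists N; intros n Hn.
  apply Cmean_sub_le; auto with cont. intros t.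
  replace (s n t * g t - G t * g t)%C with (- ((G t - s n t) * g t))%C by ring.
  rewrite Cmod_opp, Cmod_mult. specialize (HN n Hn). specialize (Hd n t). specialize (Hg1 t).
  assert (H1 := Cmod_ge_0 (G t - s n t)%C). assert (H2 := Cmod_ge_0 (g t)).
  apply Rle_trans with (Cmod (G t - s n t)%C * 1); [apply Rmult_le_compat_l; lra|lra].
Qed.

Lemma Cmean_cauchy_conj (zeta : C) k : Cmod zeta < 1 ->
  Cmean (fun t => cauchy_ker zeta t * Cconj (cis t ^ k))%C = (zeta ^ k)%C.
Proof.
  intros H. apply (Cmean_mult_approx (cauchy_ker zeta) (fun t => Cconj (cis t ^ k)) _
    (fun n t => csum (fun j => zeta ^ j * cis t ^ j)%C n) (fun n => Cmod zeta ^ n / (1 - Cmod zeta)));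
    auto using ccont_cauchy with cont.
  - intros n; apply (ccont_csum (fun j t => zeta ^ j * cis t ^ j)%C); auto with cont.
  - intros t; rewrite Cmod_conj, Cmod_pow, Cmod_cis, pow1; lra.
  - intros n t; apply cauchy_approx; auto.
  - intros e He; apply geom_small; auto. split; auto; apply Cmod_ge_0.
  - apply (clim_eventually_const _ _ (S k)). intros n Hn.
    etransitivity; [apply (Cmean_pev_cis (fun j => zeta ^ j)%C n k)|]. destruct (lt_dec k n); auto; lia.
Qed.

(** The terms with [j > 0] have positive frequency and vanish; the term [j = 0] is the right-hand
    side, so partial sums with at least one term are already exact. *)
Lemma Cmean_cauchy_pow (zeta : C) k : Cmod zeta < 1 ->
  Cmean (fun t => cauchy_ker zeta t * cis t ^ k)%C = Cmean (fun t => cis t ^ k)%C.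
Proof.
  intros H. apply (Cmean_mult_approx (cauchy_ker zeta) (fun t => cis t ^ k)%C _
    (fun n t => csum (fun j => zeta ^ j * cis t ^ j)%C n) (fun n => Cmod zeta ^ n / (1 - Cmod zeta)));
    auto using ccont_cauchy with cont.
  - intros n; apply (ccont_csum (fun j t => zeta ^ j * cis t ^ j)%C); auto with cont.
  - intros t; rewrite Cmod_pow, Cmod_cis, pow1; lra.
  - intros n t; apply cauchy_approx; auto.
  - intros e He; apply geom_small; auto. split; auto; apply Cmod_ge_0.
  - apply (clim_eventually_const _ _ 1%nat). intros [|n] Hn; [lia|].
    rewrite (Cmean_ext _ (fun t => csum (fun j => zeta ^ j * cis t ^ (j + k))%C (S n))).
    2:{ intros t; rewrite <- csum_scal_r; apply csum_ext; intros; rewrite Cpow_add_r; ring. }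
    rewrite (Cmean_csum (fun j t => zeta ^ j * cis t ^ (j + k))%C) by auto with cont.
    rewrite (csum_single _ (S n) O); [|lia|].
    + rewrite Cmean_scal by auto with cont. simpl Cpow at 1. rewrite Cmult_1_l. auto.
    + intros j Hj Hj0. rewrite Cmean_scal, Cmean_cis_pow by (auto with cont; lia). ring.
Qed.

Lemma poisson_cauchy_sq (z : C) t : Cmod z < 1 ->
  poisson z t = (1 - Cmod z ^ 2) * Cmod (cauchy_ker (Cconj z) t) ^ 2.
Proof.
  intros H. unfold poisson, cauchy_ker. rewrite Cmod_inv by (apply cauchy_den_neq; rewrite Cmod_conj; auto).
  replace (Cmod (cis t - z)%C) with (Cmod (1 - Cconj z * cis t)%C).
  - assert (K := cauchy_den (Cconj z) t). rewrite Cmod_conj in K. specialize (K H).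
    field. lra.
  - rewrite <- (Cmod_conj (cis t - z)%C), Cminus_conj.
    replace (1 - Cconj z * cis t)%C with (cis t * (Cconj (cis t) - Cconj z))%C.
    + rewrite Cmod_mult, Cmod_cis; ring.
    + replace (cis t * (Cconj (cis t) - Cconj z))%C with (cis t * Cconj (cis t) - Cconj z * cis t)%C by ring.
      rewrite cis_conj_r; auto.
Qed.

(** The form $2\,\mathrm{Re}\,K-1$ can be integrated against powers of [cis], whereas
    [poisson_cauchy_sq] shows positivity. *)
Lemma poisson_cauchy (z : C) t : Cmod z < 1 ->
  RtoC (poisson z t) = (cauchy_ker (Cconj z) t + Cconj (cauchy_ker (Cconj z) t) - 1)%C.
Proof.
  intros H. rewrite poisson_cauchy_sq by auto.
  assert (Hz : Cmod (Cconj z) < 1) by (rewrite Cmod_conj; auto).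
  assert (Hn := cauchy_den_neq (Cconj z) t Hz).
  rewrite RtoC_mult, <- Cmod2_real, RtoC_minus, <- Cmod2_real.
  unfold cauchy_ker. rewrite Cinv_conj by auto.
  assert (Hn' : Cconj (1 - Cconj z * cis t)%C <> RtoC 0).
  { intros E; apply Hn. rewrite <- (Cconj_conj (1 - Cconj z * cis t)%C), E. apply C_ext; simpl; ring. }
  assert (E : Cconj (1 - Cconj z * cis t)%C = (1 - z * Cconj (cis t))%C).
  { rewrite Cminus_conj, Cmult_conj, Cconj_conj. f_equal. apply C_ext; simpl; ring. }
  rewrite E in *. assert (U := cis_conj_r t).
  transitivity ((1 - z * Cconj z * (cis t * Cconj (cis t))) * (/ (1 - Cconj z * cis t) * / (1 - z * Cconj (cis t))))%C.
  - rewrite U. ring.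
  - field. auto.
Qed.

Lemma poisson_pos (z : C) t : Cmod z < 1 -> 0 <= poisson z t.
Proof.
  intros H. rewrite poisson_cauchy_sq by auto. apply Rmult_le_pos; [|apply pow2_ge_0].
  assert (H0 := Cmod_ge_0 z). nra.
Qed.

Lemma rcont_poisson (z : C) : Cmod z < 1 -> rcont (poisson z).
Proof.
  intros H. apply rcont_ext with (fun t => (1 - Cmod z ^ 2) * Cmod (cauchy_ker (Cconj z) t) ^ 2).
  - intros; rewrite poisson_cauchy_sq; auto.
  - assert (K : ccont (cauchy_ker (Cconj z))) by (apply ccont_cauchy; rewrite Cmod_conj; auto).
    apply rcont_mult; [auto with cont|]. apply (rcont_pow _ 2); auto with cont.
Qed.

(** Of the three terms of [poisson_cauchy], the conjugate Cauchy kernel yields [z ^ k], and the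
    other two cancel. *)
Lemma Cmean_poisson_pow (z : C) k : Cmod z < 1 ->
  Cmean (fun t => cis t ^ k * RtoC (poisson z t))%C = (z ^ k)%C.
Proof.
  intros H. assert (Hz : Cmod (Cconj z) < 1) by (rewrite Cmod_conj; auto).
  assert (Hc := ccont_cauchy _ Hz).
  rewrite (Cmean_ext _ (fun t => cauchy_ker (Cconj z) t * cis t ^ k + Cconj (cauchy_ker (Cconj z) t * Cconj (cis t ^ k)) - cis t ^ k)%C).
  2:{ intros t. rewrite poisson_cauchy by auto. rewrite Cmult_conj, Cconj_conj. ring. }
  rewrite Cmean_minus, Cmean_plus, Cmean_conj by auto 12 with cont.
  rewrite Cmean_cauchy_pow, Cmean_cauchy_conj by auto. rewrite Cpow_conj, Cconj_conj. ring.
Qed.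

Lemma mean_poisson (z : C) : Cmod z < 1 -> mean (poisson z) = 1.
Proof.
  intros H. assert (E := f_equal Re (Cmean_poisson_pow z 0 H)). simpl in E. rewrite <- E.
  apply mean_ext; intros; ring.
Qed.

Lemma mean_cauchy_sq (zeta : C) : Cmod zeta < 1 -> mean (fun t => Cmod (cauchy_ker zeta t) ^ 2) = / (1 - Cmod zeta ^ 2).
Proof.
  intros H. assert (H' : Cmod (Cconj zeta) < 1) by (rewrite Cmod_conj; auto).
  assert (Hc := ccont_cauchy _ H).
  assert (E := mean_poisson _ H'). assert (H0 := Cmod_ge_0 zeta).
  rewrite (mean_ext _ (fun t => (1 - Cmod zeta ^ 2) * Cmod (cauchy_ker zeta t) ^ 2)) in E.
  - rewrite mean_scal in E by (apply (rcont_pow _ 2); auto with cont).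
    apply Rmult_eq_reg_l with (1 - Cmod zeta ^ 2); [|nra]. rewrite E, Rinv_r; nra.
  - intros t. rewrite poisson_cauchy_sq, Cconj_conj, Cmod_conj; auto.
Qed.

Lemma mean_Re_pev_poisson (p : nat -> C) n z : Cmod z < 1 ->
  mean (fun t => Re (pev p n (cis t)) * poisson z t) = Re (pev p n z).
Proof.
  intros H. assert (HP := rcont_poisson z H).
  assert (E : Cmean (fun t => pev p n (cis t) * RtoC (poisson z t))%C = pev p n z).
  { rewrite (Cmean_ext _ (fun t => csum (fun k => p k * (cis t ^ k * RtoC (poisson z t)))%C n)).
    2:{ intros t; unfold pev; rewrite <- csum_scal_r; apply csum_ext; intros; ring. }
    rewrite (Cmean_csum (fun k t => p k * (cis t ^ k * RtoC (poisson z t)))%C) by auto 8 with cont.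
    apply csum_ext; intros k _. rewrite Cmean_scal, Cmean_poisson_pow; auto with cont. }
  rewrite <- E. unfold Cmean. simpl Re at 2. apply mean_ext; intros t.
  change (Re (pev p n (cis t)) * poisson z t =
    Re (pev p n (cis t)) * poisson z t - Im (pev p n (cis t)) * 0). ring.
Qed.

(** * The Garsia gap of a polynomial *)

(* [|h|^2 + (1 - |z|^2) * sum_m |h_m(z)|^2], with [h_m] the m-th backward shift, is harmonic:
   it is the real part of [sum |h_m|^2 + 2 sum_m conj (h m) * z * h_(m+1) z]. *)
Definition harm_coef (h : nat -> C) (n k : nat) : C :=
  match k with
  | O => RtoC (rsum (fun m => Cmod (h m) ^ 2) n)
  | S _ => (2 * csum (fun m => Cconj (h m) * h (m + k)%nat) n)%C
  end.

Lemma pev_shift_step (h : nat -> C) n m z : (forall k, (n <= k)%nat -> h k = RtoC 0) ->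
  pev (shift h m) n z = (h m + z * pev (shift h (S m)) n z)%C.
Proof.
  intros H. transitivity (pev (shift h m) (S n) z).
  - unfold pev. cbn [csum]. unfold shift at 3. rewrite (H (m + n)%nat) by lia. ring.
  - unfold pev. rewrite csum_shift, <- csum_scal. unfold shift at 1. rewrite Nat.add_0_r.
    simpl Cpow at 1. rewrite Cmult_1_r. f_equal. apply csum_ext; intros k _.
    unfold shift. rewrite Nat.add_succ_comm, Cpow_S. ring.
Qed.

(** With [e m] the value at [z] of the [m]-th shift, [e m = h m + z * e (S m)]. Expanding
    [Cmod (e m) ^ 2] and summing gives [S1]; splitting off the first term of the same sum gives
    [S2]. Their difference is the real part of a polynomial. *)
Lemma gap_harmonic (h : nat -> C) n z : (forall k, (n <= k)%nat -> h k = RtoC 0) ->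
  Cmod (pev h n z) ^ 2 + (1 - Cmod z ^ 2) * rsum (fun m => Cmod (pev (shift h (S m)) n z) ^ 2) n
  = Re (pev (harm_coef h n) (S n) z).
Proof.
  intros H. set (e := fun m => pev (shift h m) n z).
  assert (E0 : pev h n z = e O) by reflexivity.
  assert (S1 : rsum (fun m => Cmod (e m) ^ 2) n
    = rsum (fun m => Cmod (h m) ^ 2) n + 2 * Re (csum (fun m => Cconj (h m) * (z * e (S m)))%C n)
      + Cmod z ^ 2 * rsum (fun m => Cmod (e (S m)) ^ 2) n).
  { rewrite csum_Re, <- !rsum_scal, <- !rsum_plus. apply rsum_ext; intros m _.
    unfold e at 1. rewrite pev_shift_step by auto. fold (e (S m)).
    rewrite !Cmod2_alt. generalize (h m), z, (e (S m)); intros [a b] [c d] [u v]; simpl; ring. }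
  assert (S2 : rsum (fun m => Cmod (e m) ^ 2) n = Cmod (e O) ^ 2 + rsum (fun m => Cmod (e (S m)) ^ 2) n).
  { transitivity (rsum (fun m => Cmod (e m) ^ 2) (S n)).
    - cbn [rsum]. replace (e n) with (RtoC 0); [rewrite Cmod_0; ring|].
      symmetry; unfold e, pev. rewrite (csum_ext _ (fun _ => RtoC 0)); [apply csum_0|].
      intros k _. unfold shift. rewrite H by lia. ring.
    - rewrite rsum_shift; reflexivity. }
  (* The double sum is regrouped by the difference of the two indices of [h], which is the exponent
     in [harm_coef]. *)
  assert (S3 : pev (harm_coef h n) (S n) z
    = (RtoC (rsum (fun m => Cmod (h m) ^ 2)%R n) + 2 * csum (fun m => Cconj (h m) * (z * e (S m))) n)%C).
  { unfold pev. rewrite csum_shift. unfold harm_coef at 1. simpl Cpow at 1. rewrite Cmult_1_r. f_equal.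
    rewrite (csum_ext _ (fun k => csum (fun m => 2 * (Cconj (h m) * (z * (h (m + S k)%nat * z ^ k))))%C n)).
    - rewrite csum_swap, <- csum_scal. apply csum_ext; intros m _.
      unfold e, pev. rewrite <- !csum_scal. apply csum_ext; intros k _.
      unfold shift. rewrite Nat.add_succ_comm. ring.
    - intros k _. unfold harm_coef. rewrite <- csum_scal, <- csum_scal_r. apply csum_ext; intros m _.
      rewrite Cpow_S. ring. }
  rewrite S3, Re_plus, E0. fold (e 1%nat).
  change (fun m => Cmod (pev (shift h (S m)) n z) ^ 2) with (fun m => Cmod (e (S m)) ^ 2).
  replace (Re (2 * csum (fun m => Cconj (h m) * (z * e (S m))) n)%C)
    with (2 * Re (csum (fun m => Cconj (h m) * (z * e (S m)))%C n)).
  2:{ rewrite Re_mult. simpl (Im 2). simpl (Re 2). ring. }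
  match goal with |- context [Re (RtoC ?x)] => change (Re (RtoC x)) with x end. lra.
Qed.

(** On the circle the factor [1 - Cmod z ^ 2] is zero, so the harmonic function of [gap_harmonic]
    has boundary values [Cmod (pev h n (cis t)) ^ 2] and is their Poisson integral. *)
Lemma mean_sq_poisson (h : nat -> C) n z : (forall k, (n <= k)%nat -> h k = RtoC 0) -> Cmod z < 1 ->
  mean (fun t => Cmod (pev h n (cis t)) ^ 2 * poisson z t)
  = Cmod (pev h n z) ^ 2 + (1 - Cmod z ^ 2) * rsum (fun m => Cmod (pev (shift h (S m)) n z) ^ 2) n.
Proof.
  intros H Hz. rewrite gap_harmonic by auto. rewrite <- mean_Re_pev_poisson by auto.
  apply mean_ext; intros t. rewrite <- gap_harmonic by auto. rewrite Cmod_cis. ring.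
Qed.

(** * The Garsia gap of a square-summable sequence *)

(** A bound on every partial sum, so that no convergence statement has to be carried along. *)
Definition l2le (a : nat -> C) (B : R) : Prop := forall n, rsum (fun k => Cmod (a k) ^ 2) n <= B.

Lemma l2le_pos a B : l2le a B -> 0 <= B.
Proof. intros H; apply (H O). Qed.

Lemma l2le_coef a B k : l2le a B -> Cmod (a k) ^ 2 <= B.
Proof.
  intros H. specialize (H (S k)). cbn [rsum] in H.
  assert (0 <= rsum (fun k => Cmod (a k) ^ 2) k) by (apply rsum_nonneg; intros; apply pow2_ge_0). lra.
Qed.

Lemma l2le_holo a B : l2le a B -> holo_disk a.
Proof.
  intros H. apply (holo_disk_bounded a (B + 1)). intros k.
  assert (H1 := l2le_coef a B k H). assert (H2 := Cmod_ge_0 (a k)). assert (H3 := l2le_pos a B H). nra.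
Qed.

Lemma clim_Cmod u l : clim u l -> is_lim_seq (fun n => Cmod (u n)) (Cmod l).
Proof.
  intros H. apply is_lim_seq_spec. intros [e He]; simpl.
  destruct (H (e / 2)) as [N HN]; [lra|]. exists N; intros n Hn.
  eapply Rle_lt_trans; [apply Cmod_triangle_inv|]. specialize (HN n Hn). lra.
Qed.

Lemma is_lim_seq_sq u l : is_lim_seq u (Finite l) -> is_lim_seq (fun n => u n ^ 2) (Finite (l ^ 2)).
Proof.
  intros H. apply is_lim_seq_ext with (fun n => u n * u n); [intros; simpl; ring|].
  replace (l ^ 2) with (l * l) by ring. apply is_lim_seq_mult'; auto.
Qed.

Lemma is_lim_seq_rsum (u : nat -> nat -> R) (l : nat -> R) N : (forall m, (m < N)%nat -> is_lim_seq (fun n => u n m) (l m)) ->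
  is_lim_seq (fun n => rsum (u n) N) (rsum l N).
Proof.
  induction N as [|N IH]; intros H; simpl; [apply is_lim_seq_const|].
  apply (is_lim_seq_plus' (fun n => rsum (u n) N) (fun n => u n N)); auto.
Qed.

(** Cauchy-Schwarz after splitting [r ^ k] into two square roots. The weight [r ^ k] kept beside the
    squares is what makes the sum over all shifts converge. *)
Lemma sq_weighted_le (a : nat -> C) z n : Cmod z < 1 ->
  Cmod (pev a n z) ^ 2 <= / (1 - Cmod z) * rsum (fun k => Cmod z ^ k * Cmod (a k) ^ 2) n.
Proof.
  intros Hz. assert (H0 := Cmod_ge_0 z). set (r := Cmod z) in *.
  assert (H1 : Cmod (pev a n z) <= rsum (fun k => sqrt (r ^ k) * (sqrt (r ^ k) * Cmod (a k))) n).
  { eapply Rle_trans; [apply pev_dom; apply Rle_refl|]. apply Req_le, rsum_ext; intros k _.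
    rewrite <- Rmult_assoc, sqrt_sqrt by (apply pow_le; auto). fold r; ring. }
  apply Rle_trans with (rsum (fun k => sqrt (r ^ k) * (sqrt (r ^ k) * Cmod (a k))) n ^ 2).
  { apply pow_incr; split; auto; apply Cmod_ge_0. }
  eapply Rle_trans; [apply rsum_CS_sq|].
  rewrite (rsum_ext (fun k => sqrt (r ^ k) ^ 2) (fun k => r ^ k)) by (intros; apply pow2_sqrt, pow_le; auto).
  rewrite (rsum_ext (fun k => (sqrt (r ^ k) * Cmod (a k)) ^ 2) (fun k => r ^ k * Cmod (a k) ^ 2))
    by (intros; rewrite Rpow_mult_distr, pow2_sqrt; auto; apply pow_le; auto).
  apply Rmult_le_compat_r; [|apply rgeom_le; auto].
  apply rsum_nonneg; intros. apply Rmult_le_pos; [apply pow_le; auto|apply pow2_ge_0].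
Qed.

(** After [sq_weighted_le] the sums are exchanged: for fixed [k] the sum over [m] is at most [B],
    and the weights [r ^ k] contribute a second factor [/ (1 - r)]. *)
Lemma l2_tails_le (a : nat -> C) z B N : l2le a B -> Cmod z < 1 ->
  rsum (fun m => Cmod (peval (shift a m) z) ^ 2) N <= B / (1 - Cmod z) ^ 2.
Proof.
  intros Ha Hz. assert (Hh := l2le_holo a B Ha). assert (H0 := Cmod_ge_0 z).
  assert (HB := l2le_pos a B Ha).
  assert (L : is_lim_seq (fun n => rsum (fun m => Cmod (pev (shift a m) n z) ^ 2) N)
    (rsum (fun m => Cmod (peval (shift a m) z) ^ 2) N)).
  { apply (is_lim_seq_rsum (fun n m => Cmod (pev (shift a m) n z) ^ 2)). intros m _.
    apply is_lim_seq_sq, clim_Cmod, peval_clim; auto using holo_disk_shift. }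
  refine (is_lim_seq_le _ (fun _ => B / (1 - Cmod z) ^ 2) (Finite _) (Finite _) _ L (is_lim_seq_const _)).
  intros n.
  set (r := Cmod z) in *.
  apply Rle_trans with (rsum (fun m => / (1 - r) * rsum (fun k => r ^ k * Cmod (a (m + k)%nat) ^ 2) n) N).
  { apply rsum_le; intros m _. apply (sq_weighted_le (shift a m)); auto. }
  rewrite rsum_scal, rsum_swap.
  replace (B / (1 - r) ^ 2) with (/ (1 - r) * (B * / (1 - r))) by (field; lra).
  apply Rmult_le_compat_l; [left; apply Rinv_0_lt_compat; lra|].
  apply Rle_trans with (rsum (fun k => B * r ^ k) n).
  - apply rsum_le; intros k _. rewrite rsum_scal, Rmult_comm. apply Rmult_le_compat_r; [apply pow_le; auto|].
    eapply Rle_trans; [|apply (Ha (k + N)%nat)]. rewrite rsum_app.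
    assert (0 <= rsum (fun k => Cmod (a k) ^ 2) k) by (apply rsum_nonneg; intros; apply pow2_ge_0).
    rewrite (rsum_ext (fun i => Cmod (a (i + k)%nat) ^ 2) (fun i => Cmod (a (k + i)%nat) ^ 2)); [lra|].
    intros; rewrite Nat.add_comm; auto.
  - rewrite rsum_scal. apply Rmult_le_compat_l; auto. apply rgeom_le; lra.
Qed.

(** A closed form of $P|a|^2-|a|^2$; [bmo_gap_garsia_gap] identifies it with [bmo_gap]. *)
Definition garsia_gap (a : nat -> C) (z : C) : R :=
  (1 - Cmod z ^ 2) * Series (fun m => Cmod (peval (shift a (S m)) z) ^ 2).

Lemma ex_series_tails (a : nat -> C) z B : l2le a B -> Cmod z < 1 ->
  ex_series (fun m => Cmod (peval (shift a (S m)) z) ^ 2).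
Proof.
  intros Ha Hz. apply ex_series_bounded with (B / (1 - Cmod z) ^ 2).
  - intros; apply pow2_ge_0.
  - intros n. eapply Rle_trans; [|apply (l2_tails_le a z B (S n)); auto].
    rewrite rsum_shift. assert (H := pow2_ge_0 (Cmod (peval (shift a 0) z))). lra.
Qed.

Lemma one_minus_sq_pos (z : C) : Cmod z < 1 -> 0 < 1 - Cmod z ^ 2 <= 1.
Proof. intros H; assert (H0 := Cmod_ge_0 z); nra. Qed.

Lemma garsia_gap_nonneg (a : nat -> C) z B : l2le a B -> Cmod z < 1 -> 0 <= garsia_gap a z.
Proof.
  intros Ha Hz. apply Rmult_le_pos; [apply one_minus_sq_pos in Hz; lra|].
  apply (rsum_le_Series _ O); [intros; apply pow2_ge_0|apply (ex_series_tails a z B); auto].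
Qed.

Lemma garsia_gap_le (a : nat -> C) z B M : l2le a B -> Cmod z < 1 ->
  (forall n, (1 - Cmod z ^ 2) * rsum (fun m => Cmod (peval (shift a (S m)) z) ^ 2) n <= M) -> garsia_gap a z <= M.
Proof.
  intros Ha Hz H. assert (Hp := one_minus_sq_pos z Hz). unfold garsia_gap.
  apply Rmult_le_reg_l with (/ (1 - Cmod z ^ 2)); [apply Rinv_0_lt_compat; lra|].
  rewrite <- Rmult_assoc, Rinv_l, Rmult_1_l by lra.
  apply Series_le_bound; [apply (ex_series_tails a z B); auto|]. intros n.
  apply Rmult_le_reg_l with (1 - Cmod z ^ 2); [lra|].
  rewrite <- Rmult_assoc, Rinv_r, Rmult_1_l by lra. auto.
Qed.

Lemma garsia_gap_ge (a : nat -> C) z B n : l2le a B -> Cmod z < 1 ->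
  (1 - Cmod z ^ 2) * rsum (fun m => Cmod (peval (shift a (S m)) z) ^ 2) n <= garsia_gap a z.
Proof.
  intros Ha Hz. apply Rmult_le_compat_l; [apply one_minus_sq_pos in Hz; lra|].
  apply rsum_le_Series; [intros; apply pow2_ge_0|apply (ex_series_tails a z B); auto].
Qed.

Lemma garsia_gap_l2 (a : nat -> C) z B : l2le a B -> Cmod z < 1 -> garsia_gap a z <= B / (1 - Cmod z) ^ 2.
Proof.
  intros Ha Hz. apply (garsia_gap_le a z B); auto. intros n. assert (Hp := one_minus_sq_pos z Hz).
  assert (H1 := l2_tails_le a z B (S n) Ha Hz). rewrite rsum_shift in H1.
  assert (H2 := pow2_ge_0 (Cmod (peval (shift a 0) z))).
  assert (H3 : 0 <= rsum (fun m => Cmod (peval (shift a (S m)) z) ^ 2) n)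
    by (apply rsum_nonneg; intros; apply pow2_ge_0).
  nra.
Qed.

Lemma Cmod_minus_sq_le (x y : C) : Cmod (x - y)%C ^ 2 <= 2 * Cmod x ^ 2 + 2 * Cmod y ^ 2.
Proof.
  assert (H := Cmod_triangle x (- y)%C). rewrite Cmod_opp in H.
  assert (H0 := Cmod_ge_0 (x - y)%C). assert (H1 := pow2_ge_0 (Cmod x - Cmod y)).
  apply Rle_trans with ((Cmod x + Cmod y) ^ 2); [apply pow_incr; split; auto|nra].
Qed.

Lemma shift_csub (a b : nat -> C) m : shift (csub a b) m = csub (shift a m) (shift b m).
Proof. reflexivity. Qed.

Lemma l2le_csub (a b : nat -> C) A B : l2le a A -> l2le b B -> l2le (csub a b) (2 * A + 2 * B).
Proof.
  intros Ha Hb n. eapply Rle_trans; [apply rsum_le; intros k _; apply Cmod_minus_sq_le|].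
  rewrite rsum_plus, !rsum_scal. specialize (Ha n). specialize (Hb n). lra.
Qed.

Lemma garsia_gap_csub (a b : nat -> C) z A B : l2le a A -> l2le b B -> Cmod z < 1 ->
  garsia_gap (csub a b) z <= 2 * garsia_gap a z + 2 * garsia_gap b z.
Proof.
  intros Ha Hb Hz. apply (garsia_gap_le _ z _ _ (l2le_csub a b A B Ha Hb) Hz). intros n.
  assert (Hp := one_minus_sq_pos z Hz).
  assert (G1 := garsia_gap_ge a z A n Ha Hz). assert (G2 := garsia_gap_ge b z B n Hb Hz).
  apply Rle_trans with ((1 - Cmod z ^ 2) * (2 * rsum (fun m => Cmod (peval (shift a (S m)) z) ^ 2) n
    + 2 * rsum (fun m => Cmod (peval (shift b (S m)) z) ^ 2) n)); [|nra].
  apply Rmult_le_compat_l; [lra|]. rewrite <- !rsum_scal, <- rsum_plus. apply rsum_le; intros m _.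
  rewrite shift_csub, peval_csub by (eauto using holo_disk_shift, l2le_holo). apply Cmod_minus_sq_le.
Qed.

(** The value that $P|a|^2$ must take if [garsia_gap] is the gap. *)
Definition poisson_sq (a : nat -> C) (z : C) : R := Cmod (peval a z) ^ 2 + garsia_gap a z.

(** The cross term [2 * u * v] is at most [c * u ^ 2 + / c * v ^ 2]. A factor close to 1 before the
    main term is what later gives continuity. *)
Lemma Cmod_sq_pert (x y : C) c : 0 < c -> Cmod x ^ 2 <= (1 + c) * Cmod y ^ 2 + (1 + / c) * Cmod (x - y)%C ^ 2.
Proof.
  intros Hc. assert (H := Cmod_triangle y (x - y)%C). replace (y + (x - y))%C with x in H by ring.
  assert (H0 := Cmod_ge_0 x). set (u := Cmod y) in *. set (v := Cmod (x - y)%C) in *.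
  apply Rle_trans with ((u + v) ^ 2); [apply pow_incr; split; auto|].
  assert (K : 0 <= / c * (c * u - v) ^ 2) by (apply Rmult_le_pos; [left; apply Rinv_0_lt_compat; auto|apply pow2_ge_0]).
  replace (/ c * (c * u - v) ^ 2) with (c * u ^ 2 - 2 * u * v + / c * v ^ 2) in K by (field; lra). lra.
Qed.

(** The factor 2 pays for the value and for the gap, each perturbed by at most
    [D / (1 - Cmod z) ^ 2] times [1 + / c]. *)
Lemma poisson_sq_pert (a b : nat -> C) z A B D c : l2le a A -> l2le b B -> l2le (csub a b) D -> Cmod z < 1 -> 0 < c ->
  poisson_sq a z <= (1 + c) * poisson_sq b z + (1 + / c) * (2 * D / (1 - Cmod z) ^ 2).
Proof.
  intros Ha Hb Hd Hz Hc. assert (Hp := one_minus_sq_pos z Hz).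
  assert (Hc' : 0 < / c) by (apply Rinv_0_lt_compat; auto).
  assert (HaH := l2le_holo _ _ Ha). assert (HbH := l2le_holo _ _ Hb).
  assert (T := fun N => l2_tails_le _ z D N Hd Hz).
  assert (E : forall m, peval (shift (csub a b) m) z = (peval (shift a m) z - peval (shift b m) z)%C)
    by (intros; rewrite shift_csub; apply peval_csub; auto using holo_disk_shift).
  set (T0 := D / (1 - Cmod z) ^ 2) in *.
  assert (G : garsia_gap a z <= (1 + c) * garsia_gap b z + (1 + / c) * T0).
  { apply (garsia_gap_le a z A); auto. intros n. assert (G1 := garsia_gap_ge b z B n Hb Hz).
    assert (Tn := T (S n)). rewrite rsum_shift in Tn.
    assert (Q := pow2_ge_0 (Cmod (peval (shift (csub a b) 0) z))).
    set (X := rsum (fun m => Cmod (peval (shift a (S m)) z) ^ 2) n).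
    set (Y := rsum (fun m => Cmod (peval (shift b (S m)) z) ^ 2) n) in *.
    set (W := rsum (fun m => Cmod (peval (shift (csub a b) (S m)) z) ^ 2) n) in *.
    assert (K : X <= (1 + c) * Y + (1 + / c) * W).
    { unfold X, Y, W. rewrite <- !rsum_scal, <- rsum_plus. apply rsum_le; intros m _. rewrite E.
      apply Cmod_sq_pert; auto. }
    assert (HW : 0 <= W) by (apply rsum_nonneg; intros; apply pow2_ge_0).
    apply Rle_trans with ((1 - Cmod z ^ 2) * ((1 + c) * Y + (1 + / c) * W)); [apply Rmult_le_compat_l; lra|].
    assert ((1 - Cmod z ^ 2) * W <= T0) by nra. nra. }
  assert (P : Cmod (peval a z) ^ 2 <= (1 + c) * Cmod (peval b z) ^ 2 + (1 + / c) * T0).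
  { eapply Rle_trans; [apply (Cmod_sq_pert _ (peval b z) c); auto|].
    apply Rplus_le_compat_l, Rmult_le_compat_l; [lra|].
    assert (T1 := T 1%nat). simpl rsum in T1. rewrite (E O) in T1. simpl in *.
    change (shift a 0) with a in T1. change (shift b 0) with b in T1. lra. }
  unfold poisson_sq. replace (2 * D / (1 - Cmod z) ^ 2) with (T0 + T0) by (unfold T0; field; lra). lra.
Qed.

Lemma l2le_csub_sym a b D : l2le (csub a b) D -> l2le (csub b a) D.
Proof.
  intros H n. specialize (H n). rewrite (rsum_ext _ (fun k => Cmod (csub a b k) ^ 2)); auto.
  intros; unfold csub. rewrite Cmod_minus_sym; auto.
Qed.

(** Using [poisson_sq_pert] in both directions gives continuity in the $\ell^2$ distance of the
    coefficients, at a fixed [z]. *)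
Lemma poisson_sq_cont (b : nat -> C) z B : l2le b B -> Cmod z < 1 -> forall eps, 0 < eps ->
  exists D, 0 < D /\ forall a, l2le (csub a b) D -> Rabs (poisson_sq a z - poisson_sq b z) <= eps.
Proof.
  intros Hb Hz e He. assert (Hz0 := Cmod_ge_0 z).
  set (q := (1 - Cmod z) ^ 2). assert (Hq : 0 < q) by (unfold q; apply pow_lt; lra).
  assert (Hp := one_minus_sq_pos z Hz).
  assert (F : 0 <= poisson_sq b z)
    by (unfold poisson_sq; assert (H1 := garsia_gap_nonneg b z B Hb Hz); assert (H2 := pow2_ge_0 (Cmod (peval b z))); lra).
  set (f := poisson_sq b z) in *.
  (* [c] makes the relative error at most [e / 4] for both values, each being at most [f + e]; [D]
     then makes the additive error exactly [e / 2]. *)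
  set (c := e / (4 * (f + e + 1))). assert (Hc : 0 < c) by (apply Rdiv_lt_0_compat; lra).
  assert (Hcf : c * (f + e + 1) = e / 4) by (unfold c; field; lra).
  assert (Hic : 0 < / c) by (apply Rinv_0_lt_compat; auto).
  set (D := e / 2 * q / (2 * (1 + / c))).
  assert (HD : 0 < D) by (apply Rdiv_lt_0_compat; [apply Rmult_lt_0_compat; lra|lra]).
  exists D; split; auto. intros a Ha.
  (* An $\ell^2$ bound for [a] is recovered from those for [a - b] and [b]. *)
  assert (Ha' : exists A, l2le a A).
  { exists (2 * D + 2 * B). intros n.
    apply Rle_trans with (rsum (fun k => Cmod (csub (csub a b) (fun k => (- b k)%C) k) ^ 2) n).
    - apply Req_le, rsum_ext; intros k _. unfold csub. do 2 f_equal. ring.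
    - apply (l2le_csub (csub a b)); auto. intros m. rewrite (rsum_ext _ (fun k => Cmod (b k) ^ 2)); auto.
      intros; rewrite Cmod_opp; auto. }
  destruct Ha' as [A Ha'].
  assert (H1 := poisson_sq_pert a b z A B D c Ha' Hb Ha Hz Hc).
  assert (H2 := poisson_sq_pert b a z B A D c Hb Ha' (l2le_csub_sym _ _ _ Ha) Hz Hc).
  fold f in H1, H2. fold q in H1, H2.
  replace ((1 + / c) * (2 * D / q)) with (e / 2) in * by (unfold D; field; lra).
  set (x := poisson_sq a z) in *.
  assert (Hx : x <= f + e) by nra.
  assert (Hx0 : 0 <= x)
    by (unfold x, poisson_sq; assert (K1 := garsia_gap_nonneg a z A Ha' Hz); assert (K2 := pow2_ge_0 (Cmod (peval a z))); lra).
  apply Rabs_le; split; nra.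
Qed.

(** Dominated convergence for sums, uniform in the number of terms: finitely many terms are small by
    [Hlim], the tail by the bound [W]. The filter is arbitrary because multipliers and truncations
    use [eventually], dilations [at_left 1]. *)
Lemma tannery {T} (F : (T -> Prop) -> Prop) {FF : Filter F} (w : T -> nat -> R) (b : nat -> R) W B :
  (forall k, 0 <= b k) -> (forall n, rsum b n <= B) -> 0 <= W -> F (fun i => forall k, 0 <= w i k <= W) ->
  (forall k eps, 0 < eps -> F (fun i => w i k <= eps)) ->
  forall eps, 0 < eps -> F (fun i => forall n, rsum (fun k => w i k * b k) n <= eps).
Proof.
  intros Hb HB HW Hw Hlim e He.
  assert (Eb := ex_series_bounded b B Hb HB).
  destruct (rsum_Series_lim b Eb (e / (2 * (W + 1)))) as [N HN]; [apply Rdiv_lt_0_compat; lra|].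
  assert (Fin : F (fun i => rsum (fun k => w i k * b k) N <= e / 2)).
  { assert (HB0 : 0 <= rsum b N) by (apply rsum_nonneg; auto).
    set (d := e / (2 * (rsum b N + 1))). assert (Hd : 0 < d) by (apply Rdiv_lt_0_compat; lra).
    assert (A : F (fun i => forall k, (k < N)%nat -> w i k <= d)).
    { clearbody d. clear -FF Hlim Hd. induction N as [|N IH].
      - apply filter_forall; intros; lia.
      - generalize (filter_and _ _ IH (Hlim N d Hd)). apply filter_imp. intros i [H1 H2] k Hk.
        destruct (Nat.eq_dec k N) as [->|]; auto. apply H1; lia. }
    revert A; apply filter_imp; intros i Hi.
    apply Rle_trans with (d * rsum b N).
    - rewrite <- rsum_scal. apply rsum_le; intros; apply Rmult_le_compat_r; auto.
    - assert (d * (rsum b N + 1) = e / 2) by (unfold d; field; lra). nra. }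
  generalize (filter_and _ _ Fin Hw). apply filter_imp; intros i [Hi Hwi] n.
  assert (Hwb : forall k, 0 <= w i k * b k) by (intros; apply Rmult_le_pos; auto; apply Hwi).
  destruct (Nat.le_ge_cases n N) as [Hn|Hn].
  { apply Rle_trans with (rsum (fun k => w i k * b k) N); [apply rsum_mono; auto|lra]. }
  replace n with (N + (n - N))%nat by lia. rewrite rsum_app.
  assert (Q : rsum (fun k => w i (N + k)%nat * b (N + k)%nat) (n - N) <= W * rsum (fun k => b (N + k)%nat) (n - N)).
  { rewrite <- rsum_scal. apply rsum_le; intros; apply Rmult_le_compat_r; auto; apply Hwi. }
  assert (Q2 : rsum (fun k => b (N + k)%nat) (n - N) <= e / (2 * (W + 1))).
  { assert (K := rsum_app b N (n - N)). replace (N + (n - N))%nat with n in K by lia.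
    assert (K2 := rsum_le_Series b n Hb Eb). specialize (HN N (le_n N)). apply Rabs_le_between in HN. lra. }
  assert (W * rsum (fun k => b (N + k)%nat) (n - N) <= e / 2).
  { apply Rle_trans with (W * (e / (2 * (W + 1)))); [apply Rmult_le_compat_l; auto|].
    apply Rmult_le_reg_r with (2 * (W + 1)); [lra|].
    replace (W * (e / (2 * (W + 1))) * (2 * (W + 1))) with (W * e) by (field; lra). nra. }
  lra.
Qed.

(** * Limits at [1] and the gap as a limit of Poisson integrals *)

(** [lim_left1] is a choice; once a limit is exhibited, uniqueness of limits identifies the chosen
    value. *)
Lemma lim_left1_eq (h : R -> R) L :
  (forall eps, 0 < eps -> at_left 1 (fun r => Rabs (h r - L) <= eps)) -> lim_left1 h = L.
Proof.
  intros H.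
  assert (HL : filterlim h (at_left 1) (locally L)).
  { apply filterlim_locally. intros [e He]. generalize (H (e / 2) ltac:(lra)).
    apply filter_imp; intros r Hr. unfold ball; simpl; unfold AbsRing_ball, abs, minus, plus, opp; simpl.
    unfold Rminus in Hr. lra. }
  apply (filterlim_locally_unique (F := at_left 1) h); auto.
  unfold lim_left1. apply epsilon_spec. exists L; auto.
Qed.

Lemma at_left1_gt s : s < 1 -> at_left 1 (fun r => s < r < 1).
Proof.
  intros Hs. exists (mkposreal (1 - s) ltac:(lra)). intros r Hr Hr1.
  unfold ball in Hr; simpl in Hr; unfold AbsRing_ball, abs, minus, plus, opp in Hr; simpl in Hr.
  apply Rabs_def2 in Hr. lra.
Qed.

Lemma Lub_Rbar_bounded (P : R -> Prop) : Rbar_lt (Lub_Rbar P) p_infty -> exists B, forall x, P x -> x <= B.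
Proof.
  intros H. destruct (Lub_Rbar_correct P) as [Hub _].
  destruct (Lub_Rbar P) as [l| |]; simpl in H; try contradiction.
  - exists l; intros x Hx; apply (Hub x Hx).
  - exists 0; intros x Hx; destruct (Hub x Hx).
Qed.

Lemma Lub_Rbar_le (P : R -> Prop) B : (forall x, P x -> x <= B) -> Rbar_le (Lub_Rbar P) (Finite B).
Proof. intros H. destruct (Lub_Rbar_correct P) as [_ Hl]. apply Hl. intros x Hx; apply H; auto. Qed.

(** * Truncations, dilations and the identification of the gap *)

Definition trunc (a : nat -> C) (n k : nat) : C := if lt_dec k n then a k else RtoC 0.
Definition dil (a : nat -> C) (r : R) (k : nat) : C := (a k * RtoC r ^ k)%C.

Lemma trunc_ge (a : nat -> C) n k : (n <= k)%nat -> trunc a n k = RtoC 0.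
Proof. intros H; unfold trunc; destruct (lt_dec k n); [lia|auto]. Qed.

Lemma pev_trunc (a : nat -> C) n z : pev (trunc a n) n z = pev a n z.
Proof. apply csum_ext; intros k Hk; unfold trunc; destruct (lt_dec k n); [auto|lia]. Qed.

Lemma l2le_trunc (a : nat -> C) B : l2le a B -> forall D, 0 < D ->
  exists N, forall n, (N <= n)%nat -> l2le (csub (trunc a n) a) D.
Proof.
  intros Ha D HD.
  destruct (tannery eventually (fun n k => if lt_dec k n then 0 else 1) (fun k => Cmod (a k) ^ 2) 1 B)
    with (eps := D) as [N HN]; auto.
  - intros; apply pow2_ge_0.
  - lra.
  - apply filter_forall. intros i k; destruct (lt_dec k i); lra.
  - intros k e He. exists (S k); intros n Hn. destruct (lt_dec k n); [lra|lia].
  - exists N; intros n Hn m. eapply Rle_trans; [|apply (HN n Hn m)].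
    apply Req_le, rsum_ext; intros k _. unfold csub, trunc. destruct (lt_dec k n).
    + replace (a k - a k)%C with (RtoC 0) by ring. rewrite Cmod_0; ring.
    + replace (0 - a k)%C with (- a k)%C by ring. rewrite Cmod_opp; ring.
Qed.

Lemma pow_1_minus r k : 0 <= r <= 1 -> 0 <= 1 - r ^ k <= INR k * (1 - r).
Proof.
  intros Hr. induction k as [|k IH]; [simpl; lra|]. rewrite S_INR. simpl pow.
  assert (0 <= r ^ k) by (apply pow_le; lra). nra.
Qed.

Lemma Cmod_dil (a : nat -> C) r k : 0 <= r -> Cmod (dil a r k) = Cmod (a k) * r ^ k.
Proof. intros Hr; unfold dil; rewrite Cmod_mult, Cmod_pow, Cmod_R, Rabs_pos_eq; auto. Qed.

Lemma Cmod_1_minus_pow r k : 0 <= r <= 1 -> Cmod (1 - RtoC r ^ k)%C = 1 - r ^ k.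
Proof.
  intros Hr. assert (H := pow_1_minus r k Hr).
  rewrite <- RtoC_pow, <- RtoC_minus, Cmod_R, Rabs_pos_eq; lra.
Qed.

Lemma at_left1_pow k eps : 0 < eps -> at_left 1 (fun r => 0 < r < 1 /\ 1 - r ^ k <= eps).
Proof.
  intros He. set (s := Rmax 0 (1 - eps / (INR k + 1))).
  assert (Hk := pos_INR k).
  assert (Hs : s < 1).
  { unfold s. apply Rmax_lub_lt; [lra|]. assert (0 < eps / (INR k + 1)) by (apply Rdiv_lt_0_compat; lra). lra. }
  generalize (at_left1_gt s Hs). apply filter_imp; intros r [Hr1 Hr2].
  assert (0 < r) by (assert (H := Rmax_l 0 (1 - eps / (INR k + 1))); fold s in H; lra).
  split; [lra|]. assert (H1 := pow_1_minus r k ltac:(lra)).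
  assert (H2 := Rmax_r 0 (1 - eps / (INR k + 1))). fold s in H2.
  assert (H3 : (eps / (INR k + 1)) * (INR k + 1) = eps) by (field; lra).
  assert (1 - r <= eps / (INR k + 1)) by lra. nra.
Qed.

Lemma l2le_dil (a : nat -> C) B r : l2le a B -> 0 <= r <= 1 -> l2le (dil a r) B.
Proof.
  intros Ha Hr n. eapply Rle_trans; [|apply (Ha n)]. apply rsum_le; intros k _.
  apply pow_incr; split; [apply Cmod_ge_0|]. rewrite Cmod_dil by lra.
  assert (H := pow_1_minus r k Hr). assert (H0 := Cmod_ge_0 (a k)). nra.
Qed.

Lemma l2le_dil_lim (a : nat -> C) B : l2le a B -> forall D, 0 < D ->
  at_left 1 (fun r => l2le (csub (dil a r) a) D).
Proof.
  intros Ha D HD. assert (T0 := at_left1_gt 0 ltac:(lra)).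
  assert (T : at_left 1 (fun r => forall n, rsum (fun k => (1 - r ^ k) ^ 2 * Cmod (a k) ^ 2) n <= D)).
  { apply (tannery (at_left 1) (fun r k => (1 - r ^ k) ^ 2) (fun k => Cmod (a k) ^ 2) 1 B); auto; [| lra | |].
    - intros; apply pow2_ge_0.
    - revert T0; apply filter_imp; intros r Hr k. assert (H := pow_1_minus r k ltac:(lra)).
      assert (H1 : 0 <= r ^ k) by (apply pow_le; lra). nra.
    - intros k e He. generalize (at_left1_pow k e He). apply filter_imp; intros r [Hr1 Hr2].
      assert (H1 : 0 <= r ^ k) by (apply pow_le; lra). assert (H2 := pow_1_minus r k ltac:(lra)). nra. }
  generalize (filter_and _ _ T0 T). apply filter_imp; intros r [Hr H] n.
  eapply Rle_trans; [|apply (H n)]. apply Req_le, rsum_ext; intros k _. unfold csub, dil.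
  replace (a k * RtoC r ^ k - a k)%C with (- ((1 - RtoC r ^ k) * a k))%C by ring.
  rewrite Cmod_opp, Cmod_mult, Cmod_1_minus_pow by lra. ring.
Qed.

Lemma Series_finite f n : (forall k, (n <= k)%nat -> f k = 0) -> Series f = rsum f n.
Proof.
  intros H.
  assert (Ef : ex_series f).
  { apply ex_series_Rabs, ex_series_bounded with (rsum (fun k => Rabs (f k)) n).
    - intros; apply Rabs_pos.
    - intros m. destruct (Nat.le_ge_cases m n).
      + apply rsum_mono; auto. intros; apply Rabs_pos.
      + rewrite (rsum_trunc _ n m); auto; [lra|]. intros; rewrite H by lia; apply Rabs_R0. }
  rewrite (Series_split f n Ef). rewrite (Series_ext _ (fun k => 0 * f k)) by (intros; rewrite H by lia; ring).
  rewrite Series_scal_l. ring.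
Qed.

Lemma poisson_sq_finite (h : nat -> C) n z : (forall k, (n <= k)%nat -> h k = RtoC 0) -> Cmod z < 1 ->
  poisson_sq h z = Cmod (pev h n z) ^ 2 + (1 - Cmod z ^ 2) * rsum (fun m => Cmod (pev (shift h (S m)) n z) ^ 2) n.
Proof.
  intros H Hz. unfold poisson_sq, garsia_gap. rewrite (peval_finite h n) by auto.
  rewrite (Series_finite _ n).
  - do 2 f_equal. apply rsum_ext; intros m _. rewrite (peval_finite _ n); auto.
    intros k Hk; unfold shift; apply H; lia.
  - intros m Hm. rewrite (peval_finite _ O); auto.
    + unfold pev; cbn [csum]. rewrite Cmod_0; ring.
    + intros k Hk; unfold shift; apply H; lia.
Qed.

Lemma mean_poisson_sub_le (f g : R -> R) z e : rcont f -> rcont g -> Cmod z < 1 ->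
  (forall t, Rabs (f t - g t) <= e) ->
  Rabs (mean (fun t => f t * poisson z t) - mean (fun t => g t * poisson z t)) <= e.
Proof.
  intros Hf Hg Hz H. assert (HP := rcont_poisson z Hz).
  assert (Hb : forall t, (f t - g t) * poisson z t <= e * poisson z t /\ - e * poisson z t <= (f t - g t) * poisson z t).
  { intros t. assert (P := poisson_pos z t Hz). assert (K := H t). apply Rabs_le_between in K. nra. }
  rewrite <- mean_minus by auto with cont.
  rewrite (mean_ext _ (fun t => (f t - g t) * poisson z t)) by (intros; ring).
  assert (M := mean_poisson z Hz).
  apply Rabs_le; split.
  - replace (- e) with (mean (fun t => - e * poisson z t)) by (rewrite mean_scal, M; auto; ring).
    apply mean_le; auto with cont. intros; apply Hb.
  - replace e with (mean (fun t => e * poisson z t)) by (rewrite mean_scal, M; auto; ring).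
    apply mean_le; auto with cont. intros; apply Hb.
Qed.

Lemma sq_sub_le (x y : C) K : Cmod x <= K -> Cmod y <= K ->
  Rabs (Cmod x ^ 2 - Cmod y ^ 2) <= 2 * K * Cmod (x - y)%C.
Proof.
  intros Hx Hy. replace (Cmod x ^ 2 - Cmod y ^ 2) with ((Cmod x + Cmod y) * (Cmod x - Cmod y)) by ring.
  rewrite Rabs_mult. assert (H := Cmod_triangle_inv x y).
  assert (H0 := Cmod_ge_0 x). assert (H1 := Cmod_ge_0 y).
  rewrite Rabs_pos_eq by lra. apply Rmult_le_compat; try lra. apply Rabs_pos.
Qed.

Lemma peval_dil (a : nat -> C) r w n : pev a n (RtoC r * w)%C = pev (dil a r) n w.
Proof. apply pev_scal_arg. Qed.

Lemma pev_unif_bound (a : nat -> C) r : holo_disk a -> 0 <= r < 1 ->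
  exists K, 0 < K /\ (forall n z, Cmod z <= r -> Cmod (pev a n z) <= K) /\
    (forall z, Cmod z <= r -> Cmod (peval a z) <= K).
Proof.
  intros Ha Hr. assert (Hs := holo_disk_R a r Ha Hr).
  assert (Hp : forall k, 0 <= Cmod (a k) * r ^ k)
    by (intros; apply Rmult_le_pos; [apply Cmod_ge_0|apply pow_le; lra]).
  set (S0 := Series (fun k => Cmod (a k) * r ^ k)).
  assert (HS : forall n, rsum (fun k => Cmod (a k) * r ^ k) n <= S0)
    by (intros; apply rsum_le_Series; auto).
  assert (B : forall n z, Cmod z <= r -> Cmod (pev a n z) <= S0 + 1).
  { intros n z Hz. eapply Rle_trans; [apply pev_dom; eauto|]. specialize (HS n). lra. }
  exists (S0 + 1); repeat split; auto.
  - assert (H := HS O). simpl in H. lra.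
  - intros z Hz. apply clim_Cmod_le with (fun n => pev a n z); [apply peval_clim; auto; lra|].
    exists O; auto.
Qed.

(** For polynomials this is [mean_sq_poisson]. Truncation perturbs both sides little: the left by
    uniform convergence on the circle of radius [r], the right by [poisson_sq_cont]. *)
Lemma poisson_mean_poisson_sq (a : nat -> C) B r z : l2le a B -> 0 <= r < 1 -> Cmod z < 1 ->
  mean (fun t => Cmod (peval a (RtoC r * cis t)%C) ^ 2 * poisson z t) = poisson_sq (dil a r) z.
Proof.
  intros Ha Hr Hz. assert (Hh := l2le_holo a B Ha). assert (Hd := l2le_dil a B r Ha ltac:(lra)).
  destruct (pev_unif_bound a r Hh Hr) as [K [HK [K1 K2]]].
  apply Rminus_diag_uniq. apply Rabs_eq_0. apply Rle_antisym; [|apply Rabs_pos].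
  apply le_epsilon; intros e He. rewrite Rplus_0_l.
  destruct (poisson_sq_cont (dil a r) z B Hd Hz (e / 2)) as [D [HD HPhi]]; [lra|].
  destruct (l2le_trunc (dil a r) B Hd D HD) as [N1 HN1].
  destruct (peval_unif a r Hh Hr (e / (4 * K))) as [N2 HN2]; [apply Rdiv_lt_0_compat; lra|].
  set (n := (N1 + N2)%nat). specialize (HPhi _ (HN1 n ltac:(unfold n; lia))).
  rewrite (poisson_sq_finite _ n) in HPhi by (auto; intros; apply trunc_ge; auto).
  rewrite <- mean_sq_poisson in HPhi by (auto; intros; apply trunc_ge; auto).
  assert (Hc := ccont_peval_cis a r Hh Hr).
  assert (HcP : ccont (fun t => pev a n (RtoC r * cis t)%C)) by (apply ccont_pev; auto with cont).
  assert (M := mean_poisson_sub_le (fun t => Cmod (peval a (RtoC r * cis t)%C) ^ 2)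
    (fun t => Cmod (pev a n (RtoC r * cis t)%C) ^ 2) z (e / 2)).
  rewrite (mean_ext (fun t => Cmod (pev (trunc (dil a r) n) n (cis t)) ^ 2 * poisson z t)
    (fun t => Cmod (pev a n (RtoC r * cis t)%C) ^ 2 * poisson z t)) in HPhi.
  2:{ intros t; rewrite pev_trunc, peval_dil; auto. }
  assert (M' : Rabs (mean (fun t => Cmod (peval a (RtoC r * cis t)%C) ^ 2 * poisson z t)
    - mean (fun t => Cmod (pev a n (RtoC r * cis t)%C) ^ 2 * poisson z t)) <= e / 2).
  { apply M; auto; try (apply (rcont_pow _ 2); auto with cont). intros t.
    assert (Hz1 : Cmod (RtoC r * cis t)%C <= r) by (rewrite Cmod_r_cis; lra).
    eapply Rle_trans; [apply (sq_sub_le _ _ K); auto|].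
    specialize (HN2 n _ ltac:(unfold n; lia) Hz1). rewrite Cmod_minus_sym.
    replace (e / 2) with (2 * K * (e / (4 * K))) by (field; lra). apply Rmult_le_compat_l; lra. }
  apply Rabs_le_between in M'. apply Rabs_le_between in HPhi. apply Rabs_le; lra.
Qed.

(** At each radius [r] the Poisson integral equals [poisson_sq (dil a r) z] exactly, and [dil a r]
    tends to [a] in $\ell^2$. *)
Lemma bmo_gap_garsia_gap (a : nat -> C) B z : l2le a B -> Cmod z < 1 -> bmo_gap a z = garsia_gap a z.
Proof.
  intros Ha Hz. unfold bmo_gap. replace (P_abs2 a z) with (poisson_sq a z); [unfold poisson_sq; ring|].
  symmetry; unfold P_abs2. apply lim_left1_eq; intros e He.
  destruct (poisson_sq_cont a z B Ha Hz e He) as [D [HD HPhi]].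
  assert (T0 := at_left1_gt 0 ltac:(lra)). assert (T := l2le_dil_lim a B Ha D HD).
  generalize (filter_and _ _ T0 T).
  apply filter_imp; intros r [Hr Hd].
  change (Rabs (mean (fun t => Cmod (peval a (RtoC r * cis t)%C) ^ 2 * poisson z t) - poisson_sq a z) <= e).
  rewrite (poisson_mean_poisson_sq a B r z) by (auto; lra). apply HPhi; auto.
Qed.

(** Bessel's inequality on each circle bounds the partial sums for [dil a r]; then [r] tends to 1
    along [1 - / (INR j + 1)]. *)
Lemma in_H2_l2le (a : nat -> C) : in_H2 a -> exists B, l2le a B.
Proof.
  intros [Hh Hb]. destruct (Lub_Rbar_bounded _ Hb) as [B HB]. exists B. intros n.
  assert (K : forall r, 0 <= r < 1 -> rsum (fun k => Cmod (dil a r k) ^ 2) n <= B).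
  { intros r Hr. apply Rle_trans with (M2sq a r); [|apply HB; exists r; auto].
    change (M2sq a r) with (mean (fun t => Cmod (peval a (RtoC r * cis t)%C) ^ 2)).
    eapply Rle_trans; [|apply (Bessel _ (fun k t => (cis t ^ k)%C) n)].
    - apply Req_le, rsum_ext; intros k _. rewrite Cmean_peval_cis; auto.
    - apply ccont_peval_cis; auto.
    - auto with cont.
    - apply Cmean_cis_orth. }
  assert (L : is_lim_seq (fun j => rsum (fun k => Cmod (dil a (1 - / (INR j + 1)) k) ^ 2) n)
    (rsum (fun k => Cmod (a k) ^ 2) n)).
  { apply (is_lim_seq_rsum (fun j k => Cmod (dil a (1 - / (INR j + 1)) k) ^ 2)). intros k _.
    apply is_lim_seq_sq.
    apply is_lim_seq_ext with (fun j => Cmod (a k) * (1 - / (INR j + 1)) ^ k).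
    { intros j. rewrite Cmod_dil; auto. assert (H := pos_INR j).
      assert (/ (INR j + 1) <= / 1) by (apply Rinv_le_contravar; lra). lra. }
    enough (X : is_lim_seq (fun j => Cmod (a k) * (1 - / (INR j + 1)) ^ k) (Cmod (a k) * 1 ^ k))
      by (rewrite pow1, Rmult_1_r in X; exact X).
    apply is_lim_seq_mult'; [apply is_lim_seq_const|].
    assert (L1 : is_lim_seq (fun j => 1 - / (INR j + 1)) 1).
    { replace (Finite 1) with (Finite (1 - 0)) by (f_equal; ring).
      apply is_lim_seq_minus'; [apply is_lim_seq_const|].
      replace (Finite 0) with (Rbar_inv p_infty) by reflexivity.
      apply is_lim_seq_inv; [|discriminate].
      apply is_lim_seq_ext with (fun j => INR (S j)); [intros; apply S_INR|].
      apply (is_lim_seq_incr_1 INR), is_lim_seq_INR. }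
    clear -L1. induction k as [|k IH]; simpl; [apply is_lim_seq_const|].
    apply is_lim_seq_mult'; auto. }
  refine (is_lim_seq_le _ (fun _ => B) (Finite _) (Finite _) _ L (is_lim_seq_const _)).
  intros j. apply K. assert (H := pos_INR j).
  assert (/ (INR j + 1) <= / 1) by (apply Rinv_le_contravar; lra).
  assert (0 < / (INR j + 1)) by (apply Rinv_0_lt_compat; lra). lra.
Qed.

(** * Cesaro numbers and the Cesaro kernel *)

(* [cesA alpha m] is binom(m + alpha, m), and [cesB alpha m] is binom(m + alpha - 1, m). *)
Fixpoint cesA (alpha : R) (m : nat) : R :=
  match m with O => 1 | S k => cesA alpha k * ((INR (S k) + alpha) / INR (S k)) end.
Definition cesB (alpha : R) (m : nat) : R := cesA alpha m * (alpha / (INR m + alpha)).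

Lemma cesA_pos alpha m : 0 < alpha -> 0 < cesA alpha m.
Proof.
  intros Ha. induction m as [|m IH]; [simpl; lra|].
  cbn [cesA]. assert (H : 0 < INR (S m)) by (apply lt_0_INR; lia).
  apply Rmult_lt_0_compat; auto. apply Rdiv_lt_0_compat; lra.
Qed.

Lemma cesB_pos alpha m : 0 < alpha -> 0 < cesB alpha m.
Proof.
  intros Ha. assert (H := pos_INR m). apply Rmult_lt_0_compat; [apply cesA_pos; auto|].
  apply Rdiv_lt_0_compat; lra.
Qed.

(** The hockey-stick identity for non-integer order. It makes the weights in [ces_kernel] sum to
    1. *)
Lemma cesB_sum alpha m : 0 < alpha -> rsum (cesB alpha) (S m) = cesA alpha m.
Proof.
  intros Ha. induction m as [|m IH].
  - unfold rsum, cesB. simpl. field. lra.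
  - cbn [rsum] in *. rewrite IH. unfold cesB. cbn [cesA]. rewrite S_INR.
    assert (H := pos_INR m). field. lra.
Qed.

Lemma cesB_S alpha m : 0 < alpha -> cesB alpha (S m) = cesB alpha m * ((INR m + alpha) / (INR m + 1)).
Proof.
  intros Ha. unfold cesB. cbn [cesA]. rewrite S_INR. assert (H := pos_INR m). field. lra.
Qed.

Lemma falling_pos x k : INR k - 1 < x -> 0 < falling x k.
Proof.
  induction k as [|k IH]; intros H; [simpl; lra|].
  cbn [falling]. rewrite S_INR in H. apply Rmult_lt_0_compat; [apply IH|]; lra.
Qed.

(** The multiplier sequence of [sigma_na], extended by 0 so that the truncation is part of the
    multiplier. *)
Definition ces_mult (alpha : R) (n k : nat) : R :=
  if (k <=? n)%nat then gbinom (INR n) k / gbinom (INR n + alpha) k else 0.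

Lemma sigma_na_mult alpha n a k : sigma_na alpha n a k = (RtoC (ces_mult alpha n k) * a k)%C.
Proof. unfold sigma_na, ces_mult. destruct (k <=? n)%nat; [reflexivity|ring]. Qed.

(** The factor [(n - k) / (n + alpha - k)] gained when [k] increases is the inverse of the last
    factor of [cesA alpha (n - k)]. *)
Lemma ces_mult_eq alpha n k : 0 < alpha -> (k <= n)%nat ->
  ces_mult alpha n k = cesA alpha (n - k) / cesA alpha n.
Proof.
  intros Ha Hk. unfold ces_mult. rewrite (proj2 (Nat.leb_le k n) Hk). unfold gbinom.
  assert (Hf : forall k, (k <= n)%nat -> falling (INR n + alpha) k <> 0).
  { intros j Hj. apply le_INR in Hj. assert (H := falling_pos (INR n + alpha) j ltac:(lra)). lra. }
  assert (HA : forall m, cesA alpha m <> 0) by (intros m; assert (H := cesA_pos alpha m Ha); lra).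
  assert (E : falling (INR n) k / falling (INR n + alpha) k = cesA alpha (n - k) / cesA alpha n).
  { induction k as [|k IH].
    - simpl. rewrite Nat.sub_0_r. field. auto.
    - specialize (IH ltac:(lia)). assert (Hk1 := Hf k ltac:(lia)). assert (Hk2 := Hf (S k) Hk).
      cbn [falling] in *.
      assert (Hd : INR n + alpha - INR k <> 0) by (intros E; apply Hk2; rewrite E; ring).
      replace (falling (INR n) k * (INR n - INR k) / (falling (INR n + alpha) k * (INR n + alpha - INR k)))
        with (falling (INR n) k / falling (INR n + alpha) k * ((INR n - INR k) / (INR n + alpha - INR k)))
        by (field; auto).
      rewrite IH. replace (n - k)%nat with (S (n - S k)) by lia. cbn [cesA].
      assert (EI : INR (S (n - S k)) = INR n - INR k).
      { rewrite <- minus_INR by lia. f_equal; lia. }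
      rewrite EI. assert (Hn : INR k < INR n) by (apply lt_INR; lia).
      field. repeat split; auto; lra. }
  rewrite <- E. field. split; auto. apply INR_fact_neq_0.
Qed.

Lemma ces_mult_0 alpha n k : (n < k)%nat -> ces_mult alpha n k = 0.
Proof. intros H; unfold ces_mult. rewrite (proj2 (Nat.leb_gt k n) H); auto. Qed.

Lemma cesA_incr alpha m n : 0 < alpha -> (m <= n)%nat -> cesA alpha m <= cesA alpha n.
Proof.
  intros Ha Hmn. rewrite <- !cesB_sum by auto. apply rsum_mono; [|lia].
  intros; left; apply cesB_pos; auto.
Qed.

Lemma ces_mult_bound alpha n k : 0 < alpha -> 0 <= ces_mult alpha n k <= 1.
Proof.
  intros Ha. destruct (Nat.le_gt_cases k n) as [H|H].
  - rewrite ces_mult_eq by auto. assert (H1 := cesA_pos alpha n Ha).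
    assert (H2 := cesA_pos alpha (n - k) Ha). assert (H3 := cesA_incr alpha (n - k) n Ha ltac:(lia)).
    split; [left; apply Rdiv_lt_0_compat; auto|].
    apply Rmult_le_reg_r with (cesA alpha n); auto. unfold Rdiv. rewrite Rmult_assoc, Rinv_l; lra.
  - rewrite ces_mult_0 by auto; lra.
Qed.

Lemma ces_mult_O alpha n : 0 < alpha -> ces_mult alpha n 0 = 1.
Proof.
  intros Ha. rewrite ces_mult_eq, Nat.sub_0_r by (auto; lia). assert (H := cesA_pos alpha n Ha). field; lra.
Qed.

(** Successive multipliers have ratio [1 - alpha / (n + alpha - k)], which tends to 1. *)
Lemma ces_mult_lim alpha k : 0 < alpha -> is_lim_seq (fun n => ces_mult alpha n k) 1.
Proof.
  intros Ha. induction k as [|k IH].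
  - apply is_lim_seq_ext with (fun _ => 1); [intros; rewrite ces_mult_O; auto|apply is_lim_seq_const].
  - assert (L0 : is_lim_seq (fun n => / (INR n + (alpha - INR k))) 0).
    { replace (Finite 0) with (Rbar_inv p_infty) by reflexivity.
      apply is_lim_seq_inv; [|discriminate].
      apply (is_lim_seq_plus _ _ p_infty (alpha - INR k)); [apply is_lim_seq_INR|apply is_lim_seq_const|reflexivity]. }
    assert (L1 : is_lim_seq (fun n => 1 - alpha * / (INR n + (alpha - INR k))) 1).
    { replace (Finite 1) with (Finite (1 - alpha * 0)) by (f_equal; ring).
      apply is_lim_seq_minus'; [apply is_lim_seq_const|].
      apply is_lim_seq_mult'; [apply is_lim_seq_const|auto]. }
    assert (L2 := is_lim_seq_mult' _ _ _ _ IH L1). rewrite Rmult_1_l in L2.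
    revert L2. apply is_lim_seq_ext_loc. exists (S k). intros n Hn.
    rewrite !ces_mult_eq by (auto; lia).
    replace (n - k)%nat with (S (n - S k)) by lia. cbn [cesA].
    assert (EI : INR (S (n - S k)) = INR n - INR k).
    { rewrite <- minus_INR by lia. f_equal; lia. }
    rewrite EI. assert (Hn' : INR k < INR n) by (apply lt_INR; lia).
    assert (H := cesA_pos alpha n Ha). field. lra.
Qed.

(** The sum of $e^{ikt}$ over $|k|\le l$, in real form. *)
Definition dirichlet (l : nat) (t : R) : R := 1 + 2 * rsum (fun k => cos (INR (S k) * t)) l.
(** Frequency [k] is present in the Dirichlet kernel of degree [n - j] exactly when [j <= n - k], so
    it receives the weight [cesA alpha (n - k) / cesA alpha n], as [ces_mult] demands. *)
Definition ces_kernel (alpha : R) (n : nat) (t : R) : R :=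
  / cesA alpha n * rsum (fun j => cesB alpha j * dirichlet (n - j) t) (S n).

Lemma rcont_dirichlet l : rcont (dirichlet l).
Proof.
  unfold dirichlet. apply rcont_plus; auto with cont. apply rcont_mult; auto with cont.
  apply (rcont_rsum (fun k t => cos (INR (S k) * t))); auto with cont.
Qed.

Lemma rcont_ces_kernel alpha n : rcont (ces_kernel alpha n).
Proof.
  unfold ces_kernel. apply rcont_mult; auto with cont.
  apply (rcont_rsum (fun j t => cesB alpha j * dirichlet (n - j) t)).
  intros; apply rcont_mult; auto with cont. apply rcont_dirichlet.
Qed.

Lemma Cmean_dirichlet l k :
  Cmean (fun t => RtoC (dirichlet l t) * Cconj (cis t ^ k))%C = RtoC (if le_dec k l then 1 else 0).
Proof.
  induction l as [|l IH].
  - rewrite (Cmean_ext _ (fun t => cis t ^ 0 * Cconj (cis t ^ k))%C).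
    + rewrite Cmean_cis_orth. destruct (Nat.eq_dec 0 k), (le_dec k 0); auto; lia.
    + intros t; unfold dirichlet; simpl. rewrite Rmult_0_r, Rplus_0_r; auto.
  - rewrite (Cmean_ext _ (fun t => RtoC (dirichlet l t) * Cconj (cis t ^ k)
       + (cis t ^ S l * Cconj (cis t ^ k) + Cconj (cis t ^ (S l + k))))%C).
    + assert (K := ccont_RtoC _ (rcont_dirichlet l)).
      rewrite !Cmean_plus, IH, Cmean_cis_orth, Cmean_conj, Cmean_cis_pow by (auto 8 with cont; lia).
      destruct (le_dec k l), (le_dec k (S l)), (Nat.eq_dec (S l) k); try lia; apply C_ext; simpl; ring.
    + intros t.
      assert (E : RtoC (dirichlet (S l) t) = (RtoC (dirichlet l t) + (cis t ^ S l + Cconj (cis t ^ S l)))%C).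
      { rewrite cis_pow. unfold dirichlet. cbn [rsum]. unfold cis.
        generalize (rsum (fun k => cos (INR (S k) * t)) l), (INR (S l) * t); intros x y.
        apply C_ext; simpl; ring. }
      rewrite E, Cpow_add_r, Cmult_conj. ring.
Qed.

Lemma Cmean_ces_kernel alpha n k : 0 < alpha ->
  Cmean (fun t => RtoC (ces_kernel alpha n t) * Cconj (cis t ^ k))%C = RtoC (ces_mult alpha n k).
Proof.
  intros Ha. assert (HA := cesA_pos alpha n Ha).
  rewrite (Cmean_ext _ (fun t => csum (fun j => RtoC (/ cesA alpha n * cesB alpha j)
     * (RtoC (dirichlet (n - j) t) * Cconj (cis t ^ k)))%C (S n))).
  2:{ intros t. unfold ces_kernel. rewrite RtoC_mult, <- csum_RtoC.
      rewrite <- csum_scal, <- csum_scal_r. apply csum_ext; intros. rewrite !RtoC_mult. ring. }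
  assert (K := fun l => ccont_RtoC _ (rcont_dirichlet l)).
  rewrite (Cmean_csum (fun j t => RtoC (/ cesA alpha n * cesB alpha j)
     * (RtoC (dirichlet (n - j) t) * Cconj (cis t ^ k)))%C) by auto 8 with cont.
  rewrite (csum_ext _ (fun j => RtoC (/ cesA alpha n * cesB alpha j * (if le_dec k (n - j) then 1 else 0)))).
  2:{ intros j _. rewrite Cmean_scal, Cmean_dirichlet by auto with cont. rewrite <- RtoC_mult; auto. }
  rewrite csum_RtoC. f_equal.
  destruct (Nat.le_gt_cases k n) as [H|H].
  - rewrite ces_mult_eq by auto. replace (S n) with (S (n - k) + k)%nat by lia. rewrite rsum_app.
    rewrite (rsum_ext (fun i => / cesA alpha n * cesB alpha (S (n - k) + i)%nat * _) (fun _ => 0)).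
    2:{ intros j Hj. destruct (le_dec k (n - (S (n - k) + j))); [lia|ring]. }
    rewrite rsum_0, Rplus_0_r.
    rewrite (rsum_ext _ (fun j => / cesA alpha n * cesB alpha j)).
    2:{ intros j Hj. destruct (le_dec k (n - j)); [ring|lia]. }
    rewrite rsum_scal, cesB_sum by auto. unfold Rdiv; ring.
  - rewrite ces_mult_0 by auto. rewrite (rsum_ext _ (fun _ => 0)); [apply rsum_0|]. intros j Hj.
    destruct (le_dec k (n - j)); [lia|ring].
Qed.

(** * Size of the Cesaro kernel *)

Lemma dirichlet_sin l t : sin (t / 2) * dirichlet l t = sin ((INR l + / 2) * t).
Proof.
  induction l as [|l IH].
  - unfold dirichlet; simpl. replace ((0 + / 2) * t) with (t / 2) by field. ring.
  - replace (dirichlet (S l) t) with (dirichlet l t + 2 * cos (INR (S l) * t))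
      by (unfold dirichlet; cbn [rsum]; ring).
    rewrite Rmult_plus_distr_l, IH.
    replace ((INR l + / 2) * t) with (INR (S l) * t - t / 2) by (rewrite S_INR; field).
    replace ((INR (S l) + / 2) * t) with (INR (S l) * t + t / 2) by field.
    rewrite sin_minus, sin_plus. ring.
Qed.

(** The factor [sin (t / 2)] turns each Dirichlet kernel into a single sine, and the weighted sum of
    sines is the imaginary part of a unimodular number times [Cconj X]. Only the one-sided sum [X]
    remains to be estimated. *)
Lemma ces_kernel_sin alpha n t : 0 < alpha ->
  cesA alpha n * Rabs (sin (t / 2) * ces_kernel alpha n t)
  <= Cmod (csum (fun j => RtoC (cesB alpha j) * cis t ^ j)%C (S n)).
Proof.
  intros Ha. assert (HA := cesA_pos alpha n Ha).
  set (X := csum (fun j => RtoC (cesB alpha j) * cis t ^ j)%C (S n)).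
  assert (E : cesA alpha n * (sin (t / 2) * ces_kernel alpha n t)
    = Im (cis ((INR n + / 2) * t) * Cconj X)%C).
  { unfold ces_kernel.
    replace (cesA alpha n * (sin (t / 2) * (/ cesA alpha n * rsum (fun j => cesB alpha j * dirichlet (n - j) t) (S n))))
      with (rsum (fun j => sin (t / 2) * (cesB alpha j * dirichlet (n - j) t)) (S n)).
    2:{ rewrite rsum_scal. field. lra. }
    unfold X. rewrite csum_conj, <- csum_scal, csum_Im. apply rsum_ext; intros j Hj.
    replace (sin (t / 2) * (cesB alpha j * dirichlet (n - j) t))
      with (cesB alpha j * (sin (t / 2) * dirichlet (n - j) t)) by ring.
    rewrite dirichlet_sin, minus_INR by lia.
    rewrite Cmult_conj, cis_pow, <- cis_neg.
    replace (cis ((INR n + / 2) * t) * (Cconj (RtoC (cesB alpha j)) * cis (- (INR j * t))))%C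
      with (RtoC (cesB alpha j) * (cis ((INR n + / 2) * t + - (INR j * t))))%C.
    2:{ rewrite cis_add. replace (Cconj (RtoC (cesB alpha j))) with (RtoC (cesB alpha j)) by (apply C_ext; simpl; ring). ring. }
    rewrite Im_mult. unfold cis. simpl.
    replace ((INR n + / 2) * t + - (INR j * t)) with ((INR n - INR j + / 2) * t) by ring. ring. }
  replace (cesA alpha n * Rabs (sin (t / 2) * ces_kernel alpha n t))
    with (Rabs (cesA alpha n * (sin (t / 2) * ces_kernel alpha n t))).
  2:{ rewrite Rabs_mult, (Rabs_pos_eq (cesA alpha n)); lra. }
  rewrite E. eapply Rle_trans; [apply Im_le_Cmod|].
  rewrite Cmod_mult, Cmod_cis, Cmod_conj. lra.
Qed.

(** Summation by parts, which turns monotonicity of [b] into bounds by its end values. *)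
Lemma abel_identity (b : nat -> R) (w : C) p :
  ((1 - w) * csum (fun j => RtoC (b j) * w ^ j) (S p)
   = RtoC (b O) - RtoC (b p) * w ^ S p + csum (fun j => RtoC (b (S j) - b j) * w ^ S j) p)%C.
Proof.
  induction p as [|p IH]; [cbn [csum]; simpl Cpow; ring|].
  change (csum (fun j => RtoC (b j) * w ^ j)%C (S (S p)))
    with (csum (fun j => RtoC (b j) * w ^ j)%C (S p) + RtoC (b (S p)) * w ^ S p)%C.
  rewrite Cmult_plus_distr_l, IH.
  change (csum (fun j => RtoC (b (S j) - b j) * w ^ S j)%C (S p))
    with (csum (fun j => RtoC (b (S j) - b j) * w ^ S j)%C p + RtoC (b (S p) - b p) * w ^ S p)%C.
  rewrite RtoC_minus, !Cpow_S. ring.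
Qed.

Lemma abel_bound (b : nat -> R) t p V : (forall j, 0 <= b j) ->
  rsum (fun j => Rabs (b (S j) - b j)) p <= V ->
  Cmod (1 - cis t)%C * Cmod (csum (fun j => RtoC (b j) * cis t ^ j)%C (S p)) <= b O + b p + V.
Proof.
  intros Hb HV. rewrite <- Cmod_mult, abel_identity.
  assert (Hw : forall k, Cmod (cis t ^ k)%C = 1) by (intros; rewrite Cmod_pow, Cmod_cis, pow1; auto).
  eapply Rle_trans; [apply Cmod_triangle|]. apply Rplus_le_compat.
  - unfold Cminus. eapply Rle_trans; [apply Cmod_triangle|].
    rewrite Cmod_opp, Cmod_mult, Hw, !Cmod_R, !Rabs_pos_eq by auto. lra.
  - eapply Rle_trans; [apply csum_Cmod_le|]. eapply Rle_trans; [|apply HV].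
    apply Req_le, rsum_ext; intros j _. rewrite Cmod_mult, Hw, Cmod_R; ring.
Qed.

Lemma rsum_telescope (b : nat -> R) p : rsum (fun j => b (S j) - b j) p = b p - b O.
Proof. induction p as [|p IH]; simpl; [|rewrite IH]; ring. Qed.

Lemma abel_incr (b : nat -> R) t p : (forall j, 0 <= b j) -> (forall j, b j <= b (S j)) ->
  Cmod (1 - cis t)%C * Cmod (csum (fun j => RtoC (b j) * cis t ^ j)%C (S p)) <= 2 * b p.
Proof.
  intros Hb Hi. replace (2 * b p) with (b O + b p + (b p - b O)) by ring. apply abel_bound; auto.
  rewrite <- rsum_telescope. apply Req_le, rsum_ext; intros j _. apply Rabs_pos_eq. specialize (Hi j); lra.
Qed.

Lemma abel_decr (b : nat -> R) t p : (forall j, 0 <= b j) -> (forall j, b (S j) <= b j) ->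
  Cmod (1 - cis t)%C * Cmod (csum (fun j => RtoC (b j) * cis t ^ j)%C p) <= 2 * b O.
Proof.
  intros Hb Hi. destruct p as [|p].
  { simpl csum. rewrite Cmod_0. specialize (Hb O); lra. }
  replace (2 * b O) with (b O + b p + - (b p - b O)) by ring. apply abel_bound; auto.
  rewrite <- rsum_telescope. replace (- rsum (fun j => b (S j) - b j) p) with (-1 * rsum (fun j => b (S j) - b j) p) by ring.
  rewrite <- rsum_scal. apply Req_le, rsum_ext; intros j _. rewrite Rabs_left1; specialize (Hi j); lra.
Qed.

Lemma Cmod_1_minus_cis t : Cmod (1 - cis t)%C = 2 * Rabs (sin (t / 2)).
Proof.
  apply Rsqr_inj; [apply Cmod_ge_0|assert (H := Rabs_pos (sin (t / 2))); lra|].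
  rewrite !Rsqr_pow2, Rpow_mult_distr, pow2_abs, Cmod2_alt. unfold cis; simpl.
  assert (E : cos t = 1 - 2 * sin (t / 2) * sin (t / 2)).
  { replace t with (2 * (t / 2)) at 1 by field. apply cos_2a_sin. }
  assert (E2 := sin2_cos2 t). unfold Rsqr in E2. nra.
Qed.

(** On [[0, 1]] the cosine is at least one half, since 1 is below [PI / 3]. Beyond 1 the sine stays
    above one half, and [x / 4] below it, because [PI <= 4]. *)
Lemma sin_lower x : 0 <= x <= PI / 2 -> x / 4 <= sin x.
Proof.
  intros Hx. assert (H4 := PI_4). assert (H3 := PI2_3_2). unfold PI2 in H3.
  assert (Small : forall y, 0 <= y <= 1 -> y / 2 <= sin y).
  { intros y Hy. destruct (Req_dec y 0) as [->|Hy0]; [rewrite sin_0; lra|].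
    destruct (MVT_cor2 sin cos 0 y) as [c [Hc1 Hc2]]; [lra|intros; apply derivable_pt_lim_sin|].
    rewrite sin_0, !Rminus_0_r in Hc1. rewrite Hc1.
    assert (/ 2 <= cos c); [|nra].
    rewrite <- (Rmult_1_l (/ 2)). change (1 * / 2) with (1 / 2). rewrite <- cos_PI3. apply cos_decr_1; lra. }
  destruct (Rle_lt_dec x 1) as [H|H].
  - specialize (Small x ltac:(lra)). lra.
  - assert (K := Small 1 ltac:(lra)).
    assert (sin 1 <= sin x) by (apply sin_incr_1; lra). lra.
Qed.

Lemma sin_half_lower t : 0 < t <= PI -> t / 8 <= sin (t / 2).
Proof. intros H. assert (K := sin_lower (t / 2)). lra. Qed.

(** For [alpha >= 1] the weights [cesB] increase, so Abel summation bounds [X] by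
    [cesB alpha n / s]. Division by [s * cesA alpha n] leaves [alpha / (n + alpha)] over [s ^ 2],
    and [s >= t / 8] accounts for 64. *)
Lemma ces_kernel_bound_ge1 alpha n t : 1 <= alpha -> 0 < t <= PI ->
  Rabs (ces_kernel alpha n t) <= 64 * alpha * / (INR n + 1) * / t * / t.
Proof.
  intros Ha Ht. assert (Hs := sin_half_lower t Ht). assert (Hn := pos_INR n).
  assert (HA := cesA_pos alpha n ltac:(lra)).
  assert (K := ces_kernel_sin alpha n t ltac:(lra)).
  assert (M := abel_incr (cesB alpha) t n).
  rewrite Cmod_1_minus_cis, Rabs_pos_eq in M by lra.
  rewrite Rabs_mult, (Rabs_pos_eq (sin (t / 2))) in K by lra.
  set (X := Cmod _) in *. set (s := sin (t / 2)) in *. set (k := Rabs _) in *.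
  assert (Hk : 0 <= k) by apply Rabs_pos.
  assert (M' : s * X <= cesB alpha n).
  { enough (2 * s * X <= 2 * cesB alpha n) by lra. apply M.
    - intros; left; apply cesB_pos; lra.
    - intros j. rewrite cesB_S by lra. assert (H1 := cesB_pos alpha j ltac:(lra)). assert (H2 := pos_INR j).
      replace ((INR j + alpha) / (INR j + 1)) with (1 + (alpha - 1) / (INR j + 1)) by (field; lra).
      assert (0 <= (alpha - 1) / (INR j + 1)) by (apply Rmult_le_pos; [lra|left; apply Rinv_0_lt_compat; lra]). nra. }
  assert (M2 : s * s * k <= alpha / (INR n + alpha)).
  { apply Rmult_le_reg_l with (cesA alpha n); auto.
    apply Rle_trans with (s * X); [|exact M']. apply Rle_trans with (s * (cesA alpha n * (s * k))); [right; ring|].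
    apply Rmult_le_compat_l; lra. }
  assert (M3 : t * t * k <= 64 * (alpha / (INR n + alpha))).
  { apply Rle_trans with (64 * (s * s * k)); [|lra].
    assert (t * t <= 64 * (s * s)) by nra. nra. }
  assert (M4 : alpha / (INR n + alpha) <= alpha / (INR n + 1)).
  { apply Rmult_le_compat_l; [lra|]. apply Rinv_le_contravar; lra. }
  apply Rmult_le_reg_l with (t * t); [nra|].
  replace (t * t * (64 * alpha * / (INR n + 1) * / t * / t)) with (64 * (alpha / (INR n + 1))) by (field; lra).
  lra.
Qed.

(** Integrability of the kernel bound asks for some positive power, not for the true growth exponent
    [alpha]. The exponent [be] is the largest with [be / j <= alpha / (j + alpha)] for all [j >= 1],
    with equality at [j = 1]; this inequality drives the induction. *)
Lemma cesA_ratio alpha m n : 0 < alpha -> (m <= n)%nat ->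
  cesA alpha m * Rpower ((INR n + 1) / (INR m + 1)) (alpha / (1 + alpha)) <= cesA alpha n.
Proof.
  intros Ha Hmn. set (be := alpha / (1 + alpha)).
  assert (Hbe : 0 < be) by (apply Rdiv_lt_0_compat; lra).
  induction Hmn as [|n Hmn IH].
  - assert (Hm := pos_INR m). replace ((INR m + 1) / (INR m + 1)) with 1 by (field; lra).
    unfold Rpower. rewrite ln_1, Rmult_0_r, exp_0. lra.
  - assert (Hm := pos_INR m). assert (Hn := pos_INR n).
    assert (HA := cesA_pos alpha n Ha). cbn [cesA]. rewrite S_INR.
    assert (P : Rpower ((INR n + 1 + 1) / (INR n + 1)) be <= (INR n + 1 + alpha) / (INR n + 1)).
    { set (j := INR n + 1) in *. assert (Hj : 1 <= j) by (unfold j; lra).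
      assert (L1 : ln ((j + 1) / j) <= / j).
      { rewrite <- (ln_exp (/ j)). apply ln_le; [apply Rdiv_lt_0_compat; lra|].
        assert (E := exp_ineq1_le (/ j)). replace ((j + 1) / j) with (1 + / j) by (field; lra). lra. }
      assert (L2 : be * / j <= alpha / (j + alpha)).
      { unfold be. apply Rmult_le_reg_r with ((1 + alpha) * j * (j + alpha)); [apply Rmult_lt_0_compat; nra|].
        replace (alpha / (1 + alpha) * / j * ((1 + alpha) * j * (j + alpha))) with (alpha * (j + alpha)) by (field; lra).
        replace (alpha / (j + alpha) * ((1 + alpha) * j * (j + alpha))) with (alpha * ((1 + alpha) * j)) by (field; lra).
        apply Rmult_le_compat_l; nra. }
      (* This is [1 - u <= exp (- u)] at [u = alpha / (j + alpha)], inverted. *)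
      assert (L3 : exp (alpha / (j + alpha)) <= (j + alpha) / j).
      { assert (E := exp_ineq1_le (- (alpha / (j + alpha)))).
        replace (1 + - (alpha / (j + alpha))) with (/ ((j + alpha) / j)) in E by (field; lra).
        rewrite exp_Ropp in E. assert (E0 := exp_pos (alpha / (j + alpha))).
        assert (0 < (j + alpha) / j) by (apply Rdiv_lt_0_compat; lra).
        rewrite <- (Rinv_inv (exp _)), <- (Rinv_inv ((j + alpha) / j)).
        apply Rinv_le_contravar; auto. apply Rinv_0_lt_compat; auto. }
      unfold Rpower. eapply Rle_trans; [|exact L3].
      assert (Q : be * ln ((j + 1) / j) <= alpha / (j + alpha)) by nra.
      destruct Q as [Q|Q]; [left; apply exp_increasing; auto|rewrite Q; lra]. }
    replace ((INR n + 1 + 1) / (INR m + 1)) with ((INR n + 1) / (INR m + 1) * ((INR n + 1 + 1) / (INR n + 1))) by (field; lra).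
    rewrite <- Rpower_mult_distr by (apply Rdiv_lt_0_compat; lra).
    rewrite <- Rmult_assoc. apply Rmult_le_compat; auto.
    + apply Rmult_le_pos; [left; apply cesA_pos; auto|left; apply exp_pos].
    + left; apply exp_pos.
Qed.

(** For [alpha <= 1] the weights decrease. The sum [X] is cut at [m], the integer part of [/ t]: the
    head is bounded by [cesA alpha m], the rest by Abel summation, and [cesA_ratio] compares
    [cesA alpha m] with [cesA alpha n]. *)
Lemma ces_kernel_bound_le1 alpha n t : 0 < alpha <= 1 -> / (INR n + 1) < t <= PI ->
  Rabs (ces_kernel alpha n t) <= 360 * / t * Rpower (t * (INR n + 1)) (- (alpha / (1 + alpha))).
Proof.
  intros Ha Ht. set (be := alpha / (1 + alpha)).
  assert (Hn := pos_INR n).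
  assert (Hi : 0 < / (INR n + 1)) by (apply Rinv_0_lt_compat; lra).
  assert (H4 := PI_4).
  assert (Hs := sin_half_lower t ltac:(lra)).
  assert (Hit : / t < INR n + 1).
  { rewrite <- (Rinv_inv (INR n + 1)). apply Rinv_lt_contravar; [|lra]. apply Rmult_lt_0_compat; lra. }
  assert (Hit0 : 0 < / t) by (apply Rinv_0_lt_compat; lra).
  destruct (nfloor_ex (/ t)) as [m [Hm1 Hm2]]; [lra|].
  assert (Hmn : (m <= n)%nat).
  { apply INR_le. assert (Q : INR m < INR (S n)) by (rewrite S_INR; lra).
    apply INR_lt in Q. apply le_INR. lia. }
  assert (HA := cesA_pos alpha n ltac:(lra)). assert (HAm := cesA_pos alpha m ltac:(lra)).
  assert (K := ces_kernel_sin alpha n t ltac:(lra)).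
  rewrite Rabs_mult, (Rabs_pos_eq (sin (t / 2))) in K by lra.
  set (k := Rabs _) in *. assert (Hk : 0 <= k) by apply Rabs_pos.
  set (s := sin (t / 2)) in *.
  assert (Hm := pos_INR m).
  (* 9 is 1 for the head plus 8 for the tail, where [s >= t / 8] meets
     [alpha / (m + alpha) <= / (m + 1) <= t]. *)
  assert (X : Cmod (csum (fun j => RtoC (cesB alpha j) * cis t ^ j)%C (S n)) <= 9 * cesA alpha m).
  { replace (S n) with (m + (S n - m))%nat by lia. rewrite csum_app.
    eapply Rle_trans; [apply Cmod_triangle|].
    replace (9 * cesA alpha m) with (cesA alpha m + 8 * cesA alpha m) by ring. apply Rplus_le_compat.
    - eapply Rle_trans; [apply csum_Cmod_le|]. rewrite <- cesB_sum by lra.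
      apply Rle_trans with (rsum (cesB alpha) m).
      + apply rsum_le; intros j _. rewrite Cmod_mult, Cmod_pow, Cmod_cis, pow1, Cmod_R, Rabs_pos_eq; [lra|].
        left; apply cesB_pos; lra.
      + apply rsum_mono; [|lia]. intros; left; apply cesB_pos; lra.
    - rewrite (csum_ext _ (fun j => cis t ^ m * (RtoC (cesB alpha (m + j)) * cis t ^ j))%C)
        by (intros; rewrite Cpow_add_r; ring).
      rewrite csum_scal, Cmod_mult, Cmod_pow, Cmod_cis, pow1, Rmult_1_l.
      assert (M := abel_decr (fun j => cesB alpha (m + j)) t (S n - m)).
      rewrite Cmod_1_minus_cis, Rabs_pos_eq in M by (fold s; lra). fold s in M.
      set (Y := Cmod (csum _ (S n - m))) in *.
      assert (M' : 2 * s * Y <= 2 * cesB alpha (m + 0)).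
      { apply M.
        - intros; left; apply cesB_pos; lra.
        - intros j. rewrite Nat.add_succ_r, cesB_S by lra.
          assert (H1 := cesB_pos alpha (m + j) ltac:(lra)). assert (H2 := pos_INR (m + j)).
          replace ((INR (m + j) + alpha) / (INR (m + j) + 1)) with (1 - (1 - alpha) / (INR (m + j) + 1)) by (field; lra).
          assert (0 <= (1 - alpha) / (INR (m + j) + 1)) by (apply Rmult_le_pos; [lra|left; apply Rinv_0_lt_compat; lra]). nra. }
      rewrite Nat.add_0_r in M'. unfold cesB in M'.
      assert (Q : alpha / (INR m + alpha) <= t).
      { apply Rle_trans with (/ (INR m + 1)).
        - apply Rmult_le_reg_r with ((INR m + alpha) * (INR m + 1)); [apply Rmult_lt_0_compat; lra|].
          replace (alpha / (INR m + alpha) * ((INR m + alpha) * (INR m + 1))) with (alpha * (INR m + 1)) by (field; lra).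
          replace (/ (INR m + 1) * ((INR m + alpha) * (INR m + 1))) with (INR m + alpha) by (field; lra). nra.
        - rewrite <- (Rinv_inv t). left. apply Rinv_lt_contravar; [|lra]. apply Rmult_lt_0_compat; lra. }
      assert (HY : 0 <= Y) by apply Cmod_ge_0.
      assert (t / 8 * Y <= t * cesA alpha m).
      { apply Rle_trans with (s * Y); [apply Rmult_le_compat_r; lra|].
        apply Rle_trans with (cesA alpha m * (alpha / (INR m + alpha))); [lra|].
        rewrite Rmult_comm. apply Rmult_le_compat_r; lra. }
      apply Rmult_le_reg_l with t; [lra|]. lra. }
  assert (K2 : t * k * cesA alpha n <= 72 * cesA alpha m).
  { apply Rle_trans with (8 * (cesA alpha n * (s * k))); [|lra].
    replace (8 * (cesA alpha n * (s * k))) with ((8 * s) * (k * cesA alpha n)) by ring.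
    rewrite Rmult_assoc. apply Rmult_le_compat_r; [apply Rmult_le_pos; lra|lra]. }
  assert (R1 := cesA_ratio alpha m n ltac:(lra) Hmn). fold be in R1.
  assert (Hbe : 0 < be < 1).
  { unfold be. split; [apply Rdiv_lt_0_compat; lra|].
    apply Rmult_lt_reg_r with (1 + alpha); [lra|]. unfold Rdiv. rewrite Rmult_assoc, Rinv_l; lra. }
  (* 5 bounds [t * (m + 1)], since [t * m <= 1] and [t <= PI <= 4]; its power is no larger because
     [be < 1]. Then 360 is 5 times 8 times 9. *)
  assert (R2 : Rpower (t * (INR n + 1)) be <= 5 * Rpower ((INR n + 1) / (INR m + 1)) be).
  { assert (R3 : Rpower 5 be <= 5).
    { rewrite <- (Rpower_1 5) at 2 by lra. apply Rle_Rpower; lra. }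
    apply Rle_trans with (Rpower (5 * ((INR n + 1) / (INR m + 1))) be).
    - apply Rle_Rpower_l; [lra|]. split; [apply Rmult_lt_0_compat; lra|].
      assert (t * (INR m + 1) <= 5).
      { assert (t * INR m <= 1).
        { apply Rle_trans with (t * / t); [apply Rmult_le_compat_l; lra|]. rewrite Rinv_r; lra. }
        lra. }
      apply Rmult_le_reg_r with (INR m + 1); [lra|].
      replace (5 * ((INR n + 1) / (INR m + 1)) * (INR m + 1)) with (5 * (INR n + 1)) by (field; lra). nra.
    - rewrite <- Rpower_mult_distr; [|lra|apply Rdiv_lt_0_compat; lra].
      apply Rmult_le_compat_r; [left; apply exp_pos|auto]. }
  set (p := Rpower ((INR n + 1) / (INR m + 1)) be) in *.
  set (q := Rpower (t * (INR n + 1)) be) in *.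
  assert (Hp : 0 < p) by apply exp_pos. assert (Hq : 0 < q) by apply exp_pos.
  rewrite Rpower_Ropp. fold q.
  assert (K3 : t * k * q <= 360).
  { apply Rmult_le_reg_r with (cesA alpha m); auto.
    assert (Htk : 0 <= t * k) by (apply Rmult_le_pos; lra).
    apply Rle_trans with (5 * (t * k * (cesA alpha m * p))).
    { replace (5 * (t * k * (cesA alpha m * p))) with ((t * k * cesA alpha m) * (5 * p)) by ring.
      replace (t * k * q * cesA alpha m) with ((t * k * cesA alpha m) * q) by ring.
      apply Rmult_le_compat_l; auto. apply Rmult_le_pos; lra. }
    apply Rle_trans with (5 * (t * k * cesA alpha n)); [|lra].
    apply Rmult_le_compat_l; [lra|]. apply Rmult_le_compat_l; auto. }
  apply Rmult_le_reg_l with (t * q); [apply Rmult_lt_0_compat; lra|].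
  replace (t * q * (360 * / t * / q)) with 360 by (field; lra). lra.
Qed.

Lemma ces_kernel_trivial_bound alpha n t : 0 < alpha -> Rabs (ces_kernel alpha n t) <= 2 * INR n + 1.
Proof.
  intros Ha. assert (HA := cesA_pos alpha n Ha).
  assert (D : forall l, Rabs (dirichlet l t) <= 2 * INR l + 1).
  { intros l. induction l as [|l IH].
    - unfold dirichlet; simpl. rewrite Rmult_0_r, Rplus_0_r, Rabs_R1. lra.
    - replace (dirichlet (S l) t) with (dirichlet l t + 2 * cos (INR (S l) * t))
        by (unfold dirichlet; cbn [rsum]; ring).
      eapply Rle_trans; [apply Rabs_triang|]. rewrite S_INR at 2.
      assert (Rabs (2 * cos (INR (S l) * t)) <= 2); [|lra].
      assert (Q := COS_bound (INR (S l) * t)). apply Rabs_le; lra. }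
  assert (H : Rabs (rsum (fun j => cesB alpha j * dirichlet (n - j) t) (S n)) <= cesA alpha n * (2 * INR n + 1)).
  { rewrite <- cesB_sum by auto. rewrite Rmult_comm, <- rsum_scal.
    assert (G : forall f g N, (forall j, (j < N)%nat -> Rabs (f j) <= g j) -> Rabs (rsum f N) <= rsum g N).
    { intros f g N; induction N as [|N IH]; intros HN; simpl; [rewrite Rabs_R0; lra|].
      eapply Rle_trans; [apply Rabs_triang|]. apply Rplus_le_compat; auto. }
    apply G. intros j Hj. assert (HB := cesB_pos alpha j Ha).
    rewrite Rabs_mult, (Rabs_pos_eq (cesB alpha j)), Rmult_comm by lra.
    apply Rmult_le_compat_r; [lra|]. eapply Rle_trans; [apply D|].
    assert (INR (n - j) <= INR n) by (apply le_INR; lia). lra. }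
  unfold ces_kernel. rewrite Rabs_mult, Rabs_pos_eq by (left; apply Rinv_0_lt_compat; auto).
  apply Rmult_le_reg_l with (cesA alpha n); auto.
  rewrite <- Rmult_assoc, Rinv_r, Rmult_1_l by lra. auto.
Qed.

(** One form for both ranges of [alpha]: the range [alpha >= 1] is the case [be = 1]. *)
Lemma ces_kernel_decay alpha : 0 < alpha -> exists C0 be, 0 < C0 /\ 0 < be /\
  forall n t, / (INR n + 1) < t <= PI ->
  Rabs (ces_kernel alpha n t) <= C0 * (/ t * Rpower (t * (INR n + 1)) (- be)).
Proof.
  intros Ha. destruct (Rle_lt_dec 1 alpha) as [H|H].
  - exists (64 * alpha), 1; repeat split; try lra. intros n t Ht.
    assert (Hn := pos_INR n). assert (Hi : 0 < / (INR n + 1)) by (apply Rinv_0_lt_compat; lra).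
    eapply Rle_trans; [apply ces_kernel_bound_ge1; lra|].
    rewrite Rpower_Ropp, Rpower_1 by (apply Rmult_lt_0_compat; lra). right. field. lra.
  - exists 360, (alpha / (1 + alpha)); repeat split; try lra; [apply Rdiv_lt_0_compat; lra|].
    intros n t Ht. rewrite <- Rmult_assoc. apply ces_kernel_bound_le1; lra.
Qed.

Lemma ces_kernel_sym alpha n t : ces_kernel alpha n (2 * PI - t) = ces_kernel alpha n t.
Proof.
  unfold ces_kernel. f_equal. apply rsum_ext; intros j _. f_equal. unfold dirichlet. do 2 f_equal.
  apply rsum_ext; intros k _.
  replace (INR (S k) * (2 * PI - t)) with (- (INR (S k) * t) + 2 * INR (S k) * PI) by ring.
  rewrite cos_period, cos_neg; auto.
Qed.

(** Up to [h = / (n + 1)] the trivial bound integrates to at most 2. From [h] to [PI] the decay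
    bound has the explicit primitive [G], and rescaling by [n + 1] makes its contribution at most
    [C0 / be] for every [n]. The second half period follows by symmetry. *)
Lemma ces_kernel_mean_bound alpha : 0 < alpha -> exists C0, 0 < C0 /\
  forall n, mean (fun t => Rabs (ces_kernel alpha n t)) <= C0.
Proof.
  intros Ha. destruct (ces_kernel_decay alpha Ha) as [C0 [be [HC [Hbe Hd]]]].
  assert (Hib : 0 < / be) by (apply Rinv_0_lt_compat; auto).
  exists (2 + C0 * / be). split; [assert (0 < C0 * / be) by (apply Rmult_lt_0_compat; auto); lra|].
  intros n. set (f := fun t => Rabs (ces_kernel alpha n t)).
  assert (Hf : rcont f) by (apply rcont_abs, rcont_ces_kernel).
  assert (Hpi := PI_RGT_0). assert (H3 := PI2_3_2). unfold PI2 in H3.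
  assert (Hn := pos_INR n). set (h := / (INR n + 1)).
  assert (Hh : 0 < h <= 1).
  { unfold h; split; [apply Rinv_0_lt_compat; lra|]. rewrite <- Rinv_1. apply Rinv_le_contravar; lra. }
  assert (EX : forall a b, ex_RInt f a b) by (intros; apply rcont_ex_RInt; auto).
  assert (I1 : RInt f 0 h <= 2).
  { apply Rle_trans with (RInt (fun _ => 2 * INR n + 1) 0 h).
    - apply RInt_le; auto; [lra|apply rcont_ex_RInt; auto with cont|].
      intros t _. apply ces_kernel_trivial_bound; auto.
    - rewrite RInt_const. unfold scal; simpl; unfold mult; simpl.
      apply Rmult_le_reg_r with (INR n + 1); [lra|].
      replace ((h - 0) * (2 * INR n + 1) * (INR n + 1)) with (2 * INR n + 1) by (unfold h; field; lra). lra. }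
  assert (I2 : RInt f h PI <= C0 * / be).
  { set (G := fun t => - (C0 / be) * Rpower (t * (INR n + 1)) (- be)).
    set (g := fun t => C0 * (/ t * Rpower (t * (INR n + 1)) (- be))).
    assert (DG : forall t, 0 < t -> is_derive G t (g t)).
    { intros t Ht. unfold G, g, Rpower. auto_derive.
      - apply Rmult_lt_0_compat; lra.
      - field. lra. }
    assert (Cg : forall t, 0 < t -> continuous g t).
    { intros t Ht. apply (ex_derive_continuous g). unfold g, Rpower. auto_derive.
      repeat split; [lra|apply Rmult_lt_0_compat; lra]. }
    assert (IG : is_RInt g h PI (G PI - G h)).
    { apply (is_RInt_derive G g); intros t; rewrite Rmin_left, Rmax_right by lra; intros Ht;
        [apply DG|apply Cg]; lra. }
    apply Rle_trans with (RInt g h PI).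
    - apply RInt_le; auto; [lra|eexists; exact IG|]. intros t Ht. apply Hd. fold h. lra.
    - rewrite (is_RInt_unique _ _ _ _ IG). unfold G.
      replace (h * (INR n + 1)) with 1 by (unfold h; field; lra).
      unfold Rpower at 2. rewrite ln_1, Rmult_0_r, exp_0.
      assert (0 < C0 / be * Rpower (PI * (INR n + 1)) (- be)).
      { apply Rmult_lt_0_compat; [apply Rdiv_lt_0_compat; auto|apply exp_pos]. }
      unfold Rdiv in *. lra. }
  assert (I3 : RInt f PI (2 * PI) = RInt f 0 PI).
  { assert (L := RInt_comp_lin f (-1) (2 * PI) (2 * PI) PI).
    replace (-1 * (2 * PI) + 2 * PI) with 0 in L by ring. replace (-1 * PI + 2 * PI) with PI in L by ring.
    transitivity (RInt (fun t => - f t) (2 * PI) PI).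
    - assert (O := opp_RInt_swap f (2 * PI) PI (EX _ _)).
      transitivity (opp (RInt f (2 * PI) PI)); [symmetry; exact O|].
      symmetry; apply (RInt_opp f); auto.
    - rewrite <- L by auto. apply RInt_ext.
      intros t _. unfold scal; simpl; unfold mult; simpl.
      replace (-1 * t + 2 * PI) with (2 * PI - t) by ring. unfold f. rewrite ces_kernel_sym. ring. }
  assert (I4 : RInt f 0 PI = RInt f 0 h + RInt f h PI) by (symmetry; apply (RInt_Chasles f); auto).
  assert (I5 : RInt f 0 (2 * PI) = RInt f 0 PI + RInt f PI (2 * PI)) by (symmetry; apply (RInt_Chasles f); auto).
  unfold mean. fold f. rewrite I5, I3, I4.
  assert (P0 : 0 < C0 * / be) by (apply Rmult_lt_0_compat; auto).
  apply Rmult_le_reg_l with (2 * PI); [lra|]. rewrite <- Rmult_assoc, Rinv_r, Rmult_1_l by lra.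
  nra.
Qed.

(** * Subharmonic functions in logarithmic coordinates *)

Definition cont2 (f : R -> R -> R) : Prop := forall x t, continuity_2d_pt f x t.

Lemma cont2_const c : cont2 (fun _ _ => c).
Proof. intros x t; apply continuity_2d_pt_const. Qed.
Lemma cont2_plus f g : cont2 f -> cont2 g -> cont2 (fun x t => f x t + g x t).
Proof. intros Hf Hg x t; apply continuity_2d_pt_plus; auto. Qed.
Lemma cont2_mult f g : cont2 f -> cont2 g -> cont2 (fun x t => f x t * g x t).
Proof. intros Hf Hg x t; apply continuity_2d_pt_mult; auto. Qed.
Lemma cont2_comp (h : R -> R) f : (forall x t, continuous h (f x t)) -> cont2 f -> cont2 (fun x t => h (f x t)).
Proof.
  intros Hh Hf x t. apply (continuity_1d_2d_pt_comp h f); auto.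
  apply continuity_pt_filterlim; apply Hh.
Qed.
Lemma cont2_ext f g : (forall x t, f x t = g x t) -> cont2 f -> cont2 g.
Proof. intros H Hf x t; apply (continuity_2d_pt_ext f); auto. Qed.
Lemma cont2_fst (h : R -> R) : rcont h -> cont2 (fun x _ => h x).
Proof. intros Hh; apply (cont2_comp h (fun x _ => x)); auto. intros x t; apply continuity_2d_pt_id1. Qed.
Lemma cont2_snd (h : R -> R) : rcont h -> cont2 (fun _ t => h t).
Proof. intros Hh; apply (cont2_comp h (fun _ t => t)); auto. intros x t; apply continuity_2d_pt_id2. Qed.

Lemma cont2_slice f x : cont2 f -> rcont (f x).
Proof.
  intros H t. assert (K := H x t). apply continuity_2d_pt_filterlim in K.
  apply filterlim_locally. intros e. apply filterlim_locally with (eps := e) in K.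
  destruct K as [d Hd]. exists d. intros y Hy. apply (Hd (x, y)). split; simpl; [apply ball_center|exact Hy].
Qed.

(** The derivatives are explicit arguments, so that Laplacians become identities between
    formulas. *)
Record smooth2 (f fx fxx ft ftt : R -> R -> R) : Prop := {
  sm_x : forall x t, is_derive (fun x => f x t) x (fx x t);
  sm_xx : forall x t, is_derive (fun x => fx x t) x (fxx x t);
  sm_t : forall x t, is_derive (fun t => f x t) t (ft x t);
  sm_tt : forall x t, is_derive (fun t => ft x t) t (ftt x t);
  sm_c : cont2 f; sm_cx : cont2 fx; sm_cxx : cont2 fxx; sm_ct : cont2 ft; sm_ctt : cont2 ftt
}.

Lemma smooth2_ext f fx fxx ft ftt g gx gxx gt gtt : smooth2 f fx fxx ft ftt ->
  (forall x t, f x t = g x t) -> (forall x t, fx x t = gx x t) -> (forall x t, fxx x t = gxx x t) ->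
  (forall x t, ft x t = gt x t) -> (forall x t, ftt x t = gtt x t) -> smooth2 g gx gxx gt gtt.
Proof.
  intros [] E Ex Exx Et Ett. split; intros; try (eapply cont2_ext; eauto).
  - rewrite <- Ex. apply (is_derive_ext (fun x => f x t)); auto.
  - rewrite <- Exx. apply (is_derive_ext (fun x => fx x t)); auto.
  - rewrite <- Et. apply (is_derive_ext (fun t => f x t)); auto.
  - rewrite <- Ett. apply (is_derive_ext (fun t => ft x t)); auto.
Qed.

Lemma smooth2_plus f fx fxx ft ftt g gx gxx gt gtt :
  smooth2 f fx fxx ft ftt -> smooth2 g gx gxx gt gtt ->
  smooth2 (fun x t => f x t + g x t) (fun x t => fx x t + gx x t) (fun x t => fxx x t + gxx x t)
    (fun x t => ft x t + gt x t) (fun x t => ftt x t + gtt x t).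
Proof.
  intros [] []. split; intros; try (apply cont2_plus; auto).
  - apply (is_derive_plus (fun x => f x t) (fun x => g x t)); auto.
  - apply (is_derive_plus (fun x => fx x t) (fun x => gx x t)); auto.
  - apply (is_derive_plus (fun t => f x t) (fun t => g x t)); auto.
  - apply (is_derive_plus (fun t => ft x t) (fun t => gt x t)); auto.
Qed.

Lemma smooth2_const c : smooth2 (fun _ _ => c) (fun _ _ => 0) (fun _ _ => 0) (fun _ _ => 0) (fun _ _ => 0).
Proof. split; intros; try apply cont2_const; apply (@is_derive_const R_AbsRing R_NormedModule). Qed.

Lemma is_derive_Rmult (f g : R -> R) x df dg : is_derive f x df -> is_derive g x dg ->
  is_derive (fun y => f y * g y) x (df * g x + f x * dg).
Proof. intros Hf Hg. apply (is_derive_mult f g x df dg); auto. intros; apply Rmult_comm. Qed.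

Lemma smooth2_mult f fx fxx ft ftt g gx gxx gt gtt :
  smooth2 f fx fxx ft ftt -> smooth2 g gx gxx gt gtt ->
  smooth2 (fun x t => f x t * g x t)
    (fun x t => fx x t * g x t + f x t * gx x t)
    (fun x t => (fxx x t * g x t + fx x t * gx x t) + (fx x t * gx x t + f x t * gxx x t))
    (fun x t => ft x t * g x t + f x t * gt x t)
    (fun x t => (ftt x t * g x t + ft x t * gt x t) + (ft x t * gt x t + f x t * gtt x t)).
Proof.
  intros [] []. split; intros; try (repeat apply cont2_plus; apply cont2_mult; auto).
  - apply (is_derive_Rmult (fun x => f x t) (fun x => g x t)); auto.
  - apply (is_derive_plus (fun x => fx x t * g x t) (fun x => f x t * gx x t));
      [apply (is_derive_Rmult (fun x => fx x t) (fun x => g x t))|apply (is_derive_Rmult (fun x => f x t) (fun x => gx x t))]; auto.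
  - apply (is_derive_Rmult (fun t => f x t) (fun t => g x t)); auto.
  - apply (is_derive_plus (fun t => ft x t * g x t) (fun t => f x t * gt x t));
      [apply (is_derive_Rmult (fun t => ft x t) (fun t => g x t))|apply (is_derive_Rmult (fun t => f x t) (fun t => gt x t))]; auto.
Qed.

Lemma smooth2_scal c f fx fxx ft ftt : smooth2 f fx fxx ft ftt ->
  smooth2 (fun x t => c * f x t) (fun x t => c * fx x t) (fun x t => c * fxx x t)
    (fun x t => c * ft x t) (fun x t => c * ftt x t).
Proof.
  intros H. eapply smooth2_ext; [apply (smooth2_mult _ _ _ _ _ _ _ _ _ _ (smooth2_const c) H)|..];
    intros; simpl; ring.
Qed.

(** The outer function is constrained only at the values of [f], which admits the logarithm of a
    positive function. *)
Lemma smooth2_comp (h h1 h2 : R -> R) f fx fxx ft ftt : smooth2 f fx fxx ft ftt ->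
  (forall x t, is_derive h (f x t) (h1 (f x t))) -> (forall x t, is_derive h1 (f x t) (h2 (f x t))) ->
  (forall x t, continuous h2 (f x t)) ->
  smooth2 (fun x t => h (f x t))
    (fun x t => h1 (f x t) * fx x t) (fun x t => h2 (f x t) * fx x t * fx x t + h1 (f x t) * fxx x t)
    (fun x t => h1 (f x t) * ft x t) (fun x t => h2 (f x t) * ft x t * ft x t + h1 (f x t) * ftt x t).
Proof.
  intros [] D1 D2 C2.
  assert (C0 : cont2 (fun x t => h (f x t))).
  { apply cont2_comp; auto. intros x t; apply (ex_derive_continuous h); eexists; apply D1. }
  assert (C1 : cont2 (fun x t => h1 (f x t))).
  { apply cont2_comp; auto. intros x t; apply (ex_derive_continuous h1); eexists; apply D2. }
  assert (C2' : cont2 (fun x t => h2 (f x t))) by (apply cont2_comp; auto).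
  assert (DC : forall (g : R -> R) (u : R -> R) (y du dg : R), is_derive g (u y) dg -> is_derive u y du ->
    is_derive (fun y => g (u y)) y (dg * du)).
  { intros g u y du dg Hg Hu. rewrite Rmult_comm. exact (is_derive_comp g u y dg du Hg Hu). }
  split; [intros x t|intros x t|intros x t|intros x t|auto using cont2_mult, cont2_plus..].
  - apply (DC h (fun x => f x t)); auto.
  - apply (is_derive_Rmult (fun x => h1 (f x t)) (fun x => fx x t)); [apply (DC h1 (fun x => f x t))|]; auto.
  - apply (DC h (fun t => f x t)); auto.
  - apply (is_derive_Rmult (fun t => h1 (f x t)) (fun t => ft x t)); [apply (DC h1 (fun t => f x t))|]; auto.
Qed.

Definition laplace (fxx ftt : R -> R -> R) (x t : R) : R := fxx x t + ftt x t.

Lemma mean_derive (f fx : R -> R -> R) : (forall x t, is_derive (fun x => f x t) x (fx x t)) ->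
  cont2 f -> cont2 fx -> forall x, is_derive (fun x => mean (f x)) x (mean (fx x)).
Proof.
  intros D Cf Cfx x. unfold mean.
  apply (is_derive_scal (fun x => RInt (f x) 0 (2 * PI))).
  rewrite (RInt_ext (fx x) (fun t => Derive (fun u => f u t) x)).
  2:{ intros t _. symmetry; apply is_derive_unique; auto. }
  apply (is_derive_RInt_param (fun x t => f x t) 0 (2 * PI) x).
  - apply filter_forall; intros y t _. eexists; apply D.
  - intros t _. apply (continuity_2d_pt_ext fx); auto. intros; symmetry; apply is_derive_unique; auto.
  - apply filter_forall; intros y. apply rcont_ex_RInt, cont2_slice; auto.
Qed.

(** The second [t]-derivative integrates to [ft x (2 * PI) - ft x 0], which vanishes by
    periodicity. *)
Lemma mean_laplace f fx fxx ft ftt : smooth2 f fx fxx ft ftt -> (forall x t, f x (t + 2 * PI) = f x t) ->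
  forall x, mean (fxx x) = mean (laplace fxx ftt x).
Proof.
  intros S P x. unfold laplace.
  rewrite mean_plus by (apply cont2_slice; apply S).
  assert (Z : mean (ftt x) = 0); [|lra].
  assert (E : is_RInt (ftt x) 0 (2 * PI) (ft x (2 * PI) - ft x 0)).
  { apply (is_RInt_derive (ft x)).
    - intros t _. apply S.
    - intros t _. apply cont2_slice, S. }
  unfold mean. rewrite (is_RInt_unique _ _ _ _ E).
  replace (ft x (2 * PI)) with (ft x 0); [ring|].
  assert (D1 := sm_t _ _ _ _ _ S x 0).
  assert (D2 : is_derive (fun t => f x (t + 2 * PI)) 0 (ft x (2 * PI))).
  { assert (D3 := sm_t _ _ _ _ _ S x (2 * PI)). replace (ft x (2 * PI)) with (1 * ft x (2 * PI)) by ring.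
    apply (is_derive_comp (fun t => f x t) (fun t => t + 2 * PI) 0).
    - rewrite Rplus_0_l; exact D3.
    - auto_derive; auto; ring. }
  apply (is_derive_ext _ (fun t => f x t)) in D2; [|intros; apply P].
  rewrite <- (is_derive_unique _ _ _ D1). apply is_derive_unique; auto.
Qed.

(** * Convex functions on the negative half-line *)

Section Convex.
Variables (I I1 I2 : R -> R).
Hypothesis D1 : forall x, is_derive I x (I1 x).
Hypothesis D2 : forall x, is_derive I1 x (I2 x).
Hypothesis P2 : forall x, x < 0 -> 0 <= I2 x.

(** The mean value theorem evaluates [I2] at interior points only, so the endpoint 0 is allowed
    although [P2] is assumed for [x < 0]. This matters because gap bounds are given only inside the
    open disk. *)
Lemma convex_tangent x y : x <= 0 -> y <= 0 -> I x + (y - x) * I1 x <= I y.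
Proof.
  intros Hx Hy.
  assert (M1 : forall a b, a < b -> exists c, I b - I a = I1 c * (b - a) /\ a < c < b)
    by (intros a b Hab; apply MVT_cor2; auto; intros; apply is_derive_Reals; auto).
  assert (M2 : forall a b, a < b -> exists c, I1 b - I1 a = I2 c * (b - a) /\ a < c < b)
    by (intros a b Hab; apply MVT_cor2; auto; intros; apply is_derive_Reals; auto).
  destruct (Rtotal_order x y) as [H|[->|H]]; [|lra|].
  - destruct (M1 x y H) as [c [E1 Hc]]. destruct (M2 x c) as [d [E2 Hd]]; [lra|].
    assert (K := P2 d ltac:(lra)). assert (I1 x <= I1 c) by nra. nra.
  - destruct (M1 y x H) as [c [E1 Hc]]. destruct (M2 c x) as [d [E2 Hd]]; [lra|].
    assert (K := P2 d ltac:(lra)). assert (I1 c <= I1 x) by nra. nra.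
Qed.

(** A negative slope would lift the tangent above [B] far to the left; [y] is the point where it has
    risen by [B + 1]. *)
Lemma convex_bounded_incr B x : (forall y, y <= 0 -> I y <= B) -> (forall y, y <= 0 -> 0 <= I y) ->
  x <= 0 -> 0 <= I1 x.
Proof.
  intros HB HI Hx. destruct (Rle_lt_dec 0 (I1 x)) as [|H]; auto. exfalso.
  assert (HB0 : 0 <= B) by (specialize (HB 0 ltac:(lra)); specialize (HI 0 ltac:(lra)); lra).
  set (y := x + (B + 1) / I1 x).
  assert (Hy : (B + 1) / I1 x < 0).
  { unfold Rdiv. assert (/ I1 x < 0) by (apply Rinv_lt_0_compat; auto). nra. }
  assert (K := convex_tangent x y Hx ltac:(unfold y; lra)).
  replace ((y - x) * I1 x) with (B + 1) in K by (unfold y; field; lra).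
  specialize (HB y ltac:(unfold y; lra)). specialize (HI x Hx). lra.
Qed.
End Convex.

(** * Polynomials in logarithmic coordinates *)

Definition zpt (x t : R) : C := (RtoC (exp x) * cis t)%C.
(** Coefficients of the Euler derivative $z\,p'(z)$: in the coordinates of [zpt] this is the
    [x]-derivative, and [Ci] times it is the [t]-derivative. *)
Definition pdelta (p : nat -> C) (k : nat) : C := (RtoC (INR k) * p k)%C.

Lemma Cmod_zpt x t : Cmod (zpt x t) = exp x.
Proof. apply Cmod_r_cis. left; apply exp_pos. Qed.

Lemma zpt_pow x t k : (zpt x t ^ k)%C = (RtoC (exp (INR k * x)) * cis (INR k * t))%C.
Proof.
  unfold zpt. rewrite Cpow_mult_l, cis_pow, <- RtoC_pow. do 2 f_equal.
  induction k as [|k IH]; [simpl; rewrite Rmult_0_l, exp_0; auto|].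
  simpl pow. rewrite IH, <- exp_plus, S_INR. f_equal; ring.
Qed.

Lemma zpt_period x t : zpt x (t + 2 * PI) = zpt x t.
Proof. unfold zpt, cis. rewrite cos_plus, sin_plus, cos_2PI, sin_2PI. do 2 f_equal; ring. Qed.

Lemma smooth2_Re_monomial (c : C) k : smooth2 (fun x t => Re (c * zpt x t ^ k)%C)
  (fun x t => Re (RtoC (INR k) * c * zpt x t ^ k)%C)
  (fun x t => Re (RtoC (INR k) * (RtoC (INR k) * c) * zpt x t ^ k)%C)
  (fun x t => - Im (RtoC (INR k) * c * zpt x t ^ k)%C)
  (fun x t => - Re (RtoC (INR k) * (RtoC (INR k) * c) * zpt x t ^ k)%C).
Proof.
  set (a := Re c). set (b := Im c). set (q := INR k).
  set (g := fun x t => exp (q * x) * (a * cos (q * t) - b * sin (q * t))).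
  set (h := fun x t => exp (q * x) * (a * sin (q * t) + b * cos (q * t))).
  assert (E1 : forall x t, Re (c * zpt x t ^ k)%C = g x t).
  { intros; rewrite zpt_pow; unfold g, a, b, q, cis; destruct c; simpl; ring. }
  assert (E2 : forall x t, Im (c * zpt x t ^ k)%C = h x t).
  { intros; rewrite zpt_pow; unfold h, a, b, q, cis; destruct c; simpl; ring. }
  assert (R1 : forall (u : R) w, Re (RtoC u * w)%C = u * Re w) by (intros u [? ?]; simpl; ring).
  assert (R2 : forall (u : R) w, Im (RtoC u * w)%C = u * Im w) by (intros u [? ?]; simpl; ring).
  assert (Ce : forall (e : R -> R), (forall t, ex_derive e t) -> cont2 (fun x t => exp (q * x) * e t)).
  { intros e He. apply (cont2_mult (fun x _ => exp (q * x)) (fun _ t => e t)).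
    - apply (cont2_fst (fun x => exp (q * x))), rcont_derivable. intros; auto_derive; auto.
    - apply cont2_snd, rcont_derivable; auto. }
  assert (Cg : cont2 g) by (apply (Ce (fun t => a * cos (q * t) - b * sin (q * t))); intros; auto_derive; auto).
  assert (Ch : cont2 h) by (apply (Ce (fun t => a * sin (q * t) + b * cos (q * t))); intros; auto_derive; auto).
  assert (Sm : smooth2 g (fun x t => q * g x t) (fun x t => q * (q * g x t)) (fun x t => - (q * h x t))
     (fun x t => - (q * (q * g x t)))).
  { split; intros; auto using cont2_mult, cont2_const.
    - unfold g; auto_derive; auto; ring.
    - unfold g; auto_derive; auto; ring.
    - unfold g, h; auto_derive; auto; ring.
    - unfold g, h; auto_derive; auto; ring.
    - apply cont2_ext with (fun x t => - q * h x t); [intros; ring|]. apply cont2_mult; auto using cont2_const.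
    - apply cont2_ext with (fun x t => - q * (q * g x t)); [intros; ring|]. auto using cont2_mult, cont2_const. }
  eapply smooth2_ext; [exact Sm|..]; intros; rewrite <- ?Cmult_assoc, ?R1, ?R2, ?E1, ?E2; auto.
Qed.

Lemma smooth2_Re_pev (p : nat -> C) n : smooth2 (fun x t => Re (pev p n (zpt x t)))
  (fun x t => Re (pev (pdelta p) n (zpt x t)))
  (fun x t => Re (pev (pdelta (pdelta p)) n (zpt x t)))
  (fun x t => - Im (pev (pdelta p) n (zpt x t)))
  (fun x t => - Re (pev (pdelta (pdelta p)) n (zpt x t))).
Proof.
  induction n as [|n IH].
  - eapply smooth2_ext; [apply (smooth2_const 0)|..]; intros; simpl; ring.
  - eapply smooth2_ext; [apply (smooth2_plus _ _ _ _ _ _ _ _ _ _ IH (smooth2_Re_monomial (p n) n))|..];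
      intros x t; unfold pev, pdelta; cbn [csum]; rewrite ?Re_plus, ?Im_plus; ring.
Qed.

(** The imaginary part of [p] is the real part of [- Ci * p], so the real case applies to [q]. *)
Lemma smooth2_Im_pev (p : nat -> C) n : smooth2 (fun x t => Im (pev p n (zpt x t)))
  (fun x t => Im (pev (pdelta p) n (zpt x t)))
  (fun x t => Im (pev (pdelta (pdelta p)) n (zpt x t)))
  (fun x t => Re (pev (pdelta p) n (zpt x t)))
  (fun x t => - Im (pev (pdelta (pdelta p)) n (zpt x t))).
Proof.
  set (q := fun k => (- Ci * p k)%C).
  assert (E : forall z, pev q n z = (- Ci * pev p n z)%C).
  { intros z; unfold pev, q. rewrite <- csum_scal. apply csum_ext; intros; ring. }
  assert (E1 : forall z, pev (pdelta q) n z = (- Ci * pev (pdelta p) n z)%C).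
  { intros z; unfold pev, q, pdelta. rewrite <- csum_scal. apply csum_ext; intros; ring. }
  assert (E2 : forall z, pev (pdelta (pdelta q)) n z = (- Ci * pev (pdelta (pdelta p)) n z)%C).
  { intros z; unfold pev, q, pdelta. rewrite <- csum_scal. apply csum_ext; intros; ring. }
  assert (R : forall z, Re (- Ci * z)%C = Im z) by (intros [u v]; simpl; ring).
  assert (R' : forall z, Im (- Ci * z)%C = - Re z) by (intros [u v]; simpl; ring).
  eapply smooth2_ext; [apply (smooth2_Re_pev q n)|..]; intros; cbv beta; rewrite ?E, ?E1, ?E2, ?R, ?R'; auto; ring.
Qed.

Lemma mean_tangent f fx fxx ft ftt : smooth2 f fx fxx ft ftt -> (forall x t, f x (t + 2 * PI) = f x t) ->
  (forall x t, x < 0 -> 0 <= laplace fxx ftt x t) ->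
  forall x y, x <= 0 -> y <= 0 -> mean (f x) + (y - x) * mean (fx x) <= mean (f y).
Proof.
  intros S P L. apply (convex_tangent (fun x => mean (f x)) (fun x => mean (fx x)) (fun x => mean (fxx x))).
  - apply mean_derive; apply S.
  - apply mean_derive; apply S.
  - intros x Hx. rewrite (mean_laplace _ _ _ _ _ S P). apply mean_ge0; auto.
    unfold laplace. apply rcont_plus; apply cont2_slice; apply S.
Qed.

(** Circle means of a bounded subharmonic function increase with the radius; the centre of the disk
    is [x] at minus infinity. *)
Lemma mean_slope_nonneg f fx fxx ft ftt B : smooth2 f fx fxx ft ftt -> (forall x t, f x (t + 2 * PI) = f x t) ->
  (forall x t, x < 0 -> 0 <= laplace fxx ftt x t) -> (forall x t, x <= 0 -> 0 <= f x t <= B) ->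
  forall x, x <= 0 -> 0 <= mean (fx x).
Proof.
  intros S P L HB x Hx.
  apply (convex_bounded_incr (fun x => mean (f x)) (fun x => mean (fx x)) (fun x => mean (fxx x))) with (B := B); auto.
  - apply mean_derive; apply S.
  - apply mean_derive; apply S.
  - intros y Hy. rewrite (mean_laplace _ _ _ _ _ S P). apply mean_ge0; auto.
    unfold laplace. apply rcont_plus; apply cont2_slice; apply S.
  - intros y Hy. rewrite <- (mean_const B). apply mean_le; auto with cont; [apply cont2_slice, S|].
    intros; apply HB; auto.
  - intros y Hy. apply mean_ge0; [apply cont2_slice, S|]. intros; apply HB; auto.
Qed.

Lemma smooth2_exp f fx fxx ft ftt : smooth2 f fx fxx ft ftt ->
  smooth2 (fun x t => exp (f x t)) (fun x t => exp (f x t) * fx x t)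
    (fun x t => exp (f x t) * fx x t * fx x t + exp (f x t) * fxx x t)
    (fun x t => exp (f x t) * ft x t)
    (fun x t => exp (f x t) * ft x t * ft x t + exp (f x t) * ftt x t).
Proof.
  intros S.
  assert (D : forall y, is_derive exp y (exp y)) by (intros; auto_derive; auto; ring).
  apply (smooth2_comp exp exp exp); auto.
  intros x t. apply (ex_derive_continuous exp). eexists; apply D.
Qed.

Lemma smooth2_half_ln f fx fxx ft ftt : smooth2 f fx fxx ft ftt -> (forall x t, 0 < f x t) ->
  smooth2 (fun x t => / 2 * ln (f x t)) (fun x t => / 2 * / f x t * fx x t)
    (fun x t => - / 2 * / (f x t ^ 2) * fx x t * fx x t + / 2 * / f x t * fxx x t)
    (fun x t => / 2 * / f x t * ft x t)
    (fun x t => - / 2 * / (f x t ^ 2) * ft x t * ft x t + / 2 * / f x t * ftt x t).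
Proof.
  intros S Hp.
  apply (smooth2_comp (fun y => / 2 * ln y) (fun y => / 2 * / y) (fun y => - / 2 * / (y ^ 2))); auto;
    intros x t; specialize (Hp x t).
  - auto_derive; auto. field; lra.
  - auto_derive; [lra|]. field; lra.
  - apply (ex_derive_continuous (fun y => - / 2 * / (y ^ 2))). auto_derive. nra.
Qed.

(** Always taken on the unit circle; smaller circles enter through [dil]. *)
Definition circle_L1 (n : nat) (p : nat -> C) : R := mean (fun t => Cmod (pev p n (cis t))).

Lemma pev_zpt p n x t : pev p n (zpt x t) = pev (dil p (exp x)) n (cis t).
Proof. unfold zpt. apply peval_dil. Qed.

Lemma ccont_pev_zpt p n x : ccont (fun t => pev p n (zpt x t)).
Proof. apply ccont_pev. unfold zpt. auto with cont. Qed.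

(** Parseval's identity for polynomials. *)
Lemma Cmean_pev_conj (p q : nat -> C) n :
  Cmean (fun t => pev p n (cis t) * Cconj (pev q n (cis t)))%C = csum (fun k => p k * Cconj (q k))%C n.
Proof.
  rewrite (Cmean_ext _ (fun t => csum (fun k => Cconj (q k) * (pev p n (cis t) * Cconj (cis t ^ k)))%C n)).
  2:{ intros t. unfold pev at 2. rewrite csum_conj, <- csum_scal. apply csum_ext; intros. rewrite Cmult_conj; ring. }
  rewrite (Cmean_csum (fun k t => Cconj (q k) * (pev p n (cis t) * Cconj (cis t ^ k)))%C).
  2:{ intros k _. apply ccont_mult; auto with cont. apply ccont_mult; auto with cont. apply ccont_pev; auto with cont. }
  apply csum_ext; intros k Hk. rewrite Cmean_scal, Cmean_pev_cis.
  2:{ apply ccont_mult; auto with cont. apply ccont_pev; auto with cont. }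
  destruct (lt_dec k n); [ring|lia].
Qed.

(* [1 - smooth_mult r k] is the remainder at [0] of the first-order Taylor expansion of
   [x |-> exp (2 k x)] at [x = ln r]. *)
Definition smooth_mult (r : R) (k : nat) : R := r ^ (2 * k) * (1 - 2 * INR k * ln r).

Lemma is_derive_rsum_exp (g : nat -> R) n x :
  is_derive (fun x => rsum (fun k => g k * exp (INR k * (2 * x))) n) x
    (rsum (fun k => g k * (2 * INR k * exp (INR k * (2 * x)))) n).
Proof.
  induction n as [|n IH]; cbn [rsum]; [apply (@is_derive_const R_AbsRing R_NormedModule)|].
  apply (is_derive_plus (fun x => rsum (fun k => g k * exp (INR k * (2 * x))) n)); auto.
  auto_derive; auto. ring.
Qed.

(** * The subharmonic comparison function *)

Section Fefferman.
Variables (p h : nat -> C) (n : nat) (M lam eps : R).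
Hypothesis (HM : 0 < M) (Hlam : 0 < lam) (Heps : 0 < eps).
Hypothesis Hh : forall k, (n <= k)%nat -> h k = RtoC 0.
Hypothesis Hgap : forall z, Cmod z < 1 ->
  (1 - Cmod z ^ 2) * rsum (fun m => Cmod (pev (shift h (S m)) n z) ^ 2) n <= M ^ 2.

(** Here $p=a+ib$ and $h=c+id$ at [zpt x t], suffixes denote derivatives in [x] and [t], and [H] is
    the harmonic function of [gap_harmonic]. The Cauchy-Riemann equations express the
    [t]-derivatives of [a], [b], [c], [d] by the [x]-derivatives. *)
Let a x t := Re (pev p n (zpt x t)).
Let b x t := Im (pev p n (zpt x t)).
Let ax x t := Re (pev (pdelta p) n (zpt x t)).
Let bx x t := Im (pev (pdelta p) n (zpt x t)).
Let axx x t := Re (pev (pdelta (pdelta p)) n (zpt x t)).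
Let bxx x t := Im (pev (pdelta (pdelta p)) n (zpt x t)).
Let c x t := Re (pev h n (zpt x t)).
Let d x t := Im (pev h n (zpt x t)).
Let cx x t := Re (pev (pdelta h) n (zpt x t)).
Let dx x t := Im (pev (pdelta h) n (zpt x t)).
Let cxx x t := Re (pev (pdelta (pdelta h)) n (zpt x t)).
Let dxx x t := Im (pev (pdelta (pdelta h)) n (zpt x t)).
Let H x t := Re (pev (harm_coef h n) (S n) (zpt x t)).
Let Hx x t := Re (pev (pdelta (harm_coef h n)) (S n) (zpt x t)).
Let Hxx x t := Re (pev (pdelta (pdelta (harm_coef h n))) (S n) (zpt x t)).
Let Ht x t := - Im (pev (pdelta (harm_coef h n)) (S n) (zpt x t)).

Let smA : smooth2 a ax axx (fun x t => - bx x t) (fun x t => - axx x t) := smooth2_Re_pev p n.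
Let smB : smooth2 b bx bxx ax (fun x t => - bxx x t) := smooth2_Im_pev p n.
Let smC : smooth2 c cx cxx (fun x t => - dx x t) (fun x t => - cxx x t) := smooth2_Re_pev h n.
Let smD : smooth2 d dx dxx cx (fun x t => - dxx x t) := smooth2_Im_pev h n.
Let smH : smooth2 H Hx Hxx Ht (fun x t => - Hxx x t) := smooth2_Re_pev (harm_coef h n) (S n).

(** Adding [eps ^ 2] keeps the square root smooth at the zeros of [p]. *)
Let N x t := a x t ^ 2 + b x t ^ 2 + eps ^ 2.
Let Nx x t := 2 * (a x t * ax x t + b x t * bx x t).
Let Nxx x t := 2 * (ax x t ^ 2 + bx x t ^ 2 + a x t * axx x t + b x t * bxx x t).
Let Nt x t := 2 * (b x t * ax x t - a x t * bx x t).
Let Ntt x t := 2 * (ax x t ^ 2 + bx x t ^ 2 - a x t * axx x t - b x t * bxx x t).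

Lemma fef_N_pos x t : 0 < N x t.
Proof.
  unfold N. assert (K1 := pow2_ge_0 (a x t)). assert (K2 := pow2_ge_0 (b x t)).
  assert (0 < eps ^ 2) by (apply pow_lt; auto). lra.
Qed.

Lemma fef_smooth_N : smooth2 N Nx Nxx Nt Ntt.
Proof.
  eapply smooth2_ext; [exact (smooth2_plus _ _ _ _ _ _ _ _ _ _ (smooth2_plus _ _ _ _ _ _ _ _ _ _
    (smooth2_mult _ _ _ _ _ _ _ _ _ _ smA smA) (smooth2_mult _ _ _ _ _ _ _ _ _ _ smB smB)) (smooth2_const (eps ^ 2)))|..];
    intros; cbv beta; unfold N, Nx, Nxx, Nt, Ntt; ring.
Qed.

(** [psi] is minus the gap over [M ^ 2], written through [H] so that it is smooth for all real [x],
    the circle [x = 0] included. *)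
Let kap := / M ^ 2.
Let psi x t := kap * (c x t ^ 2 + d x t ^ 2 - H x t).
Let psix x t := kap * (2 * (c x t * cx x t + d x t * dx x t) - Hx x t).
Let psixx x t := kap * (2 * (cx x t ^ 2 + dx x t ^ 2 + c x t * cxx x t + d x t * dxx x t) - Hxx x t).
Let psit x t := kap * (2 * (d x t * cx x t - c x t * dx x t) - Ht x t).
Let psitt x t := kap * (2 * (cx x t ^ 2 + dx x t ^ 2 - c x t * cxx x t - d x t * dxx x t) + Hxx x t).

Lemma fef_smooth_psi : smooth2 psi psix psixx psit psitt.
Proof.
  eapply smooth2_ext; [exact (smooth2_scal kap _ _ _ _ _ (smooth2_plus _ _ _ _ _ _ _ _ _ _ (smooth2_plus _ _ _ _ _ _ _ _ _ _
    (smooth2_mult _ _ _ _ _ _ _ _ _ _ smC smC) (smooth2_mult _ _ _ _ _ _ _ _ _ _ smD smD)) (smooth2_scal (-1) _ _ _ _ _ smH)))|..];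
    intros; cbv beta; unfold psi, psix, psixx, psit, psitt; ring.
Qed.

(** [exp v] is the regularised modulus of [p]. Working with its logarithm turns the exponential
    weight into the addition of [psi]. *)
Let v x t := / 2 * ln (N x t).
Let vx x t := / 2 * / N x t * Nx x t.
Let vxx x t := - / 2 * / (N x t ^ 2) * Nx x t * Nx x t + / 2 * / N x t * Nxx x t.
Let vt x t := / 2 * / N x t * Nt x t.
Let vtt x t := - / 2 * / (N x t ^ 2) * Nt x t * Nt x t + / 2 * / N x t * Ntt x t.
Let smV : smooth2 v vx vxx vt vtt := smooth2_half_ln _ _ _ _ _ fef_smooth_N fef_N_pos.

Let w x t := v x t + psi x t.
Let wx x t := vx x t + psix x t.
Let wxx x t := vxx x t + psixx x t.
Let wt x t := vt x t + psit x t.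
Let wtt x t := vtt x t + psitt x t.
Let smW : smooth2 w wx wxx wt wtt := smooth2_plus _ _ _ _ _ _ _ _ _ _ smV fef_smooth_psi.

Let U x t := exp (v x t).
Let Ux x t := exp (v x t) * vx x t.
Let Uxx x t := exp (v x t) * vx x t * vx x t + exp (v x t) * vxx x t.
Let Ut x t := exp (v x t) * vt x t.
Let Utt x t := exp (v x t) * vt x t * vt x t + exp (v x t) * vtt x t.
Let smU : smooth2 U Ux Uxx Ut Utt := smooth2_exp _ _ _ _ _ smV.

Let W x t := exp (w x t).
Let Wx x t := exp (w x t) * wx x t.
Let Wxx x t := exp (w x t) * wx x t * wx x t + exp (w x t) * wxx x t.
Let Wt x t := exp (w x t) * wt x t.
Let Wtt x t := exp (w x t) * wt x t * wt x t + exp (w x t) * wtt x t.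
Let smEW : smooth2 W Wx Wxx Wt Wtt := smooth2_exp _ _ _ _ _ smW.

Let Q x t := a x t * c x t + b x t * d x t.
Let Qx x t := ax x t * c x t + a x t * cx x t + (bx x t * d x t + b x t * dx x t).
Let Qxx x t := axx x t * c x t + 2 * ax x t * cx x t + a x t * cxx x t
             + (bxx x t * d x t + 2 * bx x t * dx x t + b x t * dxx x t).
Let Qt x t := - bx x t * c x t - a x t * dx x t + (ax x t * d x t + b x t * cx x t).
Let Qtt x t := - axx x t * c x t + 2 * bx x t * dx x t - a x t * cxx x t
             + (- bxx x t * d x t + 2 * ax x t * cx x t - b x t * dxx x t).

Lemma fef_smooth_Q : smooth2 Q Qx Qxx Qt Qtt.
Proof.
  eapply smooth2_ext; [exact (smooth2_plus _ _ _ _ _ _ _ _ _ _ (smooth2_mult _ _ _ _ _ _ _ _ _ _ smA smC)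
                        (smooth2_mult _ _ _ _ _ _ _ _ _ _ smB smD))|..];
    intros; cbv beta; unfold Q, Qx, Qxx, Qt, Qtt; ring.
Qed.

(** [exp 1] offsets the lower bound -1 for [psi], [M ^ 2] cancels [kap], and division by [lam]
    balances the weight [lam] of [U]. *)
Let mu := exp 1 * M ^ 2 / lam.
Let Y x t := lam * U x t + mu * W x t + -1 * Q x t.
Let Yx x t := lam * Ux x t + mu * Wx x t + -1 * Qx x t.
Let Yxx x t := lam * Uxx x t + mu * Wxx x t + -1 * Qxx x t.
Let Yt x t := lam * Ut x t + mu * Wt x t + -1 * Qt x t.
Let Ytt x t := lam * Utt x t + mu * Wtt x t + -1 * Qtt x t.
Let smY : smooth2 Y Yx Yxx Yt Ytt :=
  smooth2_plus _ _ _ _ _ _ _ _ _ _ (smooth2_plus _ _ _ _ _ _ _ _ _ _ (smooth2_scal lam _ _ _ _ _ smU)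
     (smooth2_scal mu _ _ _ _ _ smEW)) (smooth2_scal (-1) _ _ _ _ _ fef_smooth_Q).

Lemma fef_kap_pos : 0 < kap.
Proof. apply Rinv_0_lt_compat, pow_lt; auto. Qed.

Lemma fef_psi_gap x t : psi x t = - kap * ((1 - exp x ^ 2) * rsum (fun m => Cmod (pev (shift h (S m)) n (zpt x t)) ^ 2) n).
Proof.
  assert (G := gap_harmonic h n (zpt x t) Hh). rewrite Cmod_zpt in G.
  unfold psi, H. rewrite <- G, Cmod2_alt. unfold c, d. ring.
Qed.

Lemma exp_le_1 x : x <= 0 -> exp x <= 1.
Proof. intros Hle. rewrite <- exp_0. destruct Hle as [Hlt| ->]; [left; apply exp_increasing; auto|lra]. Qed.

Lemma fef_psi_nonpos x t : x <= 0 -> psi x t <= 0.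
Proof.
  intros Hx0. rewrite fef_psi_gap. assert (K := fef_kap_pos). assert (E := exp_le_1 x Hx0). assert (E0 := exp_pos x).
  assert (0 <= rsum (fun m => Cmod (pev (shift h (S m)) n (zpt x t)) ^ 2) n)
    by (apply rsum_nonneg; intros; apply pow2_ge_0).
  assert (0 <= (1 - exp x ^ 2) * rsum (fun m => Cmod (pev (shift h (S m)) n (zpt x t)) ^ 2) n)
    by (apply Rmult_le_pos; auto; nra). nra.
Qed.

Lemma fef_psi_lower x t : x < 0 -> -1 <= psi x t.
Proof.
  intros Hx0. rewrite fef_psi_gap. assert (K := fef_kap_pos).
  assert (Hz : Cmod (zpt x t) < 1) by (rewrite Cmod_zpt, <- exp_0; apply exp_increasing; auto).
  assert (G := Hgap _ Hz). rewrite Cmod_zpt in G.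
  assert (kap * M ^ 2 = 1) by (unfold kap; field; lra). nra.
Qed.

(** The logarithm of the modulus of [p] is harmonic off its zeros; the regularisation leaves a
    nonnegative multiple of [eps ^ 2]. *)
Lemma fef_lap_v x t : vxx x t + vtt x t = 2 * (ax x t ^ 2 + bx x t ^ 2) * eps ^ 2 * / (N x t ^ 2).
Proof.
  assert (Np := fef_N_pos x t).
  assert (E : eps ^ 2 = N x t - (a x t ^ 2 + b x t ^ 2)) by (unfold N; ring).
  rewrite E. unfold vxx, vtt, Nx, Nxx, Nt, Ntt. field. lra.
Qed.

Lemma fef_grad_v x t :
  vx x t ^ 2 + vt x t ^ 2 = (a x t ^ 2 + b x t ^ 2) * (ax x t ^ 2 + bx x t ^ 2) * / (N x t ^ 2).
Proof. assert (Np := fef_N_pos x t). unfold vx, vt, Nx, Nt. field. lra. Qed.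

Lemma fef_U_sq x t : U x t ^ 2 = N x t.
Proof.
  assert (Np := fef_N_pos x t). unfold U, v.
  replace (exp (/ 2 * ln (N x t)) ^ 2) with (exp (/ 2 * ln (N x t) + / 2 * ln (N x t))) by (rewrite exp_plus; ring).
  replace (/ 2 * ln (N x t) + / 2 * ln (N x t)) with (ln (N x t)) by field. apply exp_ln; auto.
Qed.

Lemma fef_sum_sq_nonneg (u1 u2 : R) : 0 <= u1 ^ 2 + u2 ^ 2.
Proof. assert (K1 := pow2_ge_0 u1); assert (K2 := pow2_ge_0 u2); lra. Qed.

(* [|grad p|^2 <= |p| * Laplacian |p|], up to the regularisation [eps]. *)
Lemma fef_lap_U x t : (ax x t ^ 2 + bx x t ^ 2) / U x t <= laplace Uxx Utt x t.
Proof.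
  assert (Np := fef_N_pos x t). assert (EU := fef_U_sq x t). assert (U0 := exp_pos (v x t)). fold (U x t) in U0.
  unfold laplace, Uxx, Utt. fold (U x t). set (S := ax x t ^ 2 + bx x t ^ 2) in *.
  replace (U x t * vx x t * vx x t + U x t * vxx x t + (U x t * vt x t * vt x t + U x t * vtt x t))
    with (U x t * ((vx x t ^ 2 + vt x t ^ 2) + (vxx x t + vtt x t))) by ring.
  rewrite fef_lap_v, fef_grad_v.
  replace (S / U x t) with (U x t * (N x t * S * / N x t ^ 2)) by (rewrite <- EU; field; lra).
  apply Rmult_le_compat_l; [lra|]. rewrite <- Rmult_plus_distr_r.
  apply Rmult_le_compat_r; [left; apply Rinv_0_lt_compat, pow_lt; auto|].
  assert (HS : 0 <= S) by apply fef_sum_sq_nonneg.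
  fold S. unfold N. assert (0 <= eps ^ 2) by apply pow2_ge_0. nra.
Qed.

(** The gradient term and the Laplacian of [v] are nonnegative and are dropped. The Laplacian of
    [psi] remains, to which the harmonic [H] contributes nothing. *)
Lemma fef_lap_W x t : W x t * (4 * kap * (cx x t ^ 2 + dx x t ^ 2)) <= laplace Wxx Wtt x t.
Proof.
  assert (Np := fef_N_pos x t). assert (U0 := exp_pos (w x t)). fold (W x t) in U0.
  unfold laplace, Wxx, Wtt. fold (W x t).
  replace (W x t * wx x t * wx x t + W x t * wxx x t + (W x t * wt x t * wt x t + W x t * wtt x t))
    with (W x t * ((wx x t ^ 2 + wt x t ^ 2) + ((vxx x t + vtt x t) + (psixx x t + psitt x t))))
    by (unfold wxx, wtt; ring).
  rewrite fef_lap_v. apply Rmult_le_compat_l; [lra|].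
  assert (E : psixx x t + psitt x t = 4 * kap * (cx x t ^ 2 + dx x t ^ 2)) by (unfold psixx, psitt; ring).
  rewrite E. assert (K := fef_sum_sq_nonneg (wx x t) (wt x t)).
  assert (0 <= 2 * (ax x t ^ 2 + bx x t ^ 2) * eps ^ 2 * / N x t ^ 2); [|lra].
  apply Rmult_le_pos; [|left; apply Rinv_0_lt_compat, pow_lt; auto].
  apply Rmult_le_pos; [|apply pow2_ge_0]. assert (K1 := fef_sum_sq_nonneg (ax x t) (bx x t)). lra.
Qed.

Lemma fef_mu_pos : 0 < mu.
Proof. apply Rdiv_lt_0_compat; auto. apply Rmult_lt_0_compat; [apply exp_pos|apply pow_lt; auto]. Qed.

(* The two weights are tuned so that the three Laplacians form perfect squares. *)
Lemma fef_lap_Y x t : x < 0 -> 0 <= laplace Yxx Ytt x t.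
Proof.
  intros Hx0.
  replace (laplace Yxx Ytt x t) with (lam * laplace Uxx Utt x t + mu * laplace Wxx Wtt x t - laplace Qxx Qtt x t)
    by (unfold laplace, Yxx, Ytt; ring).
  assert (LU := fef_lap_U x t). assert (LW := fef_lap_W x t). assert (Hmu := fef_mu_pos).
  assert (EQ : laplace Qxx Qtt x t = 4 * (ax x t * cx x t + bx x t * dx x t)) by (unfold laplace, Qxx, Qtt; ring).
  assert (U0 := exp_pos (v x t)). fold (U x t) in U0.
  assert (HW : exp (-1) * U x t <= W x t).
  { unfold W, w. rewrite exp_plus. fold (U x t). rewrite Rmult_comm. apply Rmult_le_compat_l; [lra|].
    destruct (fef_psi_lower x t Hx0) as [K|K]; [left; apply exp_increasing; auto|rewrite <- K; lra]. }
  set (S := ax x t ^ 2 + bx x t ^ 2) in *. set (T := cx x t ^ 2 + dx x t ^ 2) in *.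
  assert (HT : 0 <= T) by apply fef_sum_sq_nonneg.
  assert (Hk := fef_kap_pos).
  (* With [W >= exp (-1) * U] the constants in [mu] reduce exactly to [4 / lam]. *)
  assert (LW' : 4 / lam * (U x t * T) <= mu * laplace Wxx Wtt x t).
  { apply Rle_trans with (mu * ((exp (-1) * U x t) * (4 * kap * T))).
    - right. unfold mu, kap. assert (E1 : exp 1 * exp (-1) = 1) by (rewrite <- exp_plus; replace (1 + -1) with 0 by ring; apply exp_0).
      replace (exp 1 * M ^ 2 / lam * (exp (-1) * U x t * (4 * / M ^ 2 * T)))
        with ((exp 1 * exp (-1)) * (4 / lam * (U x t * T))) by (field; lra). rewrite E1. ring.
    - apply Rmult_le_compat_l; [lra|]. eapply Rle_trans; [|exact LW].
      apply Rmult_le_compat_r; auto. apply Rmult_le_pos; lra. }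
  assert (LU' : lam * (S / U x t) <= lam * laplace Uxx Utt x t) by (apply Rmult_le_compat_l; lra).
  rewrite EQ.
  assert (F : lam * (S / U x t) + 4 / lam * (U x t * T) - 4 * (ax x t * cx x t + bx x t * dx x t)
    = / (lam * U x t) * ((lam * ax x t - 2 * U x t * cx x t) ^ 2 + (lam * bx x t - 2 * U x t * dx x t) ^ 2)).
  { unfold S, T. field. lra. }
  assert (0 <= / (lam * U x t) * ((lam * ax x t - 2 * U x t * cx x t) ^ 2 + (lam * bx x t - 2 * U x t * dx x t) ^ 2)).
  { apply Rmult_le_pos; [left; apply Rinv_0_lt_compat, Rmult_lt_0_compat; auto|apply fef_sum_sq_nonneg]. }
  lra.
Qed.

Lemma fef_U_bounds x t : Cmod (pev p n (zpt x t)) <= U x t <= Cmod (pev p n (zpt x t)) + eps.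
Proof.
  assert (E := fef_U_sq x t). assert (E0 := exp_pos (v x t)). fold (U x t) in E0.
  assert (E1 : N x t = Cmod (pev p n (zpt x t)) ^ 2 + eps ^ 2) by (rewrite Cmod2_alt; reflexivity).
  assert (E2 := Cmod_ge_0 (pev p n (zpt x t))). rewrite E1 in E.
  split; apply Rsqr_incr_0_var; try lra; unfold Rsqr; nra.
Qed.

Lemma fef_W_le_U x t : x <= 0 -> W x t <= U x t.
Proof.
  intros Hx1. assert (K := fef_psi_nonpos x t Hx1). unfold W, w. rewrite exp_plus. fold (U x t).
  assert (E0 := exp_pos (v x t)). fold (U x t) in E0. assert (E1 := exp_le_1 _ K). nra.
Qed.

Lemma fef_N_period x t : N x (t + 2 * PI) = N x t.
Proof. unfold N, a, b. rewrite zpt_period; auto. Qed.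
Lemma fef_psi_period x t : psi x (t + 2 * PI) = psi x t.
Proof. unfold psi, c, d, H. rewrite zpt_period; auto. Qed.
Lemma fef_U_period x t : U x (t + 2 * PI) = U x t.
Proof. unfold U, v. rewrite fef_N_period; auto. Qed.
Lemma fef_W_period x t : W x (t + 2 * PI) = W x t.
Proof. unfold W, w, v. rewrite fef_N_period, fef_psi_period; auto. Qed.
Lemma fef_Q_period x t : Q x (t + 2 * PI) = Q x t.
Proof. unfold Q, a, b, c, d. rewrite zpt_period; auto. Qed.

Let g k := Re (p k * Cconj (h k))%C.

Lemma fef_mean_Q x : mean (Q x) = rsum (fun k => g k * exp (INR k * (2 * x))) n.
Proof.
  assert (E := f_equal Re (Cmean_pev_conj (dil p (exp x)) (dil h (exp x)) n)).
  rewrite csum_Re in E.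
  transitivity (mean (fun t => Re (pev (dil p (exp x)) n (cis t) * Cconj (pev (dil h (exp x)) n (cis t)))%C)).
  { apply mean_ext; intros t. unfold Q, a, b, c, d. rewrite !pev_zpt.
    generalize (pev (dil p (exp x)) n (cis t)), (pev (dil h (exp x)) n (cis t)). intros [? ?] [? ?]; simpl; ring. }
  etransitivity; [exact E|]. apply rsum_ext; intros k _. unfold dil, g.
  assert (P : (RtoC (exp x) ^ k)%C = RtoC (exp (INR k * x))).
  { rewrite <- RtoC_pow. f_equal. induction k as [|k IH]; [simpl; rewrite Rmult_0_l, exp_0; auto|].
    simpl pow. rewrite IH, <- exp_plus, S_INR. f_equal; ring. }
  rewrite P. replace (INR k * (2 * x)) with (INR k * x + INR k * x) by ring. rewrite exp_plus.
  generalize (p k), (h k), (exp (INR k * x)). intros [? ?] [? ?] e; simpl; ring.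
Qed.

Lemma fef_mean_Qx x : mean (Qx x) = rsum (fun k => g k * (2 * INR k * exp (INR k * (2 * x)))) n.
Proof.
  assert (D := mean_derive Q Qx (sm_x _ _ _ _ _ fef_smooth_Q) (sm_c _ _ _ _ _ fef_smooth_Q) (sm_cx _ _ _ _ _ fef_smooth_Q) x).
  apply is_derive_unique in D. rewrite <- D. apply is_derive_unique.
  apply (is_derive_ext (fun x => rsum (fun k => g k * exp (INR k * (2 * x))) n)); [intros; symmetry; apply fef_mean_Q|].
  apply is_derive_rsum_exp.
Qed.

(** The tangent inequality for the convex function [mean (Y x)], from [x0] to 0. The terms in [Q]
    form the left side. The slopes of [U] and [W], multiplied by [- x0 >= 0], and the mean of [W] at
    [x0] are nonnegative and discarded; the mean of [W] at 0 is bounded by that of [U]. *)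
Lemma fef_bound_eps x0 : x0 <= 0 ->
  rsum (fun k => g k * (1 - exp (INR k * (2 * x0)) + x0 * (2 * INR k * exp (INR k * (2 * x0))))) n
  <= lam * (circle_L1 n p + eps - circle_L1 n (dil p (exp x0))) + mu * (circle_L1 n p + eps).
Proof.
  intros Hx0. assert (Hmu := fef_mu_pos).
  (* The value of this bound is immaterial: boundedness alone fixes the sign of the slopes. *)
  set (B := rsum (fun k => Cmod (p k) * 1 ^ k) n + eps).
  assert (HB : forall x t, x <= 0 -> 0 <= U x t <= B).
  { intros x t Hx1. split; [left; apply exp_pos|].
    eapply Rle_trans; [apply fef_U_bounds|]. unfold B. apply Rplus_le_compat_r, pev_dom.
    rewrite Cmod_zpt. apply exp_le_1; auto. }
  assert (SU : 0 <= mean (Ux x0)).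
  { apply (mean_slope_nonneg _ _ _ _ _ B smU fef_U_period); auto.
    intros x t _. eapply Rle_trans; [|apply fef_lap_U].
    apply Rmult_le_pos; [apply fef_sum_sq_nonneg|left; apply Rinv_0_lt_compat, exp_pos]. }
  assert (SW : 0 <= mean (Wx x0)).
  { apply (mean_slope_nonneg _ _ _ _ _ B smEW fef_W_period); auto.
    - intros x t _. eapply Rle_trans; [|apply fef_lap_W]. assert (K := fef_kap_pos).
      apply Rmult_le_pos; [left; apply exp_pos|].
      assert (K1 := fef_sum_sq_nonneg (cx x t) (dx x t)). apply Rmult_le_pos; lra.
    - intros x t Hx1. split; [left; apply exp_pos|].
      eapply Rle_trans; [apply fef_W_le_U; auto|apply HB; auto]. }
  assert (T : mean (Y x0) + (0 - x0) * mean (Yx x0) <= mean (Y 0)).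
  { apply (mean_tangent _ _ _ _ _ smY); auto using fef_lap_Y; try lra.
    intros x t; unfold Y. rewrite fef_U_period, fef_W_period, fef_Q_period; auto. }
  assert (cU : forall x, rcont (U x)) by (intros; apply cont2_slice, smU).
  assert (cW : forall x, rcont (W x)) by (intros; apply cont2_slice, smEW).
  assert (cQ : forall x, rcont (Q x)) by (intros; apply cont2_slice, fef_smooth_Q).
  assert (cUx : forall x, rcont (Ux x)) by (intros; apply cont2_slice, smU).
  assert (cWx : forall x, rcont (Wx x)) by (intros; apply cont2_slice, smEW).
  assert (cQx : forall x, rcont (Qx x)) by (intros; apply cont2_slice, fef_smooth_Q).
  assert (MY : forall x, mean (Y x) = lam * mean (U x) + mu * mean (W x) - mean (Q x)).
  { intros x. unfold Y. rewrite !mean_plus, !mean_scal; auto with cont. ring. }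
  assert (MYx : mean (Yx x0) = lam * mean (Ux x0) + mu * mean (Wx x0) - mean (Qx x0)).
  { unfold Yx. rewrite !mean_plus, !mean_scal; auto with cont. ring. }
  rewrite !MY, MYx in T.
  assert (CP : forall x, rcont (fun t => Cmod (pev p n (zpt x t)))) by (intros; apply rcont_Cmod, ccont_pev_zpt).
  assert (NU0 : mean (U 0) <= circle_L1 n p + eps).
  { apply Rle_trans with (mean (fun t => Cmod (pev p n (zpt 0 t)) + eps)).
    - apply mean_le; auto with cont. intros; apply fef_U_bounds.
    - rewrite mean_plus, mean_const by auto with cont. apply Rplus_le_compat_r, Req_le, mean_ext; intros t.
      unfold zpt. rewrite exp_0, Cmult_1_l; auto. }
  assert (NUx : circle_L1 n (dil p (exp x0)) <= mean (U x0)).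
  { apply Rle_trans with (mean (fun t => Cmod (pev p n (zpt x0 t)))).
    - apply Req_le, mean_ext; intros t. rewrite pev_zpt; auto.
    - apply mean_le; auto. intros; apply fef_U_bounds. }
  assert (NW0 : mean (W 0) <= mean (U 0)) by (apply mean_le; auto; intros; apply fef_W_le_U; lra).
  assert (NWx : 0 <= mean (W x0)) by (apply mean_ge0; auto; intros; left; apply exp_pos).
  assert (EQ : rsum (fun k => g k * (1 - exp (INR k * (2 * x0)) + x0 * (2 * INR k * exp (INR k * (2 * x0))))) n
    = mean (Q 0) - mean (Q x0) + x0 * mean (Qx x0)).
  { rewrite !fef_mean_Q, fef_mean_Qx, <- rsum_scal.
    replace (rsum (fun k => g k * exp (INR k * (2 * 0))) n) with (rsum g n).
    2:{ apply rsum_ext; intros k _. rewrite Rmult_0_r, Rmult_0_r, exp_0; ring. }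
    replace (rsum (fun k => g k * exp (INR k * (2 * x0))) n)
      with (-1 * rsum (fun k => -1 * (g k * exp (INR k * (2 * x0)))) n) by (rewrite rsum_scal; ring).
    unfold Rminus at 2. replace (- (-1 * rsum (fun k => -1 * (g k * exp (INR k * (2 * x0)))) n))
      with (rsum (fun k => -1 * (g k * exp (INR k * (2 * x0)))) n) by ring.
    rewrite <- !rsum_plus. apply rsum_ext; intros; ring. }
  rewrite EQ.
  assert (0 <= - x0 * (lam * mean (Ux x0))) by (apply Rmult_le_pos; [lra|apply Rmult_le_pos; lra]).
  assert (0 <= - x0 * (mu * mean (Wx x0))) by (apply Rmult_le_pos; [lra|apply Rmult_le_pos; lra]).
  assert (0 <= mu * mean (W x0)) by (apply Rmult_le_pos; lra).
  assert (mu * mean (W 0) <= mu * (circle_L1 n p + eps)) by (apply Rmult_le_compat_l; lra).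
  assert (lam * mean (U 0) <= lam * (circle_L1 n p + eps)) by (apply Rmult_le_compat_l; lra).
  assert (lam * circle_L1 n (dil p (exp x0)) <= lam * mean (U x0)) by (apply Rmult_le_compat_l; lra).
  lra.
Qed.
End Fefferman.

(** [fef_bound_eps] at [x0 = ln r]. The regularisation costs [lam + mu] times its parameter, hence
    the choice [e / (lam + mu)]. *)
Lemma fefferman_Re (p h : nat -> C) (n : nat) (M lam r : R) : 0 < M -> 0 < lam -> 0 < r <= 1 ->
  (forall k, (n <= k)%nat -> h k = RtoC 0) ->
  (forall z, Cmod z < 1 -> (1 - Cmod z ^ 2) * rsum (fun m => Cmod (pev (shift h (S m)) n z) ^ 2) n <= M ^ 2) ->
  Re (csum (fun k => p k * Cconj (h k) * RtoC (1 - smooth_mult r k))%C n)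
  <= lam * (circle_L1 n p - circle_L1 n (dil p r)) + exp 1 * M ^ 2 / lam * circle_L1 n p.
Proof.
  intros HM Hlam Hr Hh Hg.
  assert (Hx : ln r <= 0) by (rewrite <- ln_1; apply ln_le; lra).
  set (mu := exp 1 * M ^ 2 / lam).
  assert (Hmu : 0 < mu) by (apply Rdiv_lt_0_compat; auto; apply Rmult_lt_0_compat; [apply exp_pos|apply pow_lt; auto]).
  apply le_epsilon; intros e He.
  assert (Hd : 0 < e / (lam + mu)) by (apply Rdiv_lt_0_compat; lra).
  assert (K := fef_bound_eps p h n M lam (e / (lam + mu)) HM Hlam Hd Hh Hg (ln r) Hx).
  rewrite exp_ln in K by lra. cbv zeta in K. fold mu in K.
  assert (E : rsum (fun k => Re (p k * Cconj (h k))%C *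
         (1 - exp (INR k * (2 * ln r)) + ln r * (2 * INR k * exp (INR k * (2 * ln r))))) n
     = Re (csum (fun k => p k * Cconj (h k) * RtoC (1 - smooth_mult r k))%C n)).
  { rewrite csum_Re. apply rsum_ext; intros k _.
    assert (P : r ^ (2 * k) = exp (INR k * (2 * ln r))).
    { rewrite <- Rpower_pow by lra. unfold Rpower. f_equal. rewrite mult_INR. simpl (INR 2). ring. }
    unfold smooth_mult. rewrite P. generalize (p k * Cconj (h k))%C. intros [? ?]; simpl; ring. }
  rewrite E in K.
  assert ((lam + mu) * (e / (lam + mu)) = e) by (field; lra). lra.
Qed.

(** * Cesaro means and the Garsia gap *)

(** A gap bound through partial sums, meaningful before any summability is known. *)
Definition gap_le (h : nat -> C) (z : C) (G : R) : Prop :=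
  forall N, (1 - Cmod z ^ 2) * rsum (fun m => Cmod (peval (shift h (S m)) z) ^ 2) N <= G.

Lemma sigma_na_holo alpha n h : 0 < alpha -> holo_disk h -> holo_disk (sigma_na alpha n h).
Proof.
  intros Ha. apply holo_disk_dom with (C0 := 1). intros k. rewrite sigma_na_mult, Cmod_mult, Cmod_R.
  assert (K := ces_mult_bound alpha n k Ha). rewrite Rabs_pos_eq by lra.
  apply Rmult_le_compat_r; [apply Cmod_ge_0|lra].
Qed.

(** Shifting commutes with convolution in the angle up to the phase [Cconj (cis s ^ S m)]. The phase
    is unimodular and the rotated points have the modulus of [z], so neither affects the bound in
    [ces_gap]. *)
Lemma peval_sigma_shift alpha n h m z : 0 < alpha -> holo_disk h -> Cmod z < 1 ->
  peval (shift (sigma_na alpha n h) (S m)) z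
  = Cmean (fun s => RtoC (ces_kernel alpha n s) * (Cconj (cis s ^ S m) * peval (shift h (S m)) (z * Cconj (cis s))))%C.
Proof.
  intros Ha Hh Hz. assert (Hz0 := Cmod_ge_0 z).
  assert (Hhs := holo_disk_shift h (S m) Hh).
  assert (Hzs : forall s, Cmod (z * Cconj (cis s))%C = Cmod z)
    by (intros; rewrite Cmod_mult, Cmod_conj, Cmod_cis; ring).
  assert (cK : ccont (fun s => RtoC (ces_kernel alpha n s))) by (apply ccont_RtoC, rcont_ces_kernel).
  apply clim_unique with (fun J => pev (shift (sigma_na alpha n h) (S m)) J z).
  { apply peval_clim; auto. apply holo_disk_shift, sigma_na_holo; auto. }
  intros e He.
  assert (Hn := pos_INR n).
  destruct (peval_unif _ (Cmod z) Hhs (conj Hz0 Hz) (e / (2 * INR n + 1))) as [N HN]; [apply Rdiv_lt_0_compat; lra|].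
  exists N; intros J HJ.
  replace (pev (shift (sigma_na alpha n h) (S m)) J z) with
    (Cmean (fun s => RtoC (ces_kernel alpha n s) * (Cconj (cis s ^ S m) * pev (shift h (S m)) J (z * Cconj (cis s))))%C).
  - apply Cmean_sub_le.
    + apply ccont_mult; auto. apply ccont_mult; auto with cont. apply ccont_pev; auto with cont.
    + apply ccont_mult; auto. apply ccont_mult; auto with cont. apply ccont_peval with (Cmod z); auto with cont.
      intros t; rewrite Hzs; lra.
    + intros s.
      replace (_ - _)%C with (RtoC (ces_kernel alpha n s) * (Cconj (cis s ^ S m)
        * (pev (shift h (S m)) J (z * Cconj (cis s)) - peval (shift h (S m)) (z * Cconj (cis s)))))%C by ring.
      rewrite !Cmod_mult, Cmod_conj, Cmod_pow, Cmod_cis, pow1, Rmult_1_l, Cmod_R.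
      assert (K1 := ces_kernel_trivial_bound alpha n s Ha).
      assert (K2 := HN J (z * Cconj (cis s))%C HJ ltac:(rewrite Hzs; lra)).
      apply Rle_trans with ((2 * INR n + 1) * (e / (2 * INR n + 1))); [|right; field; lra].
      apply Rmult_le_compat; auto; [apply Rabs_pos|apply Cmod_ge_0].
  - rewrite (Cmean_ext _ (fun s => csum (fun j => (h (S m + j)%nat * z ^ j)
       * (RtoC (ces_kernel alpha n s) * Cconj (cis s ^ (S m + j))))%C J)).
    + rewrite (Cmean_csum (fun j s => (h (S m + j)%nat * z ^ j)
       * (RtoC (ces_kernel alpha n s) * Cconj (cis s ^ (S m + j))))%C) by auto 8 with cont.
      apply csum_ext; intros j _. rewrite Cmean_scal, Cmean_ces_kernel by auto with cont.
      unfold shift. rewrite sigma_na_mult. ring.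
    + intros s. unfold pev. rewrite <- !csum_scal. apply csum_ext; intros j _.
      unfold shift. rewrite Cpow_mult_l, Cpow_add_r, Cmult_conj, (Cpow_conj (cis s) j). ring.
Qed.

(* Minkowski's inequality in l2, by pairing with the vector of values itself. *)
Lemma ces_gap alpha C0 n h z M : 0 < alpha -> 0 < C0 -> 0 <= M ->
  mean (fun t => Rabs (ces_kernel alpha n t)) <= C0 -> holo_disk h -> Cmod z < 1 ->
  (forall w, Cmod w = Cmod z -> gap_le h w (M ^ 2)) -> gap_le (sigma_na alpha n h) z ((C0 * M) ^ 2).
Proof.
  intros Ha HC HM HK Hh Hz Hg N. assert (Hp := one_minus_sq_pos z Hz).
  set (v := fun m => peval (shift (sigma_na alpha n h) (S m)) z).
  change (rsum (fun m => Cmod (peval (shift (sigma_na alpha n h) (S m)) z) ^ 2) N)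
    with (rsum (fun m => Cmod (v m) ^ 2) N).
  set (V := rsum (fun m => Cmod (v m) ^ 2) N).
  assert (HV : 0 <= V) by (apply rsum_nonneg; intros; apply pow2_ge_0).
  set (q := 1 - Cmod z ^ 2) in *. assert (Hq : 0 < sqrt q) by (apply sqrt_lt_R0; lra).
  set (D := fun m s => peval (shift h (S m)) (z * Cconj (cis s))%C).
  assert (Hzs : forall s, Cmod (z * Cconj (cis s))%C = Cmod z)
    by (intros; rewrite Cmod_mult, Cmod_conj, Cmod_cis; ring).
  assert (cD : forall m, ccont (D m)).
  { intros m. apply ccont_peval with (Cmod z); auto with cont; [apply holo_disk_shift; auto| |].
    - split; auto; apply Cmod_ge_0.
    - intros t; rewrite Hzs; lra. }
  assert (cK : ccont (fun s => RtoC (ces_kernel alpha n s))) by (apply ccont_RtoC, rcont_ces_kernel).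
  assert (E : RtoC V = Cmean (fun s => csum (fun m => Cconj (v m) * (RtoC (ces_kernel alpha n s) * (Cconj (cis s ^ S m) * D m s)))%C N)).
  { rewrite (Cmean_csum (fun m s => Cconj (v m) * (RtoC (ces_kernel alpha n s) * (Cconj (cis s ^ S m) * D m s)))%C)
      by auto 10 with cont.
    unfold V. rewrite <- csum_RtoC. apply csum_ext; intros m _. rewrite Cmean_scal by auto 8 with cont.
    unfold D. rewrite <- peval_sigma_shift by auto. fold (v m). rewrite <- Cmod2_real. ring. }
  assert (B : V <= C0 * (sqrt V * (M / sqrt q))).
  { rewrite <- (Rabs_pos_eq V) at 1 by auto. rewrite <- Cmod_R, E.
    eapply Rle_trans; [apply Cmod_Cmean|].
    { apply (ccont_csum (fun m s => Cconj (v m) * (RtoC (ces_kernel alpha n s) * (Cconj (cis s ^ S m) * D m s)))%C).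
      auto 10 with cont. }
    apply Rle_trans with (mean (fun s => (sqrt V * (M / sqrt q)) * Rabs (ces_kernel alpha n s))).
    - apply mean_le.
      + apply rcont_Cmod. apply (ccont_csum (fun m s => Cconj (v m) * (RtoC (ces_kernel alpha n s) * (Cconj (cis s ^ S m) * D m s)))%C).
        auto 10 with cont.
      + apply rcont_mult; auto with cont. apply rcont_abs, rcont_ces_kernel.
      + intros s.
        rewrite (csum_ext _ (fun m => RtoC (ces_kernel alpha n s) * (Cconj (v m) * (Cconj (cis s ^ S m) * D m s)))%C) by (intros; ring).
        rewrite csum_scal, Cmod_mult, Cmod_R, Rmult_comm. apply Rmult_le_compat_r; [apply Rabs_pos|].
        eapply Rle_trans; [apply csum_CS|].
        rewrite (rsum_ext (fun k => Cmod (Cconj (v k)) ^ 2) (fun k => Cmod (v k) ^ 2)) by (intros; rewrite Cmod_conj; auto).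
        fold V. apply Rmult_le_compat_l; [apply sqrt_pos|].
        rewrite (rsum_ext _ (fun m => Cmod (D m s) ^ 2)).
        2:{ intros m _. rewrite Cmod_mult, Cmod_conj, Cmod_pow, Cmod_cis, pow1, Rmult_1_l; auto. }
        assert (G := Hg (z * Cconj (cis s))%C (Hzs s) N). rewrite Hzs in G. fold q in G.
        change (fun m => Cmod (peval (shift h (S m)) (z * Cconj (cis s))%C) ^ 2) with (fun m => Cmod (D m s) ^ 2) in G.
        apply Rmult_le_reg_l with (sqrt q); auto.
        rewrite <- sqrt_mult; [|lra|apply rsum_nonneg; intros; apply pow2_ge_0].
        replace (sqrt q * (M / sqrt q)) with M by (field; lra).
        rewrite <- (sqrt_pow2 M) by auto. apply sqrt_le_1_alt; auto.
    - rewrite mean_scal by (apply rcont_abs, rcont_ces_kernel).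
      rewrite Rmult_comm. apply Rmult_le_compat_r; auto.
      apply Rmult_le_pos; [apply sqrt_pos|]. apply Rmult_le_pos; auto. left; apply Rinv_0_lt_compat; auto. }
  assert (SV := sqrt_sqrt V HV). assert (SV0 := sqrt_pos V). assert (Sq := sqrt_sqrt q ltac:(lra)).
  assert (B2 : sqrt V * sqrt q <= C0 * M).
  { destruct (Req_dec (sqrt V) 0) as [Z|Z]; [rewrite Z, Rmult_0_l; apply Rmult_le_pos; lra|].
    apply Rmult_le_reg_l with (sqrt V); [lra|].
    apply Rle_trans with (V * sqrt q); [right; rewrite <- SV at 3; ring|].
    apply Rle_trans with (C0 * (sqrt V * (M / sqrt q)) * sqrt q); [apply Rmult_le_compat_r; lra|].
    right; field; lra. }
  apply Rle_trans with ((sqrt V * sqrt q) ^ 2).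
  - right. rewrite <- SV at 1. rewrite <- Sq at 1. ring.
  - apply pow_incr; split; auto. apply Rmult_le_pos; lra.
Qed.

(** * Fefferman's inequality *)

Lemma clim_csum (u : nat -> nat -> C) (l : nat -> C) N : (forall k, (k < N)%nat -> clim (fun j => u j k) (l k)) ->
  clim (fun j => csum (u j) N) (csum l N).
Proof.
  induction N as [|N IH]; intros H; simpl; [apply (clim_eventually_const _ _ O); auto|].
  apply (clim_plus (fun j => csum (u j) N) (fun j => u j N)); auto.
Qed.

Lemma clim_mult_RtoC (u : nat -> R) (l : R) (c : C) : is_lim_seq u l -> clim (fun j => RtoC (u j) * c)%C (RtoC l * c)%C.
Proof.
  intros H. apply clim_ext with (fun j => c * RtoC (u j))%C; [intros; ring|].
  rewrite Cmult_comm. apply clim_scal. intros e He.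
  apply is_lim_seq_spec in H. destruct (H (mkposreal e He)) as [N HN]. exists N; intros j Hj.
  rewrite <- RtoC_minus, Cmod_R. left; apply HN; auto.
Qed.

Lemma circle_L1_nonneg n p : 0 <= circle_L1 n p.
Proof. apply mean_ge0; [apply rcont_Cmod, ccont_pev; auto with cont|intros; apply Cmod_ge_0]. Qed.

Lemma circle_L1_ext n p q : (forall k, (k < n)%nat -> p k = q k) -> circle_L1 n p = circle_L1 n q.
Proof. intros H. apply mean_ext; intros t. f_equal. apply csum_ext; intros; rewrite H; auto. Qed.

Lemma circle_L1_scal n p u : circle_L1 n (fun k => u * p k)%C = Cmod u * circle_L1 n p.
Proof.
  unfold circle_L1. rewrite <- mean_scal by (apply rcont_Cmod, ccont_pev; auto with cont).
  apply mean_ext; intros t. rewrite <- Cmod_mult. f_equal. unfold pev. rewrite <- csum_scal.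
  apply csum_ext; intros; ring.
Qed.

Lemma circle_L1_trunc n m p : (n <= m)%nat -> circle_L1 m (trunc p n) = circle_L1 n p.
Proof.
  intros H. apply mean_ext; intros t. rewrite <- (pev_trunc p n). f_equal. apply csum_trunc; auto.
  intros k Hk. rewrite trunc_ge by lia. ring.
Qed.

Lemma circle_L1_coef0 n p : (0 < n)%nat -> Cmod (p O) <= circle_L1 n p.
Proof.
  intros Hn. assert (E := Cmean_pev_cis p n O). destruct (lt_dec 0 n); [|lia]. rewrite <- E.
  eapply Rle_trans; [apply Cmod_Cmean|].
  - apply ccont_mult; auto with cont. apply ccont_pev; auto with cont.
  - apply Req_le, mean_ext; intros t. rewrite Cmod_mult, Cmod_conj, Cmod_pow, Cmod_cis, pow1; ring.
Qed.

Lemma unimodular_rotation (c : C) : exists u, Cmod u = 1 /\ (u * c)%C = RtoC (Cmod c).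
Proof.
  destruct (Req_dec (Cmod c) 0) as [E|E].
  - exists (RtoC 1). rewrite Cmod_1. split; auto. rewrite E. apply Cmod_eq_0 in E. rewrite E. ring.
  - assert (Hc := Cmod_ge_0 c). exists (RtoC (/ Cmod c) * Cconj c)%C. split.
    + rewrite Cmod_mult, Cmod_conj, Cmod_R, Rabs_pos_eq; [field; auto|left; apply Rinv_0_lt_compat; lra].
    + replace (RtoC (/ Cmod c) * Cconj c * c)%C with (RtoC (/ Cmod c) * (c * Cconj c))%C by ring.
      rewrite Cmod2_real, <- RtoC_mult. f_equal. field; auto.
Qed.

Lemma pev_conj p n z : pev (fun k => Cconj (p k)) n z = Cconj (pev p n (Cconj z)).
Proof.
  unfold pev. rewrite csum_conj. apply csum_ext; intros k _. rewrite Cmult_conj, Cpow_conj, Cconj_conj; auto.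
Qed.

(* For polynomial [h] this is [fefferman_Re]; in general [h] is replaced by its Cesaro means. *)
Lemma fefferman_gain alpha C0 (p h : nat -> C) n M lam r : 0 < alpha -> 0 < C0 ->
  (forall n, mean (fun t => Rabs (ces_kernel alpha n t)) <= C0) ->
  0 < M -> 0 < lam -> 0 < r <= 1 -> holo_disk h -> (forall z, Cmod z < 1 -> gap_le h z (M ^ 2)) ->
  Cmod (csum (fun k => p k * h k * RtoC (1 - smooth_mult r k))%C n)
  <= lam * (circle_L1 n p - circle_L1 n (dil p r)) + exp 1 * (C0 * M) ^ 2 / lam * circle_L1 n p.
Proof.
  intros Ha HC HK HM Hlam Hr Hh Hg.
  apply clim_Cmod_le with (fun J => csum (fun k => RtoC (ces_mult alpha J k) * (p k * h k * RtoC (1 - smooth_mult r k)))%C n).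
  { rewrite (csum_ext (fun k => p k * h k * RtoC (1 - smooth_mult r k))%C
      (fun k => RtoC 1 * (p k * h k * RtoC (1 - smooth_mult r k)))%C) by (intros; ring).
    apply (clim_csum (fun J k => RtoC (ces_mult alpha J k) * (p k * h k * RtoC (1 - smooth_mult r k)))%C).
    intros k _. apply clim_mult_RtoC, ces_mult_lim; auto. }
  exists n; intros J HJ.
  (* Only real parts are controlled, so [p] is multiplied by a unimodular [u] that makes the sum
     nonnegative. *)
  set (c := csum _ n). destruct (unimodular_rotation c) as [u [Hu Huc]].
  (* [fefferman_Re] pairs with a conjugate, hence the conjugated coefficients; their gap at [z] is
     that of the means at [Cconj z]. *)
  set (eta := fun k => Cconj (sigma_na alpha J h k)).
  set (p' := fun k => (u * trunc p n k)%C).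
  assert (Heta : forall k, (S J <= k)%nat -> eta k = RtoC 0).
  { intros k Hk. unfold eta. rewrite sigma_na_mult, ces_mult_0 by lia.
    apply C_ext; simpl; ring. }
  assert (Hgap : forall z, Cmod z < 1 ->
     (1 - Cmod z ^ 2) * rsum (fun m => Cmod (pev (shift eta (S m)) (S J) z) ^ 2) (S J) <= (C0 * M) ^ 2).
  { intros z Hz. assert (Hz' : Cmod (Cconj z) < 1) by (rewrite Cmod_conj; auto).
    assert (G := ces_gap alpha C0 J h (Cconj z) M Ha HC ltac:(lra) (HK J) Hh Hz' (fun w Hw => Hg w ltac:(rewrite Hw; auto)) (S J)).
    rewrite Cmod_conj in G. eapply Rle_trans; [|exact G]. right. f_equal. apply rsum_ext; intros m _.
    rewrite (peval_finite _ (S J)); auto.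
    - rewrite <- (Cmod_conj (pev (shift (sigma_na alpha J h) (S m)) (S J) (Cconj z))), <- pev_conj. reflexivity.
    - intros k Hk. unfold shift. rewrite sigma_na_mult, ces_mult_0 by lia. ring. }
  assert (F := fefferman_Re p' eta (S J) (C0 * M) lam r ltac:(apply Rmult_lt_0_compat; auto) Hlam Hr Heta Hgap).
  assert (E1 : circle_L1 (S J) p' = circle_L1 n p).
  { unfold p'. rewrite circle_L1_scal, Hu, Rmult_1_l. apply circle_L1_trunc; lia. }
  assert (E2 : circle_L1 (S J) (dil p' r) = circle_L1 n (dil p r)).
  { rewrite (circle_L1_ext _ (dil p' r) (fun k => u * trunc (dil p r) n k)%C).
    - rewrite circle_L1_scal, Hu, Rmult_1_l. apply circle_L1_trunc; lia.
    - intros k _. unfold p', dil, trunc. destruct (lt_dec k n); ring. }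
  rewrite E1, E2 in F.
  assert (E3 : csum (fun k => p' k * Cconj (eta k) * RtoC (1 - smooth_mult r k))%C (S J) = (u * c)%C).
  { unfold c. rewrite <- csum_scal. rewrite (csum_trunc _ n (S J)) by
      (try lia; intros k Hk; unfold p'; rewrite trunc_ge by lia; ring).
    apply csum_ext; intros k Hk. unfold p', eta, trunc. destruct (lt_dec k n); [|lia].
    rewrite Cconj_conj, sigma_na_mult. ring. }
  rewrite E3, Huc in F. exact F.
Qed.

(** With [x = - k * ln r] the multiplier is $e^{-2x}(1+2x)$, and $1+2x\le 2e^x$. The geometric decay
    is what makes [gmain] absolutely summable. *)
Lemma smooth_mult_bound r k : 0 < r <= 1 -> 0 <= smooth_mult r k <= 2 * r ^ k.
Proof.
  intros Hr. unfold smooth_mult. assert (Hl : ln r <= 0) by (rewrite <- ln_1; apply ln_le; lra).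
  assert (Hk := pos_INR k). set (x := - (INR k * ln r)).
  assert (Hx : 0 <= x) by (unfold x; nra).
  assert (E : r ^ k = exp (- x)).
  { rewrite <- Rpower_pow by lra. unfold Rpower, x. f_equal; ring. }
  replace (2 * k)%nat with (k + k)%nat by lia. rewrite pow_add, E.
  replace (1 - 2 * INR k * ln r) with (1 + 2 * x) by (unfold x; ring).
  assert (E1 := exp_ineq1_le x). assert (E2 := exp_pos (- x)).
  assert (E3 : exp (- x) * exp x = 1) by (rewrite <- exp_plus; replace (- x + x) with 0 by ring; apply exp_0).
  split; [repeat apply Rmult_le_pos; lra|].
  apply Rle_trans with (exp (- x) * (exp (- x) * (2 * exp x))); [|nra].
  rewrite Rmult_assoc. apply Rmult_le_compat_l; [lra|]. apply Rmult_le_compat_l; lra.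
Qed.

(** [r] tends to 0 in [fefferman_gain], with [lam = C0 * M] so that both terms on the right are
    multiples of [C0 * M]. The coefficient at 0 escapes, since [smooth_mult r 0 = 1] for every [r],
    and is bounded by [circle_L1_coef0]. *)
Lemma fefferman alpha C0 (p h : nat -> C) n M : 0 < alpha -> 0 < C0 ->
  (forall n, mean (fun t => Rabs (ces_kernel alpha n t)) <= C0) ->
  0 < M -> holo_disk h -> (forall z, Cmod z < 1 -> gap_le h z (M ^ 2)) ->
  Cmod (csum (fun k => p k * h k)%C n) <= (Cmod (h O) + (1 + exp 1) * (C0 * M)) * circle_L1 n p.
Proof.
  intros Ha HC HK HM Hh Hg. destruct n as [|n].
  { simpl csum. rewrite Cmod_0. apply Rmult_le_pos; [|apply circle_L1_nonneg].
    assert (K1 := Cmod_ge_0 (h O)). assert (K2 := exp_pos 1).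
    assert (0 < (1 + exp 1) * (C0 * M)) by (repeat apply Rmult_lt_0_compat; lra). lra. }
  assert (HCM : 0 < C0 * M) by (apply Rmult_lt_0_compat; auto).
  assert (B : Cmod (csum (fun k => p (S k) * h (S k))%C n) <= (1 + exp 1) * (C0 * M) * circle_L1 (S n) p).
  { set (rj := fun j => exp (- INR j)).
    assert (Hrj : forall j, 0 < rj j <= 1).
    { intros j; unfold rj; split; [apply exp_pos|]. apply exp_le_1. assert (Q := pos_INR j); lra. }
    apply clim_Cmod_le with (fun j => csum (fun k => RtoC (1 - smooth_mult (rj j) (S k)) * (p (S k) * h (S k)))%C n).
    - rewrite (csum_ext (fun k => p (S k) * h (S k))%C (fun k => RtoC 1 * (p (S k) * h (S k)))%C) by (intros; ring).
      apply (clim_csum (fun j k => RtoC (1 - smooth_mult (rj j) (S k)) * (p (S k) * h (S k)))%C). intros k _.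
      apply clim_mult_RtoC. replace (Finite 1) with (Finite (1 - 0)) by (f_equal; ring).
      apply is_lim_seq_minus'; [apply is_lim_seq_const|].
      apply is_lim_seq_le_le with (fun _ => 0) (fun j => 2 * / INR (S j)).
      + intros j. destruct (smooth_mult_bound (rj j) (S k) (Hrj j)) as [S1 S2]. split; auto.
        eapply Rle_trans; [exact S2|]. apply Rmult_le_compat_l; [lra|].
        apply Rle_trans with (rj j).
        * simpl pow. rewrite <- (Rmult_1_r (rj j)) at 3. apply Rmult_le_compat_l; [left; apply Hrj|].
          rewrite <- (pow1 k). apply pow_incr. destruct (Hrj j); lra.
        * unfold rj. rewrite exp_Ropp. apply Rinv_le_contravar; [apply lt_0_INR; lia|].
          rewrite S_INR. assert (Q := exp_ineq1_le (INR j)). lra.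
      + apply is_lim_seq_const.
      + replace (Finite 0) with (Finite (2 * 0)) by (f_equal; ring).
        apply is_lim_seq_mult'; [apply is_lim_seq_const|].
        apply (is_lim_seq_incr_1 (fun j => / INR j)).
        replace (Finite 0) with (Rbar_inv p_infty) by reflexivity.
        apply is_lim_seq_inv; [apply is_lim_seq_INR|discriminate].
    - exists O; intros j _.
      assert (F := fefferman_gain alpha C0 p h (S n) M (C0 * M) (rj j) Ha HC HK HM HCM (Hrj j) Hh Hg).
      rewrite csum_shift in F.
      replace (RtoC (1 - smooth_mult (rj j) 0)) with (RtoC 0) in F by (unfold smooth_mult; simpl; f_equal; ring).
      rewrite Cmult_0_r, Cplus_0_l in F.
      rewrite (csum_ext _ (fun k => p (S k) * h (S k) * RtoC (1 - smooth_mult (rj j) (S k)))%C) by (intros; ring).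
      eapply Rle_trans; [exact F|].
      replace (exp 1 * (C0 * M) ^ 2 / (C0 * M)) with (exp 1 * (C0 * M)) by (field; lra).
      assert (Q := circle_L1_nonneg (S n) (dil p (rj j))). nra. }
  rewrite csum_shift. eapply Rle_trans; [apply Cmod_triangle|]. rewrite Rmult_plus_distr_r.
  apply Rplus_le_compat; auto. rewrite Cmod_mult, Rmult_comm.
  apply Rmult_le_compat_l; [apply Cmod_ge_0|apply circle_L1_coef0; lia].
Qed.

(** * Duality *)

Lemma Cmean_cis_orth_conj j k i :
  Cmean (fun t => Cconj (cis t ^ (i + j)) * Cconj (Cconj (cis t ^ (i + k))))%C = RtoC (if Nat.eq_dec j k then 1 else 0).
Proof.
  rewrite (Cmean_ext _ (fun t => Cconj (cis t ^ (i + j) * Cconj (cis t ^ (i + k))))%C) by (intros; rewrite Cmult_conj; auto).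
  rewrite Cmean_conj, Cmean_cis_orth by auto with cont.
  destruct (Nat.eq_dec (i + j) (i + k)), (Nat.eq_dec j k); try lia; apply C_ext; simpl; ring.
Qed.

Section Projection.
Variable phi : R -> C.
Hypothesis cphi : ccont phi.
Hypothesis phi1 : forall t, Cmod (phi t) <= 1.

(** Fourier coefficients of [phi] at the frequencies [- k]: the pairing carries no conjugation, so
    it is the reflected Riesz projection that is paired with [f]. *)
Definition proj_coef (k : nat) : C := Cmean (fun t => phi t * cis t ^ k)%C.

Lemma proj_l2 : l2le proj_coef 1.
Proof.
  intros n. apply Rle_trans with (mean (fun t => Cmod (phi t) ^ 2)).
  - eapply Rle_trans; [|apply (Bessel phi (fun k t => Cconj (cis t ^ k))%C n); auto with cont].
    + apply Req_le, rsum_ext; intros k _. unfold proj_coef. do 2 f_equal.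
      apply Cmean_ext; intros t. rewrite Cconj_conj; auto.
    + intros j k. apply (Cmean_cis_orth_conj j k 0).
  - rewrite <- (mean_const 1). apply mean_le; [apply (rcont_pow _ 2); auto with cont|auto with cont|].
    intros t. specialize (phi1 t). assert (K := Cmod_ge_0 (phi t)). nra.
Qed.

(** The shifts evaluated at [z] are Fourier coefficients of [phi] times the Cauchy kernel, and the
    mean square of the kernel is [/ (1 - Cmod z ^ 2)], exactly compensating the factor of the
    gap. *)
Lemma proj_gap z : Cmod z < 1 -> gap_le proj_coef z 1.
Proof.
  intros Hz N. assert (Hp := one_minus_sq_pos z Hz). assert (cC := ccont_cauchy z Hz).
  assert (E : forall m, peval (shift proj_coef (S m)) z = Cmean (fun t => cauchy_ker z t * (phi t * cis t ^ S m))%C).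
  { intros m. symmetry.
    apply (Cmean_mult_approx (cauchy_ker z) (fun t => phi t * cis t ^ S m)%C _
      (fun n t => csum (fun j => z ^ j * cis t ^ j)%C n) (fun n => Cmod z ^ n / (1 - Cmod z))); auto with cont.
    - intros n; apply (ccont_csum (fun j t => z ^ j * cis t ^ j)%C); auto with cont.
    - intros t; rewrite Cmod_mult, Cmod_pow, Cmod_cis, pow1, Rmult_1_r; auto.
    - intros n t; apply cauchy_approx; auto.
    - intros e He; apply geom_small; auto. split; auto; apply Cmod_ge_0.
    - apply clim_ext with (fun n => pev (shift proj_coef (S m)) n z).
      + intros n. rewrite (Cmean_ext _ (fun t => csum (fun j => z ^ j * (phi t * cis t ^ (S m + j)))%C n)).
        * rewrite (Cmean_csum (fun j t => z ^ j * (phi t * cis t ^ (S m + j)))%C) by auto with cont.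
          apply csum_ext; intros j _. rewrite Cmean_scal by auto with cont. unfold shift, proj_coef. ring.
        * intros t. rewrite <- csum_scal_r. apply csum_ext; intros j _. rewrite Cpow_add_r. ring.
      + apply peval_clim; auto. apply holo_disk_shift, (l2le_holo _ 1), proj_l2. }
  apply Rle_trans with ((1 - Cmod z ^ 2) * mean (fun t => Cmod (cauchy_ker z t * phi t)%C ^ 2)).
  - apply Rmult_le_compat_l; [lra|].
    eapply Rle_trans; [|apply (Bessel (fun t => cauchy_ker z t * phi t)%C (fun k t => Cconj (cis t ^ (1 + k)))%C N); auto with cont].
    + apply Req_le, rsum_ext; intros m _. rewrite E. do 2 f_equal. apply Cmean_ext; intros t.
      rewrite Cconj_conj. simpl (1 + m)%nat. ring.
    + intros j k. apply (Cmean_cis_orth_conj j k 1).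
  - replace 1 with ((1 - Cmod z ^ 2) * / (1 - Cmod z ^ 2)) at 2 by (field; lra).
    apply Rmult_le_compat_l; [lra|]. rewrite <- mean_cauchy_sq by auto.
    apply mean_le; try (apply (rcont_pow _ 2); auto with cont).
    intros t. rewrite Cmod_mult, Rpow_mult_distr. specialize (phi1 t).
    assert (K := Cmod_ge_0 (phi t)). assert (K2 := pow2_ge_0 (Cmod (cauchy_ker z t))).
    rewrite <- (Rmult_1_r (Cmod (cauchy_ker z t) ^ 2)) at 2. apply Rmult_le_compat_l; auto. nra.
Qed.
End Projection.

(** The test function [phi] is the conjugate sign of [F], regularised where [F] vanishes:
    [/ q t * Cmod (F t) ^ 2] differs from [Cmod (F t)] by at most [e]. *)
Lemma circle_L1_dual n f K :
  (forall h, l2le h 1 -> (forall z, Cmod z < 1 -> gap_le h z 1) -> Cmod (csum (fun k => f k * h k)%C n) <= K) ->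
  circle_L1 n f <= K.
Proof.
  intros H. apply le_epsilon; intros e He.
  set (F := fun t => pev f n (cis t)).
  assert (cF : ccont F) by (apply ccont_pev; auto with cont).
  set (q := fun t => sqrt (Cmod (F t) ^ 2 + e ^ 2)).
  assert (Hq0 : forall t, 0 < Cmod (F t) ^ 2 + e ^ 2)
    by (intros t; assert (K1 := pow2_ge_0 (Cmod (F t))); assert (0 < e ^ 2) by (apply pow_lt; auto); lra).
  assert (Hq : forall t, 0 < q t) by (intros; apply sqrt_lt_R0; auto).
  assert (Hqs : forall t, q t * q t = Cmod (F t) ^ 2 + e ^ 2) by (intros; apply sqrt_sqrt; left; auto).
  assert (cq : rcont q).
  { apply rcont_sqrt, rcont_plus; [apply (rcont_pow _ 2)|]; auto with cont. }
  assert (ciq : rcont (fun t => / q t)) by (apply rcont_inv; auto; intros t; specialize (Hq t); lra).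
  set (phi := fun t => (RtoC (/ q t) * Cconj (F t))%C).
  assert (cphi : ccont phi) by (apply ccont_mult; auto with cont).
  assert (HqF : forall t, Cmod (F t) <= q t).
  { intros t. apply Rsqr_incr_0_var; [|left; auto]. unfold Rsqr. rewrite Hqs. assert (0 < e ^ 2) by (apply pow_lt; auto). nra. }
  assert (phi1 : forall t, Cmod (phi t) <= 1).
  { intros t. unfold phi. rewrite Cmod_mult, Cmod_conj, Cmod_R. specialize (Hq t). specialize (HqF t).
    rewrite Rabs_pos_eq by (left; apply Rinv_0_lt_compat; auto).
    apply Rmult_le_reg_l with (q t); auto. rewrite <- Rmult_assoc, Rinv_r by lra. lra. }
  assert (B := H (proj_coef phi) (proj_l2 phi cphi phi1) (proj_gap phi cphi phi1)).
  assert (E : csum (fun k => f k * proj_coef phi k)%C n = RtoC (mean (fun t => / q t * Cmod (F t) ^ 2))).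
  { rewrite <- Cmean_RtoC. rewrite (Cmean_ext _ (fun t => csum (fun k => f k * (phi t * cis t ^ k))%C n)).
    - rewrite (Cmean_csum (fun k t => f k * (phi t * cis t ^ k))%C) by auto with cont.
      apply csum_ext; intros k _. rewrite Cmean_scal by auto with cont. reflexivity.
    - intros t. rewrite RtoC_mult, <- Cmod2_real. unfold phi.
      replace (RtoC (/ q t) * (F t * Cconj (F t)))%C with (F t * (RtoC (/ q t) * Cconj (F t)))%C by ring.
      unfold F at 1, pev. rewrite <- csum_scal_r. apply csum_ext; intros; ring. }
  rewrite E, Cmod_R in B.
  assert (cS : rcont (fun t => / q t * Cmod (F t) ^ 2)) by (apply rcont_mult; auto; apply (rcont_pow _ 2); auto with cont).
  apply Rle_trans with (mean (fun t => / q t * Cmod (F t) ^ 2 + e)).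
  - apply mean_le; auto with cont. intros t. fold (F t).
    assert (K1 := Hq t). assert (K2 := Hqs t). assert (K3 := Cmod_ge_0 (F t)).
    assert (K4 : q t <= Cmod (F t) + e).
    { apply Rsqr_incr_0_var; [|lra]. unfold Rsqr. rewrite K2. nra. }
    apply Rmult_le_reg_l with (q t); auto. rewrite Rmult_plus_distr_l, <- Rmult_assoc, Rinv_r by lra.
    destruct (Rle_lt_dec (Cmod (F t)) e) as [L|L]; [|nra].
    assert (q t * Cmod (F t) <= q t * e) by (apply Rmult_le_compat_l; lra). assert (0 <= Cmod (F t) ^ 2) by apply pow2_ge_0. lra.
  - rewrite mean_plus, mean_const by auto with cont. apply Rplus_le_compat_r.
    eapply Rle_trans; [|exact B]. apply Rle_abs.
Qed.

Section Bounds.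
Variables (alpha C0 : R).
Hypotheses (Ha : 0 < alpha) (HC : 0 < C0).
Hypothesis HK : forall n, mean (fun t => Rabs (ces_kernel alpha n t)) <= C0.

(** The multiplier acts on the product [p k * h k], so it may be moved to the test sequence [h],
    whose gap becomes at most [C0 ^ 2]. Then [fefferman] applies with [M = C0], and the bound 1 on
    the modulus of [h 0] gives the leading 1. *)
Lemma circle_L1_sigma n j p : circle_L1 n (sigma_na alpha j p) <= (1 + (1 + exp 1) * (C0 * C0)) * circle_L1 n p.
Proof.
  apply circle_L1_dual. intros h Hl Hg. assert (Hh := l2le_holo h 1 Hl).
  rewrite (csum_ext _ (fun k => p k * sigma_na alpha j h k)%C) by (intros; rewrite !sigma_na_mult; ring).
  eapply Rle_trans; [apply (fefferman alpha C0 p (sigma_na alpha j h) n C0); auto|].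
  - apply sigma_na_holo; auto.
  - intros z Hz. replace (C0 ^ 2) with ((C0 * 1) ^ 2) by ring. apply (ces_gap alpha C0 j h z 1); auto; [lra|].
    intros w Hw. rewrite pow1. apply Hg. rewrite Hw; auto.
  - apply Rmult_le_compat_r; [apply circle_L1_nonneg|]. apply Rplus_le_compat_r.
    rewrite sigma_na_mult, ces_mult_O, Cmult_1_l by auto.
    assert (K := l2le_coef h 1 O Hl). assert (K0 := Cmod_ge_0 (h O)). nra.
Qed.

Lemma circle_L1_smoothing n p lam r : 0 < lam -> 0 < r <= 1 ->
  circle_L1 n (fun k => RtoC (1 - smooth_mult r k) * p k)%C
  <= lam * (circle_L1 n p - circle_L1 n (dil p r)) + exp 1 * C0 ^ 2 / lam * circle_L1 n p.
Proof.
  intros Hlam Hr. apply circle_L1_dual. intros h Hl Hg. assert (Hh := l2le_holo h 1 Hl).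
  rewrite (csum_ext _ (fun k => p k * h k * RtoC (1 - smooth_mult r k))%C) by (intros; ring).
  replace (C0 ^ 2) with ((C0 * 1) ^ 2) by ring.
  apply (fefferman_gain alpha C0 p h n 1 lam r); auto; [lra|]. intros z Hz; rewrite pow1; auto.
Qed.

(** The left side of [circle_L1_smoothing] is nonnegative, so large [lam] leaves monotonicity in the
    radius. The choice [lam = 1 + X / e] makes the remainder at most [e]. *)
Lemma circle_L1_dil_le n p r : 0 < r <= 1 -> circle_L1 n (dil p r) <= circle_L1 n p.
Proof.
  intros Hr. apply le_epsilon; intros e He.
  set (X := exp 1 * C0 ^ 2 * circle_L1 n p).
  assert (HX : 0 <= X).
  { unfold X. apply Rmult_le_pos; [apply Rmult_le_pos; [left; apply exp_pos|apply pow2_ge_0]|apply circle_L1_nonneg]. }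
  set (lam := 1 + X / e). assert (Hxe : 0 <= X / e) by (apply Rmult_le_pos; auto; left; apply Rinv_0_lt_compat; auto).
  assert (Hlam : 0 < lam) by (unfold lam; lra).
  assert (S := circle_L1_smoothing n p lam r Hlam Hr).
  assert (P := circle_L1_nonneg n (fun k => RtoC (1 - smooth_mult r k) * p k)%C).
  replace (exp 1 * C0 ^ 2 / lam * circle_L1 n p) with (X / lam) in S by (unfold X; field; lra).
  assert (Q : X / lam <= e).
  { apply Rmult_le_reg_r with lam; auto. unfold Rdiv. rewrite Rmult_assoc, Rinv_l, Rmult_1_r by lra.
    unfold lam. replace (e * (1 + X / e)) with (e + X) by (field; lra). lra. }
  assert (e <= lam * e) by (unfold lam; nra). nra.
Qed.
End Bounds.

(** * Convergence in H1 *)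

(** Inequalities for [circle_L1] reach the means of arbitrary holomorphic functions through this
    limit. *)
Lemma M1_lim (a : nat -> C) r : holo_disk a -> 0 <= r < 1 -> is_lim_seq (fun n => circle_L1 n (dil a r)) (M1 a r).
Proof.
  intros Ha Hr. apply is_lim_seq_spec. intros [e He]; simpl.
  destruct (peval_unif a r Ha Hr (e / 2)) as [N HN]; [lra|]. exists N; intros n Hn.
  apply Rle_lt_trans with (e / 2); [|lra].
  assert (Hc := ccont_peval_cis a r Ha Hr).
  apply (mean_Rabs_sub_le (fun t => Cmod (pev (dil a r) n (cis t))) (fun t => Cmod (peval a (RtoC r * cis t)%C)));
    auto with cont.
  - apply rcont_Cmod, ccont_pev; auto with cont.
  - intros t. rewrite <- peval_dil. eapply Rle_trans; [apply Cmod_triangle_inv|].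
    apply HN; auto. rewrite Cmod_r_cis; lra.
Qed.

Lemma lim_seq_le_le (u v : nat -> R) (l l' : R) : is_lim_seq u l -> is_lim_seq v l' -> (forall n, u n <= v n) -> l <= l'.
Proof. intros Hu Hv H. exact (is_lim_seq_le u v (Finite l) (Finite l') H Hu Hv). Qed.

Lemma M1_csub_le (a b : nat -> C) r : holo_disk a -> holo_disk b -> 0 <= r < 1 ->
  M1 (csub a b) r <= M1 a r + M1 b r.
Proof.
  intros Ha Hb Hr. assert (Ca := ccont_peval_cis a r Ha Hr). assert (Cb := ccont_peval_cis b r Hb Hr).
  assert (Cab := ccont_peval_cis _ r (holo_disk_csub a b Ha Hb) Hr).
  change (mean (fun t => Cmod (peval (csub a b) (RtoC r * cis t)%C))
    <= mean (fun t => Cmod (peval a (RtoC r * cis t)%C)) + mean (fun t => Cmod (peval b (RtoC r * cis t)%C))).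
  rewrite <- mean_plus by auto with cont. apply mean_le; auto with cont. intros t.
  rewrite peval_csub; auto; [|rewrite Cmod_r_cis; lra].
  unfold Cminus. eapply Rle_trans; [apply Cmod_triangle|]. rewrite Cmod_opp; lra.
Qed.

Lemma M1_sum_bound (a : nat -> C) r B : holo_disk a -> 0 <= r < 1 -> (forall n, rsum (fun k => Cmod (a k)) n <= B) -> M1 a r <= B.
Proof.
  intros Ha Hr HB. assert (Ca := ccont_peval_cis a r Ha Hr).
  change (mean (fun t => Cmod (peval a (RtoC r * cis t)%C)) <= B).
  rewrite <- (mean_const B). apply mean_le; auto with cont. intros t.
  assert (E : Cmod (RtoC r * cis t)%C = r) by (apply Cmod_r_cis; lra).
  apply peval_dom; auto; [lra|]. intros n. eapply Rle_trans; [|apply (HB n)].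
  apply rsum_le; intros k _. rewrite E. rewrite <- (Rmult_1_r (Cmod (a k))) at 2.
  apply Rmult_le_compat_l; [apply Cmod_ge_0|]. rewrite <- (pow1 k). apply pow_incr; lra.
Qed.

(** Radius 0 lies outside [circle_L1_dil_le], whose ratio is positive; here the mean is the modulus
    of the constant coefficient. *)
Lemma M1_zero_le (a : nat -> C) r : holo_disk a -> 0 <= r < 1 -> M1 a 0 <= M1 a r.
Proof.
  intros Ha Hr.
  assert (E : M1 a 0 = Cmod (a O)).
  { change (M1 a 0) with (mean (fun t => Cmod (peval a (RtoC 0 * cis t)%C))).
    rewrite <- (mean_const (Cmod (a O))). apply mean_ext; intros t. rewrite Cmult_0_l, peval_0; auto. }
  rewrite E. refine (lim_seq_le_le (fun _ => Cmod (a O)) (fun n => circle_L1 (S n) (dil a r)) _ _ (is_lim_seq_const _) _ _).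
  - apply (is_lim_seq_incr_1 (fun n => circle_L1 n (dil a r))), M1_lim; auto.
  - intros n. eapply Rle_trans; [|apply circle_L1_coef0; lia]. unfold dil. rewrite Cmult_1_r. lra.
Qed.

Section H1.
Variables (alpha C0 : R).
Hypotheses (Ha : 0 < alpha) (HC : 0 < C0).
Hypothesis HK : forall n, mean (fun t => Rabs (ces_kernel alpha n t)) <= C0.
Let C1 := 1 + (1 + exp 1) * (C0 * C0).

Lemma M1_sigma (a : nat -> C) n r : holo_disk a -> 0 <= r < 1 -> M1 (sigma_na alpha n a) r <= C1 * M1 a r.
Proof.
  intros Hh Hr.
  apply (lim_seq_le_le (fun j => circle_L1 j (dil (sigma_na alpha n a) r)) (fun j => C1 * circle_L1 j (dil a r))).
  - apply M1_lim; auto. apply sigma_na_holo; auto.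
  - apply is_lim_seq_mult'; [apply is_lim_seq_const|apply M1_lim; auto].
  - intros j. eapply Rle_trans; [|apply (circle_L1_sigma alpha C0 Ha HC HK j n (dil a r))].
    right. apply circle_L1_ext; intros k _. unfold dil. rewrite !sigma_na_mult. ring.
Qed.

Lemma M1_mono (a : nat -> C) s r : holo_disk a -> 0 <= s <= r -> r < 1 -> M1 a s <= M1 a r.
Proof.
  intros Hh Hs Hr. destruct (Req_dec s 0) as [->|Hs0]; [apply M1_zero_le; auto; lra|].
  apply (lim_seq_le_le (fun j => circle_L1 j (dil a s)) (fun j => circle_L1 j (dil a r))); try (apply M1_lim; auto; lra).
  intros j. eapply Rle_trans; [|apply (circle_L1_dil_le alpha C0 Ha HC HK j (dil a r) (s / r))].
  - right. apply circle_L1_ext; intros k _. unfold dil. rewrite <- Cmult_assoc, <- Cpow_mult_l, <- RtoC_mult.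
    do 3 f_equal. field; lra.
  - split; [apply Rdiv_lt_0_compat; lra|]. apply Rmult_le_reg_r with r; [lra|].
    unfold Rdiv. rewrite Rmult_assoc, Rinv_l; lra.
Qed.

(** The split of [g] into an absolutely summable part and a remainder small in norm. Both are
    coefficient multipliers, so they commute with dilations and with [sigma_na]. *)
Definition gmain (r : R) (g : nat -> C) (k : nat) : C := (RtoC (smooth_mult r k) * g k)%C.
Definition grest (r : R) (g : nat -> C) (k : nat) : C := (RtoC (1 - smooth_mult r k) * g k)%C.

Lemma gsplit r g k : g k = (grest r g k + gmain r g k)%C.
Proof. unfold grest, gmain. rewrite RtoC_minus. ring. Qed.

Lemma pow_le_1 r k : 0 < r <= 1 -> 0 < r ^ k <= 1.
Proof. intros Hr; split; [apply pow_lt; lra|]. rewrite <- (pow1 k). apply pow_incr; lra. Qed.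

Lemma grest_holo r g : 0 < r <= 1 -> holo_disk g -> holo_disk (grest r g).
Proof.
  intros Hr. apply holo_disk_dom with (C0 := 1). intros k. unfold grest. rewrite Cmod_mult, Cmod_R.
  apply Rmult_le_compat_r; [apply Cmod_ge_0|]. assert (S := smooth_mult_bound r k Hr).
  assert (P := pow_le_1 r k Hr). apply Rabs_le; lra.
Qed.

Lemma gmain_holo r g : 0 < r <= 1 -> holo_disk g -> holo_disk (gmain r g).
Proof.
  intros Hr. apply holo_disk_dom with (C0 := 2). intros k. unfold gmain. rewrite Cmod_mult, Cmod_R.
  apply Rmult_le_compat_r; [apply Cmod_ge_0|]. assert (S := smooth_mult_bound r k Hr).
  assert (P := pow_le_1 r k Hr). apply Rabs_le; lra.
Qed.

Lemma gmain_summable r g : 0 < r < 1 -> holo_disk g -> exists B, forall n, rsum (fun k => Cmod (gmain r g k)) n <= B.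
Proof.
  intros Hr Hg. exists (2 * Series (fun k => Cmod (g k) * r ^ k)). intros n.
  assert (Hs := holo_disk_R g r Hg ltac:(lra)).
  apply Rle_trans with (2 * rsum (fun k => Cmod (g k) * r ^ k) n).
  - rewrite <- rsum_scal. apply rsum_le; intros k _. unfold gmain. rewrite Cmod_mult, Cmod_R.
    assert (S := smooth_mult_bound r k ltac:(lra)). rewrite Rabs_pos_eq by lra.
    assert (K := Cmod_ge_0 (g k)). nra.
  - apply Rmult_le_compat_l; [lra|]. apply rsum_le_Series; auto.
    intros k. apply Rmult_le_pos; [apply Cmod_ge_0|apply pow_le; lra].
Qed.

Lemma M1_grest_le g s r lam : holo_disk g -> 0 <= s < 1 -> 0 < r <= 1 -> 0 < lam ->
  M1 (grest r g) s <= lam * (M1 g s - M1 g (s * r)) + exp 1 * C0 ^ 2 / lam * M1 g s.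
Proof.
  intros Hg Hs Hr Hlam.
  apply (lim_seq_le_le (fun j => circle_L1 j (dil (grest r g) s))
    (fun j => lam * (circle_L1 j (dil g s) - circle_L1 j (dil g (s * r))) + exp 1 * C0 ^ 2 / lam * circle_L1 j (dil g s))).
  - apply M1_lim; auto. apply grest_holo; auto.
  - apply is_lim_seq_plus'; apply is_lim_seq_mult'; try apply is_lim_seq_const; [|apply M1_lim; auto].
    apply is_lim_seq_minus'; apply M1_lim; auto. nra.
  - intros j. rewrite (circle_L1_ext j (dil (grest r g) s) (fun k => RtoC (1 - smooth_mult r k) * dil g s k)%C)
      by (intros; unfold dil, grest; ring).
    rewrite (circle_L1_ext j (dil g (s * r)) (dil (dil g s) r)).
    + apply (circle_L1_smoothing alpha C0 Ha HC HK); auto.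
    + intros k _. unfold dil. rewrite RtoC_mult, Cpow_mult_l. ring.
Qed.

(** [lam] is fixed before [r]: it brings the term in [/ lam] below [eta / 2]. The variation of
    [M1 g] near the circle is then brought below [del = eta / (2 * lam)], using that [G] is the
    supremum of an increasing function. *)
Lemma H1_smoothing g : in_H1 g -> forall eta, 0 < eta -> exists r, 0 < r < 1 /\
  forall s, 0 <= s < 1 -> M1 (grest r g) s <= eta.
Proof.
  intros [Hg Hn] eta Heta. unfold H1_norm in Hn.
  destruct (Lub_Rbar_correct (fun m => exists r, 0 <= r < 1 /\ m = M1 g r)) as [Hub Hlb].
  destruct (Lub_Rbar (fun m => exists r, 0 <= r < 1 /\ m = M1 g r)) as [G| |]; simpl in Hn; try contradiction.
  (* The supremum of a nonempty set is not minus infinity. *)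
  2:{ exfalso. apply (Hub (M1 g 0)). exists 0; split; auto; lra. }
  assert (HG : forall r, 0 <= r < 1 -> M1 g r <= G) by (intros r Hr; apply (Hub (M1 g r)); exists r; auto).
  assert (M0 : 0 <= M1 g 0).
  { apply (lim_seq_le_le (fun _ => 0) (fun n => circle_L1 n (dil g 0))); [apply is_lim_seq_const|apply M1_lim; auto; lra|].
    intros; apply circle_L1_nonneg. }
  assert (HG0 : 0 <= G) by (eapply Rle_trans; [exact M0|apply HG; lra]).
  set (X := exp 1 * C0 ^ 2 * G). assert (HX : 0 <= X).
  { unfold X. apply Rmult_le_pos; auto. apply Rmult_le_pos; [left; apply exp_pos|apply pow2_ge_0]. }
  set (lam := 1 + 2 * X / eta).
  assert (HXe : 0 <= 2 * X / eta) by (apply Rmult_le_pos; [lra|left; apply Rinv_0_lt_compat; auto]).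
  assert (Hlam : 0 < lam) by (unfold lam; lra).
  set (del := eta / (2 * lam)). assert (Hdel : 0 < del) by (apply Rdiv_lt_0_compat; lra).
  assert (Ex : exists s0, 0 <= s0 < 1 /\ G - del < M1 g s0).
  { destruct (classic (exists s0, 0 <= s0 < 1 /\ G - del < M1 g s0)) as [E|E]; auto. exfalso.
    assert (K : Rbar_le G (G - del)).
    { apply Hlb. intros m [r [Hr ->]]. simpl. destruct (Rle_lt_dec (M1 g r) (G - del)); auto.
      exfalso; apply E; eauto. }
    simpl in K. lra. }
  destruct Ex as [s0 [Hs0 HMs0]].
  (* The maximum with one half keeps the radius positive. *)
  set (s1 := Rmax s0 (/ 2)).
  assert (Hs1 : s0 <= s1 /\ 0 < s1 < 1).
  { unfold s1. assert (K1 := Rmax_l s0 (/ 2)). assert (K2 := Rmax_r s0 (/ 2)).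
    assert (Rmax s0 (/ 2) < 1) by (apply Rmax_lub_lt; lra). lra. }
  assert (HMs1 : G - del < M1 g s1) by (eapply Rlt_le_trans; [exact HMs0|apply M1_mono; auto; lra]).
  (* With a square root, [s >= r] forces [s * r >= s1], so [M1 g s] and [M1 g (s * r)] both lie
     between [G - del] and [G]. Radii below [r] follow by [M1_mono]. *)
  set (r := sqrt s1).
  assert (Hrr : r * r = s1) by (apply sqrt_sqrt; lra).
  assert (Hr0 : 0 < r) by (apply sqrt_lt_R0; lra).
  assert (Hr1 : r < 1) by nra.
  exists r; split; auto.
  assert (Big : forall s, r <= s < 1 -> M1 (grest r g) s <= eta).
  { intros s Hs. eapply Rle_trans; [apply (M1_grest_le g s r lam); auto; lra|].
    assert (K1 := HG s ltac:(lra)).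
    assert (K2 : G - del < M1 g (s * r)).
    { eapply Rlt_le_trans; [exact HMs1|]. apply M1_mono; auto; [split; [lra|nra]|nra]. }
    assert (K3 : lam * (M1 g s - M1 g (s * r)) <= lam * del) by (apply Rmult_le_compat_l; lra).
    assert (K4 : exp 1 * C0 ^ 2 / lam * M1 g s <= X / lam).
    { unfold X. replace (exp 1 * C0 ^ 2 * G / lam) with (exp 1 * C0 ^ 2 / lam * G) by (field; lra).
      apply Rmult_le_compat_l; auto. apply Rmult_le_pos; [|left; apply Rinv_0_lt_compat; auto].
      apply Rmult_le_pos; [left; apply exp_pos|apply pow2_ge_0]. }
    assert (K5 : lam * del = eta / 2) by (unfold del; field; lra).
    assert (K6 : X / lam <= eta / 2).
    { apply Rmult_le_reg_r with lam; auto. unfold Rdiv at 1. rewrite Rmult_assoc, Rinv_l, Rmult_1_r by lra.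
      unfold lam. replace (eta / 2 * (1 + 2 * X / eta)) with (eta / 2 + X) by (field; lra). lra. }
    lra. }
  intros s Hs. destruct (Rle_lt_dec r s) as [L|L]; [apply Big; lra|].
  eapply Rle_trans; [apply (M1_mono _ s r); try lra; apply grest_holo; auto; lra|]. apply Big; lra.
Qed.

Lemma ces_mult_tannery (b : nat -> R) B : (forall k, 0 <= b k) -> (forall n, rsum b n <= B) ->
  forall eps, 0 < eps -> exists N, forall n, (N <= n)%nat ->
  forall m, rsum (fun k => (1 - ces_mult alpha n k) * b k) m <= eps.
Proof.
  intros Hb HB eps He.
  destruct (tannery eventually (fun n k => 1 - ces_mult alpha n k) b 1 B Hb HB) with (eps := eps) as [N HN]; auto.
  - lra.
  - apply filter_forall. intros n k. assert (K := ces_mult_bound alpha n k Ha). lra.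
  - intros k e He'. assert (L := ces_mult_lim alpha k Ha). apply is_lim_seq_spec in L.
    destruct (L (mkposreal e He')) as [N HN]. exists N; intros n Hn. specialize (HN n Hn). simpl in HN.
    apply Rabs_def2 in HN. lra.
  - exists N; auto.
Qed.

(** On [grest] uniform boundedness of the means suffices; on [gmain] the coefficient moduli are
    summable and dominate. [eta] is chosen so that [C1 * eta + eta = eps / 2]. *)
Lemma sigma_H1 g : in_H1 g -> forall eps, 0 < eps -> exists N, forall n, (N <= n)%nat ->
  Rbar_le (H1_norm (csub (sigma_na alpha n g) g)) (Finite eps).
Proof.
  intros Hg eps He. assert (Hh := proj1 Hg).
  assert (HC1 : 1 < C1).
  { unfold C1. assert (0 < (1 + exp 1) * (C0 * C0)); [|lra].
    apply Rmult_lt_0_compat; [assert (K := exp_pos 1); lra|apply Rmult_lt_0_compat; auto]. }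
  set (eta := eps / (2 * (C1 + 1))). assert (Heta : 0 < eta) by (apply Rdiv_lt_0_compat; lra).
  destruct (H1_smoothing g Hg eta Heta) as [r [Hr Hrest]].
  destruct (gmain_summable r g Hr Hh) as [B HB].
  destruct (ces_mult_tannery (fun k => Cmod (gmain r g k)) B (fun k => Cmod_ge_0 _) HB (eps / 2)) as [N HN]; [lra|].
  exists N; intros n Hn. apply Lub_Rbar_le. intros m [s [Hs ->]].
  assert (HR : holo_disk (grest r g)) by (apply grest_holo; auto; lra).
  assert (HM : holo_disk (gmain r g)) by (apply gmain_holo; auto; lra).
  assert (HsR := sigma_na_holo alpha n _ Ha HR). assert (HsM := sigma_na_holo alpha n _ Ha HM).
  assert (K0 : M1 (csub (sigma_na alpha n g) g) s
    <= M1 (csub (sigma_na alpha n (grest r g)) (grest r g)) s + M1 (csub (gmain r g) (sigma_na alpha n (gmain r g))) s).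
  { eapply Rle_trans; [|apply M1_csub_le; auto using holo_disk_csub]. right.
    assert (EE : forall z, peval (csub (sigma_na alpha n g) g) z
      = peval (csub (csub (sigma_na alpha n (grest r g)) (grest r g)) (csub (gmain r g) (sigma_na alpha n (gmain r g)))) z).
    { intros z. assert (E : forall k, csub (sigma_na alpha n g) g k
        = csub (csub (sigma_na alpha n (grest r g)) (grest r g)) (csub (gmain r g) (sigma_na alpha n (gmain r g))) k).
      { intros k. unfold csub. rewrite !sigma_na_mult. rewrite (gsplit r g k). ring. }
      unfold peval. f_equal; apply Series_ext; intros k; rewrite E; auto. }
    apply mean_ext; intros t. rewrite EE; auto. }
  assert (K1 : M1 (csub (sigma_na alpha n (grest r g)) (grest r g)) s <= C1 * eta + eta).
  { eapply Rle_trans; [apply M1_csub_le; auto|]. apply Rplus_le_compat; [|apply Hrest; auto].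
    eapply Rle_trans; [apply M1_sigma; auto|]. apply Rmult_le_compat_l; [lra|apply Hrest; auto]. }
  assert (K2 : M1 (csub (gmain r g) (sigma_na alpha n (gmain r g))) s <= eps / 2).
  { apply M1_sum_bound; auto using holo_disk_csub. intros j. eapply Rle_trans; [|apply (HN n Hn j)].
    right. apply rsum_ext; intros k _. unfold csub. rewrite sigma_na_mult.
    replace (gmain r g k - RtoC (ces_mult alpha n k) * gmain r g k)%C
      with (RtoC (1 - ces_mult alpha n k) * gmain r g k)%C by (rewrite RtoC_minus; ring).
    rewrite Cmod_mult, Cmod_R, Rabs_pos_eq; auto. assert (K := ces_mult_bound alpha n k Ha). lra. }
  assert (C1 * eta + eta = eps / 2) by (unfold eta; field; lra). lra.
Qed.

(** * Weak-star convergence in BMOA *)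

Lemma in_BMOA_gap h : in_BMOA h -> exists B M, 0 < M /\ l2le h B /\ forall z, Cmod z < 1 -> gap_le h z (M ^ 2).
Proof.
  intros [H2 Hn]. destruct (in_H2_l2le h H2) as [B HB].
  assert (HL : Rbar_lt (Lub_Rbar (fun s => exists z : C, Cmod z < 1 /\ s = sqrt (bmo_gap h z))) p_infty).
  { unfold BMOA_norm in Hn. destruct (Lub_Rbar _) as [l| |]; simpl in *; auto. }
  destruct (Lub_Rbar_bounded _ HL) as [M0 HM0].
  assert (HM00 : 0 <= M0).
  { eapply Rle_trans; [apply sqrt_pos|apply HM0]. exists (RtoC 0). split; [rewrite Cmod_0; lra|reflexivity]. }
  (* The bound is raised by 1 to be positive, as [fefferman] requires. *)
  exists B, (M0 + 1); repeat split; auto; [lra|]. intros z Hz N.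
  eapply Rle_trans; [apply (garsia_gap_ge h z B N HB Hz)|].
  rewrite <- (bmo_gap_garsia_gap h B z HB Hz).
  assert (K := HM0 _ (ex_intro _ z (conj Hz eq_refl))).
  assert (Q := garsia_gap_nonneg h z B HB Hz). rewrite <- (bmo_gap_garsia_gap h B z HB Hz) in Q.
  rewrite <- (sqrt_sqrt (bmo_gap h z)) by auto. assert (P := sqrt_pos (bmo_gap h z)). nra.
Qed.

Lemma pairing_eq g h L :
  (forall eps, 0 < eps -> at_left 1 (fun r =>
     Cmod (Cmean (fun t => peval g (RtoC r * cis t) * peval h (RtoC r * cis (- t)))%C - L)%C <= eps)) ->
  pairing g h = L.
Proof.
  intros H. apply C_ext; apply lim_left1_eq; intros e He; generalize (H e He); apply filter_imp; intros r Hr.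
  - eapply Rle_trans; [|exact Hr]. apply (re_le_Cmod (Cmean _ - L)%C).
  - eapply Rle_trans; [|exact Hr]. apply (Im_le_Cmod (Cmean _ - L)%C).
Qed.

(** Partial sums converge uniformly on the circle. Since [cis (- t)] is [Cconj (cis t)],
    orthogonality applies to the product and yields the weights [r ^ (2 * k)]. *)
Lemma Cmean_pairing (g h : nat -> C) r : holo_disk g -> holo_disk h -> 0 <= r < 1 ->
  clim (fun n => csum (fun k => g k * h k * RtoC (r ^ (2 * k)))%C n)
    (Cmean (fun t => peval g (RtoC r * cis t) * peval h (RtoC r * cis (- t)))%C).
Proof.
  intros Hg Hh Hr e He.
  destruct (pev_unif_bound g r Hg Hr) as [K1 [HK1 [B1 B1']]].
  destruct (pev_unif_bound h r Hh Hr) as [K2 [HK2 [B2 B2']]].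
  set (d := e / (K1 + K2)). assert (Hd : 0 < d) by (apply Rdiv_lt_0_compat; lra).
  destruct (peval_unif g r Hg Hr d Hd) as [N1' HN1]. destruct (peval_unif h r Hh Hr d Hd) as [N2' HN2].
  exists (N1' + N2')%nat; intros n Hn.
  assert (Z1 : forall t, Cmod (RtoC r * cis t)%C <= r) by (intros; rewrite Cmod_r_cis; lra).
  assert (cneg : ccont (fun t => cis (- t))) by (apply (ccont_comp cis (fun t => - t)); auto with cont).
  replace (csum (fun k => g k * h k * RtoC (r ^ (2 * k)))%C n)
    with (Cmean (fun t => pev g n (RtoC r * cis t) * pev h n (RtoC r * cis (- t)))%C).
  - apply Cmean_sub_le.
    + apply ccont_mult; apply ccont_pev; auto with cont.
    + apply ccont_mult; [apply ccont_peval_cis; auto|].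
      apply ccont_peval with r; auto with cont.
    + intros t. set (x := pev g n _). set (y := pev h n _). set (x' := peval g _). set (y' := peval h _).
      replace (x * y - x' * y')%C with ((x - x') * y + x' * (y - y'))%C by ring.
      eapply Rle_trans; [apply Cmod_triangle|]. rewrite !Cmod_mult.
      assert (Q1 : Cmod (x - x')%C <= d) by (apply HN1; auto; lia).
      assert (Q2 : Cmod (y - y')%C <= d) by (apply HN2; auto; lia).
      assert (Q3 : Cmod y <= K2) by (apply B2; auto). assert (Q4 : Cmod x' <= K1) by (apply B1'; auto).
      assert (Q5 : d * (K1 + K2) = e) by (unfold d; field; lra).
      assert (Cmod (x - x')%C * Cmod y <= d * K2) by (apply Rmult_le_compat; auto; apply Cmod_ge_0).
      assert (Cmod x' * Cmod (y - y')%C <= K1 * d) by (apply Rmult_le_compat; auto; apply Cmod_ge_0).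
      lra.
  - rewrite (Cmean_ext _ (fun t => pev (dil g r) n (cis t) * Cconj (pev (fun k => Cconj (dil h r k)) n (cis t)))%C).
    + rewrite Cmean_pev_conj. apply csum_ext; intros k _. rewrite Cconj_conj. unfold dil.
      rewrite RtoC_pow. replace (2 * k)%nat with (k + k)%nat by lia. rewrite Cpow_add_r. ring.
    + intros t. rewrite pev_conj, Cconj_conj, cis_neg, !peval_dil. auto.
Qed.

Lemma at_left1_Cmod_sum (f : nat -> C) n eps : 0 < eps ->
  at_left 1 (fun r => 0 < r < 1 /\ Cmod (csum (fun k => f k * RtoC (1 - r ^ (2 * k)))%C n) <= eps).
Proof.
  intros He. set (S0 := rsum (fun k => Cmod (f k)) n).
  assert (HS : 0 <= S0) by (apply rsum_nonneg; intros; apply Cmod_ge_0).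
  assert (Hd : 0 < eps / (S0 + 1)) by (apply Rdiv_lt_0_compat; lra).
  generalize (at_left1_pow (2 * n) _ Hd). apply filter_imp; intros r [Hr Hp]. split; auto.
  eapply Rle_trans; [apply csum_Cmod_le|].
  apply Rle_trans with (rsum (fun k => eps / (S0 + 1) * Cmod (f k)) n).
  - apply rsum_le; intros k Hk. rewrite Cmod_mult, Cmod_R, Rmult_comm.
    apply Rmult_le_compat_r; [apply Cmod_ge_0|].
    assert (K := pow_1_minus r (2 * k) ltac:(lra)). rewrite Rabs_pos_eq by lra.
    eapply Rle_trans; [|exact Hp].
    replace (2 * n)%nat with (2 * k + (2 * n - 2 * k))%nat by lia. rewrite pow_add.
    assert (K2 := pow_le_1 r (2 * n - 2 * k) ltac:(lra)). assert (0 <= r ^ (2 * k)) by (apply pow_le; lra). nra.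
  - rewrite rsum_scal. fold S0. assert (eps / (S0 + 1) * (S0 + 1) = eps) by (field; lra). nra.
Qed.

Lemma pairing_sigma (g h : nat -> C) n : holo_disk g -> holo_disk h ->
  pairing g (sigma_na alpha n h) = csum (fun k => RtoC (ces_mult alpha n k) * (g k * h k))%C (S n).
Proof.
  intros Hg Hh. apply pairing_eq; intros e He.
  assert (Hs := sigma_na_holo alpha n h Ha Hh).
  generalize (at_left1_Cmod_sum (fun k => RtoC (ces_mult alpha n k) * (g k * h k))%C (S n) e He).
  apply filter_imp; intros r [Hr Hsum].
  replace (Cmean _) with (csum (fun k => g k * sigma_na alpha n h k * RtoC (r ^ (2 * k)))%C (S n)).
  - rewrite <- csum_minus. rewrite <- (Cmod_opp (csum _ _)).
    rewrite (csum_ext _ (fun k => (-1) * (RtoC (ces_mult alpha n k) * (g k * h k) * RtoC (1 - r ^ (2 * k))))%C).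
    + rewrite csum_scal. replace (- (-1 * csum (fun k => RtoC (ces_mult alpha n k) * (g k * h k) * RtoC (1 - r ^ (2 * k))) (S n)))%C
        with (csum (fun k => RtoC (ces_mult alpha n k) * (g k * h k) * RtoC (1 - r ^ (2 * k)))%C (S n)); auto.
      generalize (csum (fun k => RtoC (ces_mult alpha n k) * (g k * h k) * RtoC (1 - r ^ (2 * k)))%C (S n)).
      intros [? ?]; apply C_ext; simpl; ring.
    + intros k _. rewrite sigma_na_mult, RtoC_minus.
      generalize (RtoC (r ^ (2 * k))), (RtoC (ces_mult alpha n k)), (g k), (h k).
      intros [? ?] [? ?] [? ?] [? ?]; apply C_ext; simpl; ring.
  - apply clim_unique with (fun m => csum (fun k => g k * sigma_na alpha n h k * RtoC (r ^ (2 * k)))%C m).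
    + apply (clim_eventually_const _ _ (S n)). intros m Hm. apply csum_trunc; auto.
      intros k Hk. rewrite sigma_na_mult, ces_mult_0 by lia. ring.
    + apply Cmean_pairing; auto; lra.
Qed.

(** [N] precedes the neighbourhood of 1, and [n] comes after [r]: comparing one circle mean with all
    late sums at once yields both the existence of the limit defining [pairing g h] and its
    value. *)
Lemma pairing_main (g h : nat -> C) : in_H1 g -> in_BMOA h -> forall eps, 0 < eps ->
  exists N, at_left 1 (fun r => forall n, (N <= n)%nat ->
    Cmod (Cmean (fun t => peval g (RtoC r * cis t) * peval h (RtoC r * cis (- t)))
      - csum (fun k => RtoC (ces_mult alpha n k) * (g k * h k)) (S n))%C <= eps).
Proof.
  intros Hg Hb eps He. assert (Hgh := proj1 Hg).
  destruct (in_BMOA_gap h Hb) as [B [M [HM [HB Hgap]]]]. assert (Hhh := l2le_holo h B HB).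
  set (Ch := Cmod (h O) + (1 + exp 1) * (C0 * M)).
  assert (HCh : 0 < Ch).
  { unfold Ch. assert (K1 := Cmod_ge_0 (h O)). assert (K2 := exp_pos 1).
    assert (0 < (1 + exp 1) * (C0 * M)) by (apply Rmult_lt_0_compat; [lra|apply Rmult_lt_0_compat; auto]). lra. }
  assert (F : forall n p, Cmod (csum (fun k => p k * h k)%C n) <= Ch * circle_L1 n p)
    by (intros; apply (fefferman alpha C0 p h n M); auto).
  assert (HC1 : 1 < C1).
  { unfold C1. assert (0 < (1 + exp 1) * (C0 * C0)); [|lra].
    apply Rmult_lt_0_compat; [assert (K := exp_pos 1); lra|apply Rmult_lt_0_compat; auto]. }
  (* The error has four parts of [eps / 4]. The bound [2 * eta] in [NB] absorbs the passage from
     [M1] to polynomials. *)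
  set (eta := eps / (8 * Ch * C1)).
  assert (Heta : 0 < eta) by (apply Rdiv_lt_0_compat; auto; apply Rmult_lt_0_compat; lra).
  assert (Eeta : Ch * (C1 * (2 * eta)) = eps / 4) by (unfold eta; field; lra).
  destruct (H1_smoothing g Hg eta Heta) as [r0 [Hr0 Hrest]].
  set (gd := grest r0 g) in *. set (gm := gmain r0 g).
  assert (Hgd : holo_disk gd) by (apply grest_holo; auto; lra).
  destruct (gmain_summable r0 g Hr0 Hgh) as [Bm HBm]. fold gm in HBm.
  assert (NB : forall r, 0 <= r < 1 -> exists J, forall j, (J <= j)%nat -> circle_L1 j (dil gd r) <= 2 * eta).
  { intros r Hr. assert (L := M1_lim gd r Hgd Hr). apply is_lim_seq_spec in L.
    destruct (L (mkposreal eta Heta)) as [J HJ]. exists J; intros j Hj. specialize (HJ j Hj). simpl in HJ.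
    apply Rabs_def2 in HJ. specialize (Hrest r Hr). lra. }
  set (bk := fun k => Cmod (gm k * h k)%C).
  set (Bh := sqrt B).
  assert (HBh : forall k, Cmod (h k) <= Bh).
  { intros k. unfold Bh. rewrite <- (sqrt_pow2 (Cmod (h k))) by apply Cmod_ge_0. apply sqrt_le_1_alt, l2le_coef; auto. }
  assert (Hbk0 : forall k, 0 <= bk k) by (intros; apply Cmod_ge_0).
  assert (Hbk : forall n, rsum bk n <= Bh * Bm).
  { intros n. apply Rle_trans with (Bh * rsum (fun k => Cmod (gm k)) n).
    - rewrite <- rsum_scal. apply rsum_le; intros k _. unfold bk. rewrite Cmod_mult, Rmult_comm.
      apply Rmult_le_compat_r; [apply Cmod_ge_0|auto].
    - apply Rmult_le_compat_l; [apply sqrt_pos|auto]. }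
  destruct (ces_mult_tannery bk _ Hbk0 Hbk (eps / 4)) as [N HN]; [lra|].
  exists N.
  assert (T0 := at_left1_gt 0 ltac:(lra)).
  assert (T : at_left 1 (fun r => forall m, rsum (fun k => (1 - r ^ (2 * k)) * bk k) m <= eps / 4)).
  { apply (tannery (at_left 1) (fun r k => 1 - r ^ (2 * k)) bk 1 (Bh * Bm)); auto; [lra | | |lra].
    - revert T0; apply filter_imp; intros r Hr k. assert (H := pow_1_minus r (2 * k) ltac:(lra)).
      assert (H1 : 0 <= r ^ (2 * k)) by (apply pow_le; lra). lra.
    - intros k e He'. generalize (at_left1_pow (2 * k) e He'). apply filter_imp; tauto. }
  generalize (filter_and _ _ T0 T). apply filter_imp. intros r [Hr HT] n Hn.
  set (Sn := csum (fun k => RtoC (ces_mult alpha n k) * (g k * h k))%C (S n)).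
  (* The norm of [gd] is controlled only inside the disk. A dilation by [q * q] is inserted,
     [fefferman] and [circle_L1_sigma] are applied to it, and in this finite sum [q] may tend to
     1. *)
  assert (D2 : Cmod (csum (fun k => RtoC (ces_mult alpha n k) * (gd k * h k))%C (S n)) <= eps / 4).
  { apply le_epsilon; intros e2 He2.
    assert (PF : ProperFilter (at_left 1)) by apply at_left_proper_filter.
    destruct (filter_ex (F := at_left 1) _ (at_left1_Cmod_sum (fun k => RtoC (ces_mult alpha n k) * (gd k * h k))%C (S n) e2 He2))
      as [q [Hq Hqs]].
    destruct (NB (q * q) ltac:(nra)) as [J HJ].
    set (c2 := csum (fun k => RtoC (ces_mult alpha n k) * (gd k * h k) * RtoC (q ^ (2 * k)))%C (S n)).
    assert (Ec : csum (fun k => RtoC (ces_mult alpha n k) * (gd k * h k))%C (S n)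
      = (c2 + csum (fun k => RtoC (ces_mult alpha n k) * (gd k * h k) * RtoC (1 - q ^ (2 * k)))%C (S n))%C).
    { unfold c2. rewrite <- csum_plus. apply csum_ext; intros k _. rewrite RtoC_minus. ring. }
    rewrite Ec. eapply Rle_trans; [apply Cmod_triangle|]. apply Rplus_le_compat; auto.
    assert (Ec2 : c2 = csum (fun k => sigma_na alpha n (dil gd (q * q)) k * h k)%C (S n + J)).
    { unfold c2. symmetry. rewrite (csum_trunc _ (S n)); [|lia|].
      - apply csum_ext; intros k _. rewrite sigma_na_mult. unfold dil.
        rewrite pow_mult, RtoC_pow. replace (q ^ 2) with (q * q) by ring. ring.
      - intros k Hk. rewrite sigma_na_mult, ces_mult_0 by lia. ring. }
    rewrite Ec2. eapply Rle_trans; [apply F|]. rewrite <- Eeta.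
    apply Rmult_le_compat_l; [lra|]. eapply Rle_trans; [apply (circle_L1_sigma alpha C0 Ha HC HK)|].
    fold C1. apply Rmult_le_compat_l; [lra|]. apply HJ; lia. }
  destruct (NB (r * r) ltac:(nra)) as [J HJ].
  apply clim_Cmod_le with (fun m => csum (fun k => g k * h k * RtoC (r ^ (2 * k)))%C m - Sn)%C.
  { apply clim_minus; [apply Cmean_pairing; auto; lra|apply (clim_eventually_const _ _ O); auto]. }
  exists (S n + J)%nat. intros m Hm.
  (* The part [gd] is small separately in the circle mean and in the Cesaro sum; for [gm] both are
     compared with the plain sum of [gm k * h k]. *)
  assert (E1 : (csum (fun k => g k * h k * RtoC (r ^ (2 * k))) m - Sn)%C
    = (csum (fun k => dil gd (r * r) k * h k) m
       - csum (fun k => RtoC (ces_mult alpha n k) * (gd k * h k)) (S n)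
       + csum (fun k => RtoC (1 - ces_mult alpha n k) * (gm k * h k)) m
       - csum (fun k => RtoC (1 - r ^ (2 * k)) * (gm k * h k)) m)%C).
  { assert (TR : forall f : nat -> C, csum (fun k => RtoC (ces_mult alpha n k) * f k)%C (S n)
       = csum (fun k => RtoC (ces_mult alpha n k) * f k)%C m).
    { intros f. symmetry. apply csum_trunc; [lia|]. intros k Hk. rewrite ces_mult_0 by lia. ring. }
    unfold Sn. rewrite (TR (fun k => g k * h k)%C), (TR (fun k => gd k * h k)%C).
    rewrite <- !csum_minus, <- csum_plus, <- csum_minus. apply csum_ext; intros k _.
    rewrite (gsplit r0 g k). fold gd gm. rewrite !RtoC_minus.
    assert (ED : dil gd (r * r) k = (gd k * RtoC (r ^ (2 * k)))%C).
    { unfold dil. rewrite pow_mult, RtoC_pow. replace (r ^ 2) with (r * r) by ring. auto. }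
    rewrite ED. ring. }
  rewrite E1.
  assert (A1 : Cmod (csum (fun k => dil gd (r * r) k * h k)%C m) <= eps / 4).
  { eapply Rle_trans; [apply F|]. assert (K := HJ m ltac:(lia)). rewrite <- Eeta.
    apply Rmult_le_compat_l; [lra|]. nra. }
  assert (A3 : Cmod (csum (fun k => RtoC (1 - ces_mult alpha n k) * (gm k * h k))%C m) <= eps / 4).
  { eapply Rle_trans; [apply csum_Cmod_le|]. eapply Rle_trans; [|apply (HN n Hn m)]. right.
    apply rsum_ext; intros k _. rewrite Cmod_mult, Cmod_R, Rabs_pos_eq; auto.
    assert (K := ces_mult_bound alpha n k Ha). lra. }
  assert (A4 : Cmod (csum (fun k => RtoC (1 - r ^ (2 * k)) * (gm k * h k))%C m) <= eps / 4).
  { eapply Rle_trans; [apply csum_Cmod_le|]. eapply Rle_trans; [|apply (HT m)]. right.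
    apply rsum_ext; intros k _. rewrite Cmod_mult, Cmod_R, Rabs_pos_eq; auto.
    assert (K := pow_1_minus r (2 * k) ltac:(lra)). lra. }
  assert (Q : forall x1 x2 x3 x4 : C, Cmod x1 <= eps / 4 -> Cmod x2 <= eps / 4 -> Cmod x3 <= eps / 4 ->
    Cmod x4 <= eps / 4 -> Cmod (x1 - x2 + x3 - x4)%C <= eps).
  { intros x1 x2 x3 x4 H1 H2 H3 H4. assert (Q1 := Cmod_triangle (x1 - x2 + x3)%C (- x4)%C).
    assert (Q2 := Cmod_triangle (x1 - x2)%C x3). assert (Q3 := Cmod_triangle x1 (- x2)%C).
    rewrite Cmod_opp in Q1, Q3. unfold Cminus in *. lra. }
  apply Q; auto.
Qed.

Lemma C_cauchy_lim (u : nat -> C) :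
  (forall eps, 0 < eps -> exists N, forall n m, (N <= n)%nat -> (N <= m)%nat -> Cmod (u n - u m)%C <= eps) ->
  exists l, clim u l.
Proof.
  intros H.
  assert (G : forall p : C -> R, (forall z w, Rabs (p z - p w) <= Cmod (z - w)%C) -> exists l : R, is_lim_seq (fun n => p (u n)) l).
  { intros p Hp.
    assert (E : ex_finite_lim_seq (fun n => p (u n))).
    { apply ex_lim_seq_cauchy_corr. intros [e He]. destruct (H (e / 2)) as [N HN]; [lra|].
      exists N; intros n m Hn Hm. simpl. eapply Rle_lt_trans; [apply Hp|]. specialize (HN n m Hn Hm). lra. }
    exact E. }
  destruct (G Re) as [a Ha'].
  { intros z w. apply (re_le_Cmod (z - w)%C). }
  destruct (G Im) as [b Hb'].
  { intros z w. apply (Im_le_Cmod (z - w)%C). }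
  exists (a, b). intros e He.
  apply is_lim_seq_spec in Ha'. apply is_lim_seq_spec in Hb'.
  assert (He2 : 0 < e / 2) by lra.
  destruct (Ha' (mkposreal _ He2)) as [N HN]. destruct (Hb' (mkposreal _ He2)) as [N' HN'].
  exists (N + N')%nat; intros n Hn. specialize (HN n ltac:(lia)). specialize (HN' n ltac:(lia)). simpl in HN, HN'.
  eapply Rle_trans; [apply Cmod_le_abs|]. unfold Cminus. rewrite Re_plus, Im_plus.
  change (Rabs (Re (u n) - a) + Rabs (Im (u n) - b) <= e). unfold Re, Im in *. lra.
Qed.

(** [pairing g h] is a chosen limit, so its existence belongs to the proof: [Main] makes [u] a
    Cauchy sequence, and the circle means defining the pairing then have the same limit. *)
Lemma sigma_weak_star h : in_BMOA h -> forall g, in_H1 g ->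
  filterlim (fun n : nat => pairing g (sigma_na alpha n h)) eventually (locally (pairing g h)).
Proof.
  intros Hb g Hg. assert (Hgh := proj1 Hg). assert (Hhh : holo_disk h) by apply Hb.
  set (u := fun n => pairing g (sigma_na alpha n h)).
  assert (Eu : forall n, u n = csum (fun k => RtoC (ces_mult alpha n k) * (g k * h k))%C (S n))
    by (intros n; exact (pairing_sigma g h n Hgh Hhh)).
  assert (PF : ProperFilter (at_left 1)) by apply at_left_proper_filter.
  assert (Main : forall eps, 0 < eps -> exists N, at_left 1 (fun r => forall n, (N <= n)%nat ->
    Cmod (Cmean (fun t => peval g (RtoC r * cis t) * peval h (RtoC r * cis (- t))) - u n)%C <= eps)).
  { intros eps He. destruct (pairing_main g h Hg Hb eps He) as [N HN]. exists N.
    revert HN; apply filter_imp; intros r HN n Hn. rewrite Eu. auto. }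
  destruct (C_cauchy_lim u) as [l Hl].
  { intros eps He. destruct (Main (eps / 2)) as [N HN]; [lra|]. exists N; intros n m Hn Hm.
    destruct (filter_ex _ HN) as [r Hr].
    assert (K1 := Hr n Hn). assert (K2 := Hr m Hm).
    eapply Rle_trans; [apply (Cmod_sub_trans _ (Cmean (fun t => peval g (RtoC r * cis t) * peval h (RtoC r * cis (- t)))%C))|].
    rewrite Cmod_minus_sym. lra. }
  assert (EL : pairing g h = l).
  { apply pairing_eq; intros e He. destruct (Main (e / 2)) as [N HN]; [lra|].
    revert HN; apply filter_imp; intros r Hr.
    destruct (Hl (e / 2)) as [N' HN']; [lra|].
    assert (K1 := Hr (N + N')%nat ltac:(lia)). assert (K2 := HN' (N + N')%nat ltac:(lia)).
    eapply Rle_trans; [apply (Cmod_sub_trans _ (u (N + N')%nat))|]. lra. }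
  rewrite EL. apply filterlim_locally. intros [e He]. destruct (Hl (e / 2)) as [N HN]; [lra|].
  exists N; intros n Hn. specialize (HN n Hn).
  assert (K1 := re_le_Cmod (u n - l)%C). assert (K2 := Im_le_Cmod (u n - l)%C).
  split; unfold ball; simpl; unfold AbsRing_ball, abs, minus, plus, opp; simpl.
  - eapply Rle_lt_trans; [exact K1|]. lra.
  - eapply Rle_lt_trans; [exact K2|]. lra.
Qed.

(** * Norm convergence in VMOA *)

Lemma l2le_sigma (f : nat -> C) B n : l2le f B -> l2le (sigma_na alpha n f) B.
Proof.
  intros Hf N. eapply Rle_trans; [|apply (Hf N)]. apply rsum_le; intros k _.
  apply pow_incr; split; [apply Cmod_ge_0|]. rewrite sigma_na_mult, Cmod_mult, Cmod_R.
  assert (K := ces_mult_bound alpha n k Ha). rewrite Rabs_pos_eq by lra.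
  assert (K2 := Cmod_ge_0 (f k)). nra.
Qed.

Lemma l2le_sigma_lim (f : nat -> C) B : l2le f B -> forall D, 0 < D ->
  exists N, forall n, (N <= n)%nat -> l2le (csub (sigma_na alpha n f) f) D.
Proof.
  intros Hf D HD.
  destruct (ces_mult_tannery (fun k => Cmod (f k) ^ 2) B (fun k => pow2_ge_0 _) Hf D HD) as [N HN].
  exists N; intros n Hn m. eapply Rle_trans; [|apply (HN n Hn m)]. apply rsum_le; intros k _.
  unfold csub. rewrite sigma_na_mult.
  replace (RtoC (ces_mult alpha n k) * f k - f k)%C with (- (RtoC (1 - ces_mult alpha n k) * f k))%C
    by (rewrite RtoC_minus; ring).
  assert (K := ces_mult_bound alpha n k Ha).
  rewrite Cmod_opp, Cmod_mult, Cmod_R, Rabs_pos_eq by lra.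
  rewrite Rpow_mult_distr. apply Rmult_le_compat_r; [apply pow2_ge_0|]. nra.
Qed.

(** Near the circle the gap of [f] is at most [e1], and that of the difference at most
    [2 * C0 ^ 2 * e1 + 2 * e1]. Where [Cmod z <= 1 - d] it is at most the $\ell^2$ error over
    [d ^ 2]. Both constants are set to give [eps ^ 2]. *)
Lemma sigma_VMOA f : in_VMOA f -> forall eps, 0 < eps -> exists N, forall n, (N <= n)%nat ->
  Rbar_le (BMOA_norm (csub (sigma_na alpha n f) f)) (Finite eps).
Proof.
  intros [Hb Hv] eps He. destruct (in_H2_l2le f (proj1 Hb)) as [B HB]. assert (Hh := l2le_holo f B HB).
  assert (Heps2 : 0 < eps ^ 2) by (apply pow_lt; auto).
  assert (HC2 : 0 < 2 * C0 ^ 2 + 2) by (assert (K := pow2_ge_0 C0); lra).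
  set (e1 := eps ^ 2 / (2 * C0 ^ 2 + 2)). assert (He1 : 0 < e1) by (apply Rdiv_lt_0_compat; auto).
  destruct (Hv e1 He1) as [d [Hd Hvd]].
  destruct (l2le_sigma_lim f B HB (eps ^ 2 * d ^ 2)) as [N HN];
    [apply Rmult_lt_0_compat; auto; apply pow_lt; auto|].
  exists N; intros n Hn. specialize (HN n Hn).
  assert (HsB := l2le_sigma f B n HB).
  assert (Gap : forall z, Cmod z < 1 -> bmo_gap (csub (sigma_na alpha n f) f) z <= eps ^ 2).
  { intros z Hz. rewrite (bmo_gap_garsia_gap _ _ z HN Hz).
    destruct (Rlt_le_dec (1 - d) (Cmod z)) as [L|L].
    - assert (G : forall w, Cmod w = Cmod z -> garsia_gap f w <= e1).
      { intros w Hw. rewrite <- (bmo_gap_garsia_gap f B w HB) by (rewrite Hw; auto).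
        eapply Rle_trans; [apply Rle_abs|]. apply Hvd. rewrite Hw; auto. }
      eapply Rle_trans; [apply (garsia_gap_csub _ f z B B); auto|].
      assert (G1 := G z eq_refl).
      assert (G2 : garsia_gap (sigma_na alpha n f) z <= C0 ^ 2 * e1).
      { apply (garsia_gap_le _ z B); auto. intros j.
        replace (C0 ^ 2 * e1) with ((C0 * sqrt e1) ^ 2) by (rewrite Rpow_mult_distr, pow2_sqrt; lra).
        apply (ces_gap alpha C0 n f z (sqrt e1)); auto; [apply sqrt_pos|].
        intros w Hw i. rewrite pow2_sqrt by lra. eapply Rle_trans; [|apply (G w Hw)].
        apply (garsia_gap_ge f w B i HB). rewrite Hw; auto. }
      assert ((2 * C0 ^ 2 + 2) * e1 = eps ^ 2) by (unfold e1; field; lra). lra.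
    - eapply Rle_trans; [apply (garsia_gap_l2 _ z _ HN Hz)|].
      apply Rmult_le_reg_r with ((1 - Cmod z) ^ 2); [apply pow_lt; lra|].
      unfold Rdiv. rewrite Rmult_assoc, Rinv_l, Rmult_1_r by (apply pow_nonzero; lra).
      apply Rmult_le_compat_l; [lra|]. apply pow_incr; lra. }
  unfold BMOA_norm.
  (* The multiplier at 0 is 1, so the constant terms cancel. *)
  assert (E0 : Cmod (peval (csub (sigma_na alpha n f) f) (RtoC 0)) = 0).
  { rewrite peval_0 by (apply (l2le_holo _ _ HN)). unfold csub. rewrite sigma_na_mult, ces_mult_O by auto.
    replace (RtoC 1 * f O - f O)%C with (RtoC 0) by ring. apply Cmod_0. }
  rewrite E0.
  assert (L : Rbar_le (Lub_Rbar (fun s => exists z : C, Cmod z < 1 /\ s = sqrt (bmo_gap (csub (sigma_na alpha n f) f) z))) (Finite eps)).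
  { apply Lub_Rbar_le. intros s [z [Hz ->]]. rewrite <- (sqrt_pow2 eps) by lra. apply sqrt_le_1_alt; auto. }
  destruct (Lub_Rbar _) as [l| |]; simpl in *; auto; lra.
Qed.
End H1.

Theorem theorem5p3 (alpha : R) (halpha : 0 < alpha) :
  (forall g : nat -> C, in_H1 g ->
     forall eps, 0 < eps -> exists N : nat, forall n : nat, (N <= n)%nat ->
       Rbar_le (H1_norm (csub (sigma_na alpha n g) g)) (Finite eps))
  /\
  (forall h : nat -> C, in_BMOA h ->
     forall g : nat -> C, in_H1 g ->
       filterlim (fun n : nat => pairing g (sigma_na alpha n h)) eventually
                 (locally (pairing g h)))
  /\
  (forall f : nat -> C, in_VMOA f ->
     forall eps, 0 < eps -> exists N : nat, forall n : nat, (N <= n)%nat ->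
       Rbar_le (BMOA_norm (csub (sigma_na alpha n f) f)) (Finite eps)).
Proof.
  destruct (ces_kernel_mean_bound alpha halpha) as [C0 [HC HK]].
  split; [|split].
  - exact (sigma_H1 alpha C0 halpha HC HK).
  - exact (sigma_weak_star alpha C0 halpha HC HK).
  - exact (sigma_VMOA alpha C0 halpha HC HK).
Qed.
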